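(* Let $(\overline M,\bar g)$ be a Riemannian manifold of dimension $m+n$ with a calibration $\Omega$ of rank $m\ge 2$ (not assumed parallel), and let $F:M\to\overline M$ be an immersed oriented submanifold of dimension $m$, with $\Omega$-angle $\theta$, mean curvature $H$ and induced metric $g$. Then for every compact domain $D$ of $M$, with boundary $\partial D$ with volume element $dA$, $$\left|\int_D\Big(-m\cos\theta\,\|H\|^2+\langle\nabla^{\bot}H,\Phi\rangle\Big)dV+\int_D\overline{\nabla}_H\Omega\right|\le\int_{\partial D}\sin\theta\,\|H\|\,dA,$$ where $\langle\cdot,\cdot\rangle$ is the Hilbert–Schmidt inner product in $TM^*\otimes NM$.
   Context: A calibration of rank $m$ on $(\overline M,\bar g)$ is a closed $m$-form $\Omega$ with comass one: at each $p\in\overline M$, $|\Omega(X_1,\dots,X_m)|\le 1$ for every orthonormal system $X_i\in T_p\overline M$, with equality for some system. $M$ carries the induced metric $g=F^*\bar g$ with volume element $dV$; $NM$ is the normal bundle with normal connection $\nabla^{\bot}$; $\overline\nabla$ is the Levi-Civita connection of $\overline M$; $B$ is the second fundamental form and $H=\frac1m\,\mathrm{trace}_g B$ the mean curvature vector. The $\Omega$-angle $\theta:M\to[0,\pi]$ is defined by $\cos\theta=\Omega(X_1,\dots,X_m)$ for a direct (positively oriented) orthonormal frame $X_i$ of $T_pM$. The morphism $\Phi:TM\to NM$ is defined by $\bar g(\Phi(X),U)=\Omega(U,*X)$ for $X\in T_pM$, $U\in NM_p$, where $*:TM\to\wedge^{m-1}TM$ is the star operator of $M$ (for a direct orthonormal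 basis, $*X_1=X_2\wedge\dots\wedge X_m$). A compact domain $D$ of $M$ is an open submanifold with compact closure and smooth boundary. $\int_D\overline\nabla_H\Omega$ is the integral over $D$ of the $m$-form $\overline\nabla_H\Omega$ restricted to $M$, i.e. of the function $(\overline\nabla_H\Omega)(X_1,\dots,X_m)$ against $dV$. *)

(* Defs.v *)
From HB Require Import structures.
From mathcomp Require Import all_boot all_order all_algebra.
From mathcomp Require Import all_classical all_reals all_analysis.

Set Implicit Arguments.
Unset Strict Implicit.
Unset Printing Implicit Defensive.

Import Order.TTheory GRing.Theory Num.Theory.
Import numFieldNormedType.Exports.

Local Open Scope classical_set_scope.
Local Open Scope ring_scope.

(* Tangent vectors are row vectors of components and a linear map acts on the
   right, as in the library's Jacobian: 'd f x v = v *m 'J f x.  In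
   particular the i-th row of 'J f x is the i-th partial derivative of f. *)

Section Calculus.
Context {R : realType}.

Fixpoint Ck d (W : normedModType R) (k : nat) (U : set 'rV[R]_d)
    (f : 'rV[R]_d -> W) : Prop :=
  (forall x, U x -> {for x, continuous f}) /\
  (if k is k'.+1 then
     forall i : 'I_d, (forall x, U x -> derivable f x (delta_mx 0 i)) /\
                      Ck k' U ('D_(delta_mx 0 i) f)
   else True).

Definition smooth_on d (W : normedModType R) (U : set 'rV[R]_d)
    (f : 'rV[R]_d -> W) : Prop :=
  forall k, Ck k U f.

Definition ip d (G : 'M[R]_d) (u v : 'rV[R]_d) : R := (u *m G *m v^T) 0 0.

(* The Lebesgue integral over R^d of a nonnegative Borel function, as an
   iterated integral (Tonelli). *)
Fixpoint lebesgue_int (d : nat) : ('rV[R]_d -> \bar R) -> \bar R :=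
  match d with
  | 0%N => fun f => f 0
  | k.+1 => fun f =>
      (\int[lebesgue_measure]_(t in [set: R])
         lebesgue_int (fun v : 'rV[R]_k =>
           f (row_mx (t%:M : 'M[R]_1) v : 'rV[R]_k.+1)))%E
  end.

End Calculus.

Record chart (R : realType) (d : nat) (T : topologicalType) := Chart {
  chart_dom : set T;
  chart_map : T -> 'rV[R]_d;
  chart_inv : 'rV[R]_d -> T;
  chart_dom_open : open chart_dom;
  chart_cod_open : open (chart_map @` chart_dom);
  chart_mapK : forall p, chart_dom p -> chart_inv (chart_map p) = p;
  chart_map_continuous : forall p, chart_dom p -> {for p, continuous chart_map};
  chart_inv_continuous :
    forall x, (chart_map @` chart_dom) x -> {for x, continuous chart_inv} }.

Section Charts.
Context {R : realType} {d : nat} {T : topologicalType}.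
Implicit Types c : chart R d T.

Definition chart_cod c : set 'rV[R]_d := chart_map c @` chart_dom c.
Definition chart_overlap c c' : set 'rV[R]_d :=
  chart_map c @` (chart_dom c `&` chart_dom c').
Definition transition c c' : 'rV[R]_d -> 'rV[R]_d :=
  fun x => chart_map c' (chart_inv c x).
Definition compatible c c' : Prop :=
  smooth_on (chart_overlap c c') (transition c c') /\
  smooth_on (chart_overlap c' c) (transition c' c).

End Charts.

Record manifold (R : realType) (d : nat) := Manifold {
  carrier :> ptopologicalType;
  manifold_hausdorff : hausdorff_space carrier;
  manifold_second_countable : @second_countable carrier;
  atlas : set (chart R d carrier);
  atlas_compatible :
    forall c c', atlas c -> atlas c' -> compatible c c';
  chart_at : carrier -> chart R d carrier;
  chart_at_atlas : forall p, atlas (chart_at p);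
  chart_at_dom : forall p, chart_dom (chart_at p) p }.

(* The charts of the maximal atlas. *)
Definition smooth_chart (R : realType) (d : nat) (M : manifold R d)
    (c : chart R d M) : Prop :=
  forall c', atlas c' -> compatible c c'.

(* An orientation is presented by an oriented atlas: the given atlas is the
   family of positive charts, while charts of the maximal atlas may reverse
   the orientation. *)
Definition oriented (R : realType) (d : nat) (M : manifold R d) : Prop :=
  forall c c' : chart R d M, atlas c -> atlas c' ->
    forall x, chart_overlap c c' x -> 0 < \det ('J (transition c c') x).

(* Tensor fields are families of components, indexed by the charts of the
   maximal atlas and given at the point of coordinates x; the values at other
   charts, or off the image of the chart, carry no meaning. *)

Record riem_metric (R : realType) (d : nat) (N : manifold R d) := Metric {
  met :> chart R d N -> 'rV[R]_d -> 'M[R]_d;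
  met_sym : forall c, smooth_chart c -> forall x, chart_cod c x ->
    (met c x)^T = met c x;
  met_pos : forall c, smooth_chart c -> forall x, chart_cod c x ->
    forall v, v != 0 -> 0 < ip (met c x) v v;
  met_smooth : forall c, smooth_chart c -> smooth_on (chart_cod c) (met c);
  met_change : forall c c', smooth_chart c -> smooth_chart c' ->
    forall x, chart_overlap c c' x ->
    met c x =
      'J (transition c c') x *m met c' (transition c c' x)
        *m ('J (transition c c') x)^T }.

(* The value of a k-form on k vectors, which are the rows of a matrix. *)
Record diff_form (R : realType) (d : nat) (N : manifold R d) (k : nat) := Form {
  formv :> chart R d N -> 'rV[R]_d -> 'M[R]_(k, d) -> R;
  form_multilinear : forall c, smooth_chart c -> forall x, chart_cod c x ->
    forall (A B C : 'M[R]_(k, d)) (i : 'I_k) (a b : R),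
      row i A = a *: row i B + b *: row i C ->
      row' i B = row' i A -> row' i C = row' i A ->
      formv c x A = a * formv c x B + b * formv c x C;
  form_alternate : forall c, smooth_chart c -> forall x, chart_cod c x ->
    forall (A : 'M[R]_(k, d)) (i j : 'I_k),
      i != j -> row i A = row j A -> formv c x A = 0;
  form_smooth : forall c, smooth_chart c -> forall A : 'M[R]_(k, d),
    smooth_on (chart_cod c) (fun x => formv c x A : R^o);
  form_change : forall c c', smooth_chart c -> smooth_chart c' ->
    forall x, chart_overlap c c' x -> forall A : 'M[R]_(k, d),
    formv c x A = formv c' (transition c c' x) (A *m 'J (transition c c') x) }.

Section Forms.
Context {R : realType} {d : nat} (N : manifold R d).

(* The exterior derivative, evaluated on coordinate-constant vector fields. *)
Definition dform k (w : diff_form N k) (c : chart R d N) (x : 'rV[R]_d)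
    (A : 'M[R]_(k.+1, d)) : R :=
  \sum_(i < k.+1) (-1) ^+ i * 'D_(row i A) (fun y => w c y (row' i A) : R^o) x.

Definition closed_form k (w : diff_form N k) : Prop :=
  forall c, smooth_chart c -> forall x, chart_cod c x ->
    forall A : 'M[R]_(k.+1, d), dform w c x A = 0.

Definition orthonormal_rows (g : riem_metric N) k c x (A : 'M[R]_(k, d)) : Prop :=
  A *m g c x *m A^T = 1%:M.

Definition comass_one (g : riem_metric N) k (w : diff_form N k) : Prop :=
  forall c, smooth_chart c -> forall x, chart_cod c x ->
    (forall A, orthonormal_rows g c x A -> `|w c x A| <= 1) /\
    (exists2 A, orthonormal_rows g c x A & `|w c x A| = 1).

Definition calibration (g : riem_metric N) k (w : diff_form N k) : Prop :=
  closed_form w /\ comass_one g w.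

End Forms.

(* Local geometry of an immersion f of an open subset of R^(m+1) into an open
   subset of R^d which carries a metric G and an (m+1)-form w.  Vectors tangent
   to the source have m+1 components; those along f have d components. *)
Section LocalGeometry.
Context {R : realType} (m d : nat).
Variables (f : 'rV[R]_m.+1 -> 'rV[R]_d) (G : 'rV[R]_d -> 'M[R]_d).
Variable w : 'rV[R]_d -> 'M[R]_(m.+1, d) -> R.
Implicit Types (x u v : 'rV[R]_m.+1) (y h U W : 'rV[R]_d).

Definition induced_gram x : 'M[R]_m.+1 := 'J f x *m G (f x) *m ('J f x)^T.

Definition is_normal x U : Prop :=
  forall u, ip (G (f x)) U (u *m 'J f x) = 0.

Definition normal_part x U : 'rV[R]_d :=
  U - U *m G (f x) *m ('J f x)^T *m invmx (induced_gram x) *m 'J f x.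

(* The Levi-Civita derivative of the coordinate-constant field k along h, from
   Koszul's formula; its components are the sums Gamma^a_bc h^b k^c. *)
Definition christoffel y h (k : 'rV[R]_d) : 'rV[R]_d :=
  2^-1 *: ((\row_e (ip ('D_h G y) k (delta_mx 0 e)
                    + ip ('D_k G y) h (delta_mx 0 e)
                    - ip ('D_(delta_mx 0 e) G y) h k)) *m invmx (G y)).

(* Levi-Civita derivative, along f, of a field U of vectors of R^d. *)
Definition covderiv x u (U : 'rV[R]_m.+1 -> 'rV[R]_d) : 'rV[R]_d :=
  'D_u U x + christoffel (f x) (u *m 'J f x) (U x).

Definition normal_connection x u (U : 'rV[R]_m.+1 -> 'rV[R]_d) : 'rV[R]_d :=
  normal_part x (covderiv x u U).

Definition second_fundamental x u v : 'rV[R]_d :=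
  normal_part x (covderiv x u (fun z => v *m 'J f z)).

Definition mean_curvature x : 'rV[R]_d :=
  (m.+1)%:R^-1 *: \sum_(i < m.+1) \sum_(j < m.+1)
    invmx (induced_gram x) i j *:
      second_fundamental x (delta_mx 0 i) (delta_mx 0 j).

Definition mean_curvature_norm x : R :=
  Num.sqrt (ip (G (f x)) (mean_curvature x) (mean_curvature x)).

(* A direct orthonormal frame: its vectors are the rows of the matrix. *)
Definition direct_frame x : 'M[R]_m.+1 :=
  xget 0 [set X : 'M[R]_m.+1 |
    X *m induced_gram x *m X^T = 1%:M /\ 0 < \det X].

Definition form_on_frame x : R := w (f x) (direct_frame x *m 'J f x).

Definition form_angle x : R := acos (form_on_frame x).

(* w(U, *v): on a direct orthonormal frame X_0, ..., X_m, the vector *X_i is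
   (-1)^i times the wedge of the X_j, j != i, in increasing order. *)
Definition form_star x U v : R :=
  \sum_(i < m.+1) ip (induced_gram x) v (row i (direct_frame x)) *
    ((-1) ^+ i *
     w (f x) (col_mx U (row' i (direct_frame x) *m 'J f x) : 'M[R]_(m.+1, d))).

Definition Phi x v : 'rV[R]_d :=
  xget 0 [set W | is_normal x W /\
    forall U, is_normal x U -> ip (G (f x)) W U = form_star x U v].

Definition hs_nablaH_Phi x : R :=
  \sum_(i < m.+1)
    ip (G (f x))
       (normal_connection x (row i (direct_frame x)) mean_curvature)
       (Phi x (row i (direct_frame x))).

Definition covderiv_form y h (A : 'M[R]_(m.+1, d)) : R :=
  'D_h (fun z => w z A : R^o) y
  - \sum_(i < m.+1)
      w y (\matrix_(j < m.+1)
             (if j == i then christoffel y h (row j A) else row j A)).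

Definition nablaH_form x : R :=
  covderiv_form (f x) (mean_curvature x) (direct_frame x *m 'J f x).

End LocalGeometry.

Notation borel M := (g_sigma_algebraType (@open (carrier M))).

Section Immersed.
Context {R : realType} {m d : nat}.
Variables (M : manifold R m.+1) (N : manifold R d).
Variables (g : riem_metric N) (w : diff_form N m.+1) (F : M -> N).

Definition local_map (c : chart R m.+1 M) (b : chart R d N) :
    'rV[R]_m.+1 -> 'rV[R]_d :=
  fun x => chart_map b (F (chart_inv c x)).

Definition immersion : Prop :=
  continuous F /\
  forall c b, smooth_chart c -> smooth_chart b ->
    let U := chart_map c @` (chart_dom c `&` F @^-1` chart_dom b) in
    smooth_on U (local_map c b) /\
    forall x, U x -> row_free ('J (local_map c b) x).

Definition at_point (A : Type)
    (e : ('rV[R]_m.+1 -> 'rV[R]_d) -> ('rV[R]_d -> 'M[R]_d) ->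
         ('rV[R]_d -> 'M[R]_(m.+1, d) -> R) -> 'rV[R]_m.+1 -> A) (p : M) : A :=
  let c := chart_at p in let b := chart_at (F p) in
  e (local_map c b) (g b) (w b) (chart_map c p).

Definition Omega_angle : M -> R := at_point (@form_angle R m d).
Definition normH (p : M) : R :=
  let c := chart_at p in let b := chart_at (F p) in
  mean_curvature_norm (local_map c b) (g b) (chart_map c p).

(* <nabla^perp H, Phi>, and the value of nabla_H Omega on a direct orthonormal
   frame of M. *)
Definition nablaH_Phi : M -> R := at_point (@hs_nablaH_Phi R m d).
Definition nablaH_Omega : M -> R := at_point (@nablaH_form R m d).

Definition gram (c : chart R m.+1 M) (x : 'rV[R]_m.+1) : 'M[R]_m.+1 :=
  let b := chart_at (F (chart_inv c x)) in
  induced_gram (local_map c b) (g b) x.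

(* The Riemannian volume measure of the induced metric is the Borel measure
   with density sqrt (det (g_ij)) in every chart. *)
Definition is_volume_measure (vol : {measure set (borel M) -> \bar R}) : Prop :=
  forall c, smooth_chart c -> forall A : set (borel M),
    measurable A -> A `<=` chart_dom c ->
    vol A = lebesgue_int (fun x =>
      (\1_(chart_map c @` A) x * Num.sqrt (\det (gram c x)))%:E).

Definition bdry (D : set M) : set M := closure D `\` D.

(* D lies on the side x_i < 0, and hence its boundary is x_i = 0, in c. *)
Definition straightens (D : set M) (c : chart R m.+1 M) (i : 'I_m.+1) : Prop :=
  smooth_chart c /\
  forall p, chart_dom c p -> D p <-> chart_map c p 0 i < 0.

Definition compact_domain (D : set M) : Prop :=
  open D /\ compact (closure D) /\
  forall p, bdry D p -> exists c i, straightens D c i /\ chart_dom c p.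

Definition insert0 (i : 'I_m.+1) (y : 'rV[R]_m) : 'rV[R]_m.+1 :=
  \row_j (if unlift i j is Some k then y 0 k else 0).

(* The volume measure of the metric induced on the boundary of D, whose
   components in y are the g_jk with j, k != i. *)
Definition is_boundary_measure (D : set M)
    (area : {measure set (borel M) -> \bar R}) : Prop :=
  forall c i, straightens D c i -> forall A : set (borel M),
    measurable A -> A `<=` chart_dom c `&` bdry D ->
    area A = lebesgue_int (fun y =>
      (\1_(chart_map c @` A) (insert0 i y) *
       Num.sqrt (\det (row' i (col' i (gram c (insert0 i y))))))%:E).

End Immersed.

(* Main.v *)
(* Write H _| Omega for the contraction of Omega with the mean curvature field.
   Since Omega is closed, the pull-back of d(H _| Omega) to M is, on a direct
   orthonormal frame X, (nabla_H Omega)(X) plus the sum over i of Omega with X_i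
   replaced by nabla_{X_i} H.  The tangential part of nabla_{X_i} H contributes
   - m cos theta |H|^2 and its normal part <nabla^perp H, Phi>, so the integrand
   on the left is d(H _| Omega).  By Stokes the left-hand side is at most the
   integral over the boundary of |Omega(H, Y)|, where Y is a direct orthonormal
   frame of the boundary.  Comass one, applied to the orthonormal systems
   (cos phi nu + sin phi H/|H|, Y) with nu the conormal, gives
   |cos phi cos theta + sin phi Omega(H/|H|, Y)| <= 1 for all phi, that is,
   |Omega(H, Y)| <= sin theta |H|.

   Stokes is proved with a C^1 partition of unity subordinate to charts in which
   the domain is everything or a half space; in such a chart it is the Euclidean
   divergence theorem, which is Fubini and the fundamental theorem of calculus. *)

From HB Require Import structures.
Require Import Defs.
From mathcomp Require Import all_boot all_order all_algebra.
From mathcomp Require Import all_classical all_reals all_analysis.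
From mathcomp Require Import measurable_realfun.
From mathcomp Require Import fingroup perm ring lra.

Set Implicit Arguments.
Unset Strict Implicit.
Unset Printing Implicit Defensive.

Import Order.TTheory GRing.Theory Num.Theory.
Import numFieldNormedType.Exports.

Local Open Scope classical_set_scope.
Local Open Scope ring_scope.

(** * Calculus in several variables *)

(** Every quantity in the statement is read at [p] in the charts [chart_at p] and [chart_at (F p)],
    often on a frame picked by [xget]; none of these choices need vary continuously with [p]. So
    nothing can be differentiated, or even seen to be measurable, before it is rewritten in fixed
    charts. Much of the proof is this rewriting: second fundamental form, mean curvature and d(H _|
    Omega) obey the expected laws under simultaneous changes of source and target coordinates, and a
    frame value times the volume density becomes a coordinate expression up to the sign of a
    Jacobian determinant. The sign is there because straightening charts may reverse the
    orientation; it is constant on small patches and disappears in the absolute value.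

    The absolute value is taken patch by patch. The final bound does not suffer: the partition
    functions are nonnegative, the pointwise boundary bound is homogeneous in them, and the bounds
    add up again to the whole boundary integral.

    Real-valued integrals send infinite values to 0, so integrability over the domain and over its
    boundary has to be proved; it also comes from the partition. *)

Section Calc.
Context {R : realType}.

Notation e_ i := (delta_mx 0 i).

Lemma is_derive_line (V W : normedModType R) (f : V -> W) v x t :
  derivable f (t *: v + x) v ->
  is_derive t 1 (fun s : R => f (s *: v + x)) ('D_v f (t *: v + x)).
Proof.
move=> df; set g := fun s : R => f (s *: v + x).
have E : (fun h : R => h^-1 *: ((g \o shift t) (h *: 1) - g t)) =
    (fun h : R => h^-1 *: ((f \o shift (t *: v + x)) (h *: v) - f (t *: v + x))).
  by apply/funext => h /=; rewrite /g [h *: 1]mulr1 scalerDl addrA.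
by apply: DeriveDef; [rewrite /derivable E|rewrite /derive E].
Qed.

Lemma is_derive_shiftl (V W : normedModType R) (f : V -> W) v a x :
  derivable f (a + x) v -> is_derive x v (fun y => f (a + y)) ('D_v f (a + x)).
Proof.
move=> df; set g := fun y => f (a + y).
have E : (fun h : R => h^-1 *: ((g \o shift x) (h *: v) - g x)) =
    (fun h : R => h^-1 *: ((f \o shift (a + x)) (h *: v) - f (a + x))).
  by apply/funext => h /=; rewrite /g addrCA.
by apply: DeriveDef; [rewrite /derivable E|rewrite /derive E].
Qed.

(** The intermediate point is located by |c| <= |h| alone, so the sign of [h] splits the proof into
    cases but does not concern the users. *)
Lemma mvt_line (V : normedModType R) (f : V -> R^o) v x (h : R) :
  (forall t : R, `|t| <= `|h| -> derivable f (t *: v + x) v) ->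
  exists2 c : R, `|c| <= `|h| & f (h *: v + x) - f x = h * 'D_v f (c *: v + x).
Proof.
move=> df; set g := fun s : R => f (s *: v + x).
have dg (t : R) : `|t| <= `|h| -> is_derive t 1 g ('D_v f (t *: v + x)).
  by move=> th; apply: is_derive_line; exact: df.
have cg (t : R) : `|t| <= `|h| -> {for t, continuous g}.
  move=> th; apply: differentiable_continuous; apply/derivable1_diffP.
  by have [] := dg t th.
have [h0|h0|h0] := ltgtP h 0.
- have [||c] := @MVT_segment _ g (fun t => 'D_v f (t *: v + x)) h 0 (ltW h0).
  + move=> t /[!in_itv]/= /andP[a b]; apply: dg.
    by rewrite !ltr0_norm// lerN2 ltW.
  + apply: continuous_in_subspaceT => t /set_mem/= /[!in_itv]/= /andP[a b].
    by apply: cg; rewrite (ltr0_norm h0) ler0_norm// lerN2.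
  rewrite in_itv/= => /andP[a b]; rewrite /g scale0r add0r sub0r => E.
  exists c; first by rewrite (ltr0_norm h0) ler0_norm// lerN2.
  by rewrite -opprB E mulrN opprK mulrC.
- have [||c] := @MVT_segment _ g (fun t => 'D_v f (t *: v + x)) 0 h (ltW h0).
  + move=> t /[!in_itv]/= /andP[a b]; apply: dg.
    by rewrite !gtr0_norm// ltW.
  + apply: continuous_in_subspaceT => t /set_mem/= /[!in_itv]/= /andP[a b].
    by apply: cg; rewrite (gtr0_norm h0) ger0_norm.
  rewrite in_itv/= => /andP[a b]; rewrite /g scale0r add0r subr0 => E.
  exists c; first by rewrite (gtr0_norm h0) ger0_norm.
  by rewrite E mulrC.
- by exists 0; rewrite ?normr0// h0 scale0r add0r subrr mul0r.
Qed.

Lemma coord_le_norm m n (M : 'M[R]_(m, n)) i j : `|M i j| <= `|M|.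
Proof.
by rewrite [leRHS]/Num.Def.normr/= mx_normrE; apply: (le_bigmax _ _ (i, j)).
Qed.

Lemma mx_norm_le m n (M : 'M[R]_(m, n)) (e : R) :
  0 <= e -> (forall i j, `|M i j| <= e) -> `|M| <= e.
Proof.
move=> e0 H; rewrite [leLHS]/Num.Def.normr/= mx_normrE.
by apply: bigmax_le => // -[i j] _; exact: H.
Qed.

Lemma continuous_at_sum (T : topologicalType) (I : finType) (f : I -> T -> R^o) (P : pred I) x :
  (forall i, {for x, continuous (f i)}) ->
  {for x, continuous (fun y => \sum_(i | P i) f i y : R^o)}.
Proof.
move=> cf; pose g := \big[(fun a b x => a x + b x : R^o)/fun=> 0]_(i | P i) f i.
have -> : (fun y => \sum_(i | P i) f i y : R^o) = g.
  by apply/funext => y; rewrite /g; elim/big_rec2 : _ => // i z h _ ->.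
rewrite /g; elim/big_ind : _ => [|a b ca cb|i _]; [exact: cst_continuous| |exact: cf].
exact: continuousD ca cb.
Qed.

Lemma nbhs0_norm_lt (V : normedModType R) (r : R) (P : V -> Prop) : 0 < r ->
  (forall h, `|h| < r -> P h) -> \forall h \near 0, P h.
Proof. by move=> r0 H; near=> h; apply: H; near: h; exact: nbhs0_lt. Unshelve. all: by end_near. Qed.

Lemma mul_dist_le (a p q k e h : R) : a = k * p -> `|q - p| <= e -> `|k| <= h ->
  `|a - k * q| <= e * h.
Proof. by move=> -> A B; rewrite -mulrBr normrM mulrC ler_pM// distrC. Qed.

Lemma near_forall (T : topologicalType) (I : finType) (P : I -> T -> Prop) (x : T) :
  (forall i, \forall y \near x, P i y) -> \forall y \near x, forall i, P i y.
Proof. by move=> H; apply: filter_forall. Qed.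

(** The increment from x to x + h is split along a coordinate path. On each leg the mean value
    theorem gives h_k times a partial derivative at a nearby point, which is close to the one at [x]
    by continuity. *)
Lemma partials_differentiable d (U : set 'rV[R]_d) (f : 'rV[R]_d -> R^o) x :
  open U -> U x ->
  (forall i y, U y -> derivable f y (e_ i)) ->
  (forall i, {for x, continuous ('D_(e_ i) f)}) ->
  differentiable f x.
Proof.
move=> oU Ux df cf.
have [L LE] : exists L : {linear 'rV[R]_d -> R^o}, forall h, L h = \sum_i h 0 i * 'D_(e_ i) f x.
  have linL : linear (fun h : 'rV[R]_d => \sum_i h 0 i * 'D_(e_ i) f x : R^o).
    move=> a u v; rewrite scaler_sumr -big_split/=; apply: eq_bigr => i _.
    by rewrite !mxE mulrDl -mulrA.
  pose scallM := GRing.isLinear.Build _ _ _ _ _ linL.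
  pose L : 'rV[R]_d -> R^o := fun h => \sum_i h 0 i * 'D_(e_ i) f x.
  pose scalL : {linear 'rV[R]_d -> R^o} := HB.pack L (scallM : GRing.isLinear _ _ _ _ L).
  by exists scalL.
have contL : continuous L.
  have -> : (L : _ -> _) = fun h => \sum_i h 0 i * 'D_(e_ i) f x by apply/funext.
  move=> h.
  apply: continuous_at_sum => i; apply: (@continuousM R); [exact: coord_continuous|exact: cst_continuous].
suff E : f \o shift x = cst (f x) + L +o_ (0 : 'rV[R]_d) id.
  by apply/diff_locallyP; rewrite (diff_unique contL E).
apply/eqaddoP => _/posnumP[e].
(* The error is shared by [d] legs; dividing by [d.+1] also covers [d = 0]. *)
pose e' := e%:num / d.+1%:R.
have e'0 : 0 < e' by rewrite divr_gt0// ltr0n.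
have : \forall y \near x, U y /\ forall i, `|'D_(e_ i) f x - 'D_(e_ i) f y| <= e'.
  apply: filterI; first exact: open_nbhs_nbhs.
  apply: (near_forall (P := fun i y => `|'D_(e_ i) f x - 'D_(e_ i) f y| <= e')) => i; move: (cf i) => /cvgrPdist_le/(_ _ e'0).
  exact.
move=> /nbhs_ballP[r /= r0 Br].
have Hn : \forall h \near (0 : 'rV[R]_d), `|h| < r by apply: (nbhs0_norm_lt r0) => h.
apply: filterS Hn => h hr.
have Bh y : `|y| <= `|h| -> U (y + x) /\ forall i, `|'D_(e_ i) f x - 'D_(e_ i) f (y + x)| <= e'.
  move=> yh; apply: Br; rewrite -ball_normE /ball_/= opprD addrC subrK normrN.
  exact: le_lt_trans hr.
(* [P k] keeps the first [k] coordinates of [h]: the path runs from [P 0 = 0] to [P d = h], its k-th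
   leg is parallel to [e_ k], and all its points have norm at most |h|. *)
pose P k : 'rV[R]_d := \row_j (if (j < k)%N then h 0 j else 0).
have Pd : P d = h by apply/rowP => j; rewrite mxE ltn_ord.
have P0 : P 0 = 0 by apply/rowP => j; rewrite !mxE.
have PS (k : 'I_d) : P k.+1 = h 0 k *: e_ k + P k.
  apply/rowP => j; rewrite !mxE eqxx/= ltnS leq_eqVlt.
  have [->|jk] := eqVneq j k; first by rewrite eqxx ltnn mulr1 addr0.
  by rewrite (negbTE (jk : (j : nat) != k)) mulr0 add0r.
have Pn (k : 'I_d) (c : R) : `|c| <= `|h 0 k| -> `|c *: e_ k + P k| <= `|h|.
  move=> ch; apply: mx_norm_le => // i j; rewrite !mxE ord1 eqxx/=.
  have [->|jk] := eqVneq j k.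
    by rewrite ltnn mulr1 addr0 (le_trans ch)// coord_le_norm.
  rewrite mulr0 add0r; case: ifP => _; [exact: coord_le_norm|by rewrite normr0].
have step (k : 'I_d) :
    `|f (P k.+1 + x) - f (P k + x) - h 0 k * 'D_(e_ k) f x| <= e' * `|h|.
  have [t th|c ch] := @mvt_line _ f (e_ k) (P k + x) (h 0 k).
    by apply: df; rewrite addrA; have [] := Bh _ (Pn k t th).
  have -> : P k.+1 + x = h 0 k *: e_ k + (P k + x) by rewrite PS addrA.
  move=> E; apply: (mul_dist_le E _ (coord_le_norm _ _ _)).
  by rewrite addrA; have [_] := Bh _ (Pn k c ch); exact.
have -> : (f \o shift x - (cst (f x) + L)) h =
    \sum_(k < d) (f (P k.+1 + x) - f (P k + x) - h 0 k * 'D_(e_ k) f x).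
  rewrite sumrB -(big_mkord xpredT (fun k => f (P k.+1 + x) - f (P k + x))).
  by rewrite telescope_sumr// Pd P0 add0r !fctE opprD addrA LE.
rewrite (le_trans (ler_norm_sum _ _ _))// (le_trans (ler_sum _ (fun i _ => step i)))//.
rewrite sumr_const card_ord -mulr_natl mulrA ler_wpM2r// /e' mulrCA -[leRHS]mulr1 ler_wpM2l//.
by rewrite ler_pdivrMr ?ltr0n// mul1r ler_nat.
Qed.

Lemma Ck_continuous d (W : normedModType R) k U (f : 'rV[R]_d -> W) x :
  Ck k U f -> U x -> {for x, continuous f}.
Proof. by case: k => [|k] []; auto. Qed.

Lemma CkW d (W : normedModType R) k U (f : 'rV[R]_d -> W) : Ck k.+1 U f -> Ck k U f.
Proof.
elim: k f => [|k IH] f; first by case.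
by move=> [cf df]; split=> // i; have [? /IH] := df i.
Qed.

Lemma Ck_sub d (W : normedModType R) k (U V : set 'rV[R]_d) (f : 'rV[R]_d -> W) :
  V `<=` U -> Ck k U f -> Ck k V f.
Proof.
move=> VU; elim: k f => [|k IH] f [cf df]; first by split=> // x /VU; exact: cf.
split=> // [x /VU|i]; first exact: cf.
by have [a b] := df i; split => [x /VU|]; [exact: a|exact: IH].
Qed.

Lemma near_open (T : topologicalType) (U : set T) (P : T -> Prop) x :
  open U -> U x -> (forall y, U y -> P y) -> \forall y \near x, P y.
Proof. by move=> oU Ux UP; apply: filterS UP _; exact: open_nbhs_nbhs. Qed.

Lemma near_eq_continuous (T S : topologicalType) (f g : T -> S) x :
  (\forall y \near x, f y = g y) -> {for x, continuous f} -> {for x, continuous g}.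
Proof.
move=> fg cf; have E : f x = g x := nbhs_singleton fg; rewrite /prop_for /continuous_at -E.
by apply: cvg_trans cf; apply: near_eq_cvg.
Qed.

Lemma Ck_ext d (W : normedModType R) k U (f g : 'rV[R]_d -> W) :
  open U -> (forall x, U x -> f x = g x) -> Ck k U f -> Ck k U g.
Proof.
move=> oU; elim: k f g => [|k IH] f g fg [cf df].
  split=> // x Ux; apply: near_eq_continuous (cf _ Ux); exact: near_open fg.
split=> [x Ux|i]; first by apply: near_eq_continuous (cf _ Ux); exact: near_open fg.
have [a b] := df i; split=> [x Ux|].
  by apply: near_eq_derivable (a _ Ux); exact: near_open fg.
by apply: IH b => x Ux; apply: near_eq_derive; exact: near_open fg.
Qed.

(** [Ck] asks for continuity and derivability in the ambient space at each point of the set, so it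
    passes from [V] to [U] point by point, whatever the shape of [V]. *)
Lemma Ck_local d (W : normedModType R) k U (f : 'rV[R]_d -> W) :
  (forall x, U x -> exists V, V x /\ Ck k V f) -> Ck k U f.
Proof.
elim: k f => [|k IH] f H.
  by split=> // x /H[V [Vx [cf _]]]; exact: cf.
split=> [x /H[V [Vx [cf _]]]|i]; first exact: cf.
split=> [x /H[V [Vx [_ df]]]|]; first by have [a _] := df i; exact: a.
by apply: IH => x /H[V [Vx [_ df]]]; exists V; split=> //; have [_] := df i.
Qed.

Lemma Ck_cst d (W : normedModType R) k U (a : W) : Ck k U (fun _ : 'rV[R]_d => a).
Proof.
elim: k a => [|k IH] a; first by split=> // x _; exact: cst_continuous.
split=> // [x _|i]; first exact: cst_continuous.
split=> [x _|]; first exact: derivable_cst.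
have -> : 'D_(e_ i) (fun _ : 'rV[R]_d => a) = fun=> 0 by apply/funext => x; exact: derive_cst.
exact: IH.
Qed.

Lemma continuous_mxP (T : topologicalType) p q (N : T -> 'M[R]_(p, q)) x :
  {for x, continuous N} <-> forall i j, {for x, continuous (fun x => N x i j : R^o)}.
Proof.
split=> [cN i j|cN].
  by apply: (@continuous_comp _ _ _ N (fun A : 'M[R]_(p, q) => A i j)) => //; exact: coord_continuous.
apply/cvgrPdist_le => e e0; near=> y; apply: mx_norm_le (ltW e0) _ => i j; rewrite !mxE.
move: i j; near: y; apply: filter_forall => i; apply: filter_forall => j.
exact: ((cvgrPdist_le _ _).1 (cN i j)).
Unshelve. all: by end_near. Qed.

Lemma Ck_mxP d p q k U (M : 'rV[R]_d -> 'M[R]_(p, q)) : open U ->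
  Ck k U M <-> forall i j, Ck k U (fun x => M x i j : R^o).
Proof.
move=> oU; elim: k M => [|k IH] M.
  split=> [[cM _] i j|cM]; split=> // x Ux; first by have /continuous_mxP := cM _ Ux; exact.
  by apply/continuous_mxP => i j; have [+ _] := cM i j; exact.
split=> [[cM dM] i j|H].
  split=> [x Ux|l]; first by have /continuous_mxP := cM _ Ux; exact.
  have [a b] := dM l; split=> [x Ux|]; first by have /derivable_mxP := a _ Ux; exact.
  move/IH : b => /(_ i j); apply: Ck_ext => // x Ux; rewrite derive_mx ?mxE//; exact: a.
split=> [x Ux|l]; first by apply/continuous_mxP => i j; have [+ _] := H i j; exact.
have D x : U x -> derivable M x (e_ l).
  by move=> Ux; apply/derivable_mxP => i j; have [_ /(_ l)[]] := H i j; move=> + _; exact.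
split=> //; apply/IH => i j; have [_ /(_ l)[_]] := H i j.
by apply: Ck_ext => // x Ux; rewrite derive_mx ?mxE//; exact: D.
Qed.

Lemma CkD d k U (f g : 'rV[R]_d -> R^o) : open U ->
  Ck k U f -> Ck k U g -> Ck k U (fun x => f x + g x).
Proof.
move=> oU; elim: k f g => [|k IH] f g [cf df] [cg dg].
  by split=> // x Ux; apply: continuousD; [exact: cf|exact: cg].
split=> // [x Ux|i].
  by apply: continuousD; [exact: cf|exact: cg].
have [a b] := df i; have [a' b'] := dg i.
split=> [x Ux|]; first by apply: derivableD; [exact: a|exact: a'].
apply: Ck_ext (IH _ _ b b') => // x Ux.
by rewrite -(deriveD (a _ Ux) (a' _ Ux)).
Qed.

Lemma CkM d k U (f g : 'rV[R]_d -> R^o) : open U ->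
  Ck k U f -> Ck k U g -> Ck k U (fun x => f x * g x).
Proof.
move=> oU; elim: k f g => [|k IH] f g F G; have [cf df] := F; have [cg dg] := G.
  by split=> // x Ux; apply: (@continuousM R); [exact: cf|exact: cg].
split=> // [x Ux|i].
  by apply: (@continuousM R); [exact: cf|exact: cg].
have [a b] := df i; have [a' b'] := dg i.
split=> [x Ux|]; first by apply: (@derivableM R); [exact: a|exact: a'].
apply: Ck_ext (CkD oU (IH _ _ (CkW F) b') (IH _ _ (CkW G) b)) => // x Ux.
by have := deriveM (a _ Ux) (a' _ Ux).
Qed.

Lemma Ck_sum d k U (I : finType) (P : pred I) (f : I -> 'rV[R]_d -> R^o) : open U ->
  (forall i, P i -> Ck k U (f i)) -> Ck k U (fun x => \sum_(i | P i) f i x : R^o).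
Proof.
move=> oU cf; pose g := \big[(fun a b x => a x + b x : R^o)/fun=> 0]_(i | P i) f i.
have -> : (fun x => \sum_(i | P i) f i x : R^o) = g.
  by apply/funext => x; rewrite /g; elim/big_rec2 : _ => // i y h _ ->.
by rewrite /g; elim/big_ind : _ => [|a b|]; [exact: Ck_cst|exact: CkD|exact: cf].
Qed.

Lemma Ck_prod d k U (I : finType) (P : pred I) (f : I -> 'rV[R]_d -> R^o) : open U ->
  (forall i, P i -> Ck k U (f i)) -> Ck k U (fun x => \prod_(i | P i) f i x : R^o).
Proof.
move=> oU cf; pose g := \big[(fun a b x => a x * b x : R^o)/fun=> 1]_(i | P i) f i.
have -> : (fun x => \prod_(i | P i) f i x : R^o) = g.
  by apply/funext => x; rewrite /g; elim/big_rec2 : _ => // i y h _ ->.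
by rewrite /g; elim/big_ind : _ => [|a b|]; [exact: Ck_cst|exact: CkM|exact: cf].
Qed.

(** The derivative of 1/f is -f'/f^2, a product of maps of class [k]: the factors 1/f by induction,
    f' by hypothesis. *)
Lemma CkV d k U (f : 'rV[R]_d -> R^o) : open U -> (forall x, U x -> f x != 0) ->
  Ck k U f -> Ck k U (fun x => (f x)^-1 : R^o).
Proof.
move=> oU f0; elim: k => [|k IH] F; have [cf df] := F.
  by split=> // x Ux; apply: (@continuousV R); [exact: f0|exact: cf].
split=> // [x Ux|i].
  by apply: (@continuousV R); [exact: f0|exact: cf].
have [a b] := df i; have I := IH (CkW F).
split=> [x Ux|]; first by apply: (@derivableV R); [exact: f0|exact: a].
apply: Ck_ext (CkM oU (CkM oU (CkM oU I I) (Ck_cst k U (-1 : R^o))) b) => // x Ux.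
have := deriveV (f0 _ Ux) (a _ Ux); rewrite /GRing.inv/= => ->.
by rewrite mulrN1 -invfM -expr2.
Qed.

(** [f] has a derivative in the direction [v] only, so the chain rule for differentials is applied
    to its restriction [h] to a line, where derivability and differentiability agree. *)
Lemma is_derive_chain d (V W : normedModType R) (f : V -> 'rV[R]_d) (g : 'rV[R]_d -> W) x v :
  derivable f x v -> differentiable g (f x) ->
  is_derive x v (g \o f) ('D_('D_v f x) g (f x)).
Proof.
move=> df dg; set h := fun s : R => f (s *: v + x).
have h0 : h 0 = f x by rewrite /h scale0r add0r.
have [dh Dh] : is_derive (0 : R) (1 : R) h ('D_v f x).
  have E : (0 : R) *: v + x = x by rewrite scale0r add0r.
  by have := @is_derive_line _ _ f v x (0 : R); rewrite E => /(_ df).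
have [dgh Dgh] : is_derive (0 : R) (1 : R) (g \o h) ('D_('D_v f x) g (f x)).
  have dh' : differentiable h 0 by exact/derivable1_diffP.
  have dg' : differentiable g (h 0) by rewrite h0.
  have dgh : differentiable (g \o h) 0 by exact: differentiable_comp.
  apply: DeriveDef; first exact/derivable1_diffP.
  rewrite deriveE// diff_comp//=.
  have <- : 'D_1 h 0 = 'd h 0 (1 : R) by exact: deriveE.
  by rewrite Dh h0 -deriveE.
apply: DeriveDef; first exact/derivable1P.
have E : (fun t : R => t^-1 *: (((g \o f) \o shift x) (t *: v) - (g \o f) x)) =
    (fun t : R => t^-1 *: (((g \o h) \o shift (0 : R)) (t *: (1 : R)) - (g \o h) (0 : R))).
  by apply/funext => t /=; rewrite /h [t *: 1]mulr1 addr0 scale0r add0r.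
by rewrite -Dgh /derive E.
Qed.

Lemma derive_sum_partials d (W : normedModType R) (f : 'rV[R]_d -> W) x v :
  differentiable f x -> 'D_v f x = \sum_i v 0 i *: 'D_(e_ i) f x.
Proof.
move=> df; rewrite deriveE// [in LHS](row_sum_delta v) linear_sum.
by apply: eq_bigr => i _; rewrite linearZ/= -deriveE.
Qed.

Lemma Ck_differentiable1 d k U (f : 'rV[R]_d -> R^o) x :
  open U -> Ck k.+1 U f -> U x -> differentiable f x.
Proof.
move=> oU [cf df] Ux; apply: (partials_differentiable oU Ux) => [i y Uy|i].
  by have [+ _] := df i; exact.
by have [_ /Ck_continuous] := df i; exact.
Qed.

Lemma differentiable_mx p q (V : normedModType R) (M : V -> 'M[R]_(p, q)) x :
  (forall i j, differentiable (fun x => M x i j : R^o) x) -> differentiable M x.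
Proof.
move=> dM; have -> : M = \sum_i \sum_j (fun y => M y i j *: delta_mx i j).
  apply/funext => y; rewrite [LHS]matrix_sum_delta fct_sumE; apply: eq_bigr => i _.
  by rewrite fct_sumE.
apply: differentiable_sum => i; apply: differentiable_sum => j.
exact: (differentiableZl _ (dM i j)).
Qed.

Lemma Ck_differentiable d p q k U (f : 'rV[R]_d -> 'M[R]_(p, q)) x :
  open U -> Ck k.+1 U f -> U x -> differentiable f x.
Proof.
move=> oU /(Ck_mxP _ _ oU) H Ux; apply: differentiable_mx => i j.
exact: Ck_differentiable1 oU (H i j) Ux.
Qed.

(** The induction generalizes [g]: a partial of the composition is a sum of products of partials of
    [f] with partials of [g] composed with [f], and the induction hypothesis is used on the partials
    of [g]. *)
Lemma Ck_comp a b k U V (f : 'rV[R]_a -> 'rV[R]_b) (g : 'rV[R]_b -> R^o) :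
  open U -> open V -> (forall x, U x -> V (f x)) ->
  Ck k U f -> Ck k V g -> Ck k U (g \o f : _ -> R^o).
Proof.
move=> oU oV UV; elim: k f g UV => [|k IH] f g UV F G.
  by split=> // x Ux; apply: continuous_comp; [exact: Ck_continuous F _|exact: Ck_continuous G (UV _ Ux)].
split=> [x Ux|i].
  by apply: continuous_comp; [exact: Ck_continuous F _|exact: Ck_continuous G (UV _ Ux)].
have D x : U x -> is_derive x (e_ i) (g \o f) ('D_('D_(e_ i) f x) g (f x)).
  move=> Ux; apply: is_derive_chain; first by have [_ /(_ i)[+ _]] := F; exact.
  by apply: Ck_differentiable1 oV G _; exact: UV.
split=> [x /D[]//|].
have [cf df] := F; have [cg dg] := G.
have C : Ck k U (fun x => \sum_(j < b) ('D_(e_ i) f x) 0 j * 'D_(e_ j) g (f x) : R^o).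
  apply: Ck_sum => // j _; apply: CkM => //.
    by have [_ /(Ck_mxP _ _ oU)] := df i; exact.
  by have [_ H] := dg j; exact: (IH f ('D_(e_ j) g) UV (CkW F) H).
apply: Ck_ext C => // x Ux; have [_ ->] := D x Ux.
by rewrite (derive_sum_partials _ (Ck_differentiable1 oV G (UV _ Ux))).
Qed.

Lemma second_difference_swap (a b c d : R) : a - b - (c - d) = a - c - (b - d).
Proof. ring. Qed.

Lemma second_difference_inj (a b c d p q k : R) : k != 0 ->
  a - b - (c - d) = k * (k * p) -> a - c - (b - d) = k * (k * q) -> p = q.
Proof.
move=> k0; rewrite second_difference_swap => -> E.
exact: (mulfI k0 (mulfI k0 E)).
Qed.

Lemma dist_halves (a b p q e : R) : p = q ->
  `|a - q| <= e / 2 -> `|b - p| <= e / 2 -> `|a - b| <= e.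
Proof.
move=> -> A B; rewrite -(subrKA q) (le_trans (ler_normD _ _))// [leRHS]splitr lerD//.
by rewrite distrC.
Qed.

(** Two applications of the mean value theorem: along [e_ i] to the first difference [phi] in the
    direction [e_ j], then along [e_ j] to ['D_(e_ i) f]. *)
Lemma mixed_difference d (U : set 'rV[R]_d) (f : 'rV[R]_d -> R^o) x i j (h r : R) :
  Ck 2 U f -> ball x r `<=` U -> 0 < h -> h + h < r ->
  exists2 y, ball x r y &
    f (h *: e_ i + (h *: e_ j + x)) - f (h *: e_ j + x) - (f (h *: e_ i + x) - f x) =
    h * (h * 'D_(e_ j) ('D_(e_ i) f) y).
Proof.
move=> [cf df] BU h0 hr.
have B (s t : R) (k l : 'I_d) : `|s| <= h -> `|t| <= h -> ball x r (s *: e_ k + (t *: e_ l + x)).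
  move=> sh th; rewrite -ball_normE /ball_/= addrA opprD addrCA subrr addr0 normrN; apply: le_lt_trans hr.
  have n1 m : `|e_ m : 'rV[R]_d| <= 1.
    by apply: mx_norm_le => // a b; rewrite mxE; case: (_ && _); rewrite ?normr1 ?normr0.
  rewrite (le_trans (ler_normD _ _))// !normrZ lerD// -[leRHS]mulr1 ler_pM//.
have nh : `|h| = h by rewrite gtr0_norm.
have B0 (s : R) k : `|s| <= h -> ball x r (s *: e_ k + x).
  by move=> sh; move: (B s 0 k k sh); rewrite scale0r add0r normr0; apply; exact: ltW.
pose phi := fun y => f (h *: e_ j + y) - f y : R^o.
have D1 y : ball x r y -> derivable f y (e_ i) by move=> /BU Uy; have [+ _] := df i; exact.
have Dphi (t : R) : `|t| <= `|h| -> is_derive (t *: e_ i + x) (e_ i) phi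
    ('D_(e_ i) f (h *: e_ j + (t *: e_ i + x)) - 'D_(e_ i) f (t *: e_ i + x)).
  rewrite nh => th.
  apply: (@is_deriveB _ _ _ (fun y => f (h *: e_ j + y)) f); first by apply: is_derive_shiftl; apply: D1; apply: B => //; rewrite nh.
  by apply: derivableP; apply: D1; exact: B0.
have [t th|c ch] := @mvt_line _ phi (e_ i) x h; first by have [] := Dphi t th.
have [_ ->] := Dphi c ch.
rewrite nh in ch.
have [t|c' ch'] := @mvt_line _ ('D_(e_ i) f) (e_ j) (c *: e_ i + x) h.
  rewrite nh => th; have [_ [_ /(_ j)[+ _]]] := df i; apply; apply: BU; exact: B.
move=> -> E; exists (c' *: e_ j + (c *: e_ i + x)); first by apply: B => //; rewrite -nh.
rewrite -E /phi [h *: e_ j + (h *: e_ i + x)]addrCA; exact: second_difference_swap.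
Qed.

(** The second difference is symmetric in [i] and [j], so one mixed partial at some [y] equals the
    other at some [z], both in an arbitrarily small ball about [x]; continuity brings both points to
    [x]. *)
Lemma schwarz d U (f : 'rV[R]_d -> R^o) x i j : open U -> Ck 2 U f -> U x ->
  'D_(e_ i) ('D_(e_ j) f) x = 'D_(e_ j) ('D_(e_ i) f) x.
Proof.
move=> oU F Ux; apply/eqP; rewrite -subr_eq0 -normr_le0; apply/ler_addgt0Pl => e e0.
rewrite addr0.
have c i' j' : {for x, continuous ('D_(e_ i') ('D_(e_ j') f))}.
  by have [_ /(_ j')[_ [_ /(_ i')[_ [+ _]]]]] := F; exact.
have e20 : 0 < e / 2 by rewrite divr_gt0.
have n1 : \forall y \near x, U y by exact: near_open oU Ux _.
move: (c i j) => /cvgrPdist_le/(_ _ e20) n2.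
move: (c j i) => /cvgrPdist_le/(_ _ e20) n3.
have /nbhs_ballP[r /= r0 Br] : \forall y \near x, U y /\
    (`|'D_(e_ i) ('D_(e_ j) f) x - 'D_(e_ i) ('D_(e_ j) f) y| <= e / 2 /\
     `|'D_(e_ j) ('D_(e_ i) f) x - 'D_(e_ j) ('D_(e_ i) f) y| <= e / 2).
  by apply: filterI n1 _; exact: filterI n2 n3.
have BU : ball x r `<=` U by move=> y /Br[].
have h0 : 0 < r / 4 by rewrite divr_gt0.
have hr : r / 4 + r / 4 < r by lra.
have [y /Br[_ [_ Y]] Ey] := mixed_difference i j F BU h0 hr.
have [z /Br[_ [Z _]] Ez] := mixed_difference j i F BU h0 hr.
have : 'D_(e_ j) ('D_(e_ i) f) y = 'D_(e_ i) ('D_(e_ j) f) z.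
  have hn : r / 4 != 0 by rewrite gt_eqF.
  move: Ez; rewrite [(r / 4) *: e_ j + (_ + x)]addrCA => Ez.
  exact: (second_difference_inj hn Ey Ez).
by move=> E; exact: (dist_halves E Z Y).
Qed.

End Calc.

(** * Alternating forms and comass *)

Section Algebra.
Context {R : rcfType}.

Definition set_row k d (i : 'I_k) (v : 'rV[R]_d) (A : 'M[R]_(k, d)) : 'M[R]_(k, d) :=
  \matrix_j (if j == i then v else row j A).

Definition multilinear k d (w : 'M[R]_(k, d) -> R) :=
  forall A i a u v, w (set_row i (a *: u + v) A) = a * w (set_row i u A) + w (set_row i v A).

Definition alternating k d (w : 'M[R]_(k, d) -> R) :=
  forall A (i j : 'I_k), i != j -> row i A = row j A -> w A = 0.

(** For multilinear [w] this is the derivative of [w] at [A] in the direction [B]. It is the common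
    shape of the Christoffel correction in a covariant derivative and of the derivative of a form
    whose arguments move. *)
Definition polarize k d (w : 'M[R]_(k, d) -> R) (A B : 'M[R]_(k, d)) : R :=
  \sum_i w (set_row i (row i B) A).

Lemma row_set_row k d (i j : 'I_k) v (A : 'M[R]_(k, d)) :
  row j (set_row i v A) = if j == i then v else row j A.
Proof. by rewrite rowK. Qed.

Lemma row_row_perm k d (i : 'I_k) (s : 'S_k) (A : 'M[R]_(k, d)) : row i (row_perm s A) = row (s i) A.
Proof. by apply/rowP => z; rewrite !mxE. Qed.

Lemma set_row_id k d (i : 'I_k) (A : 'M[R]_(k, d)) : set_row i (row i A) A = A.
Proof. by apply/row_matrixP => j; rewrite rowK; case: eqP => // ->. Qed.

Lemma set_rowK k d (i : 'I_k) u v (A : 'M[R]_(k, d)) : set_row i u (set_row i v A) = set_row i u A.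
Proof. by apply/row_matrixP => j; rewrite !rowK; case: eqP. Qed.

Lemma set_rowC k d (i j : 'I_k) u v (A : 'M[R]_(k, d)) : i != j ->
  set_row i u (set_row j v A) = set_row j v (set_row i u A).
Proof.
by move=> ij; apply/row_matrixP => l; rewrite !rowK; case: (eqVneq l i) => // ->; rewrite (negbTE ij).
Qed.

Lemma set_row_mul k l d (i : 'I_k) v (P : 'M[R]_(k, l)) (A : 'M[R]_(l, d)) :
  set_row i v P *m A = set_row i (v *m A) (P *m A).
Proof. by apply/row_matrixP => j; rewrite row_mul !rowK; case: ifP => // _; rewrite row_mul. Qed.

Section Multilinear.
Context (k d : nat) (w : 'M[R]_(k, d) -> R).
Hypothesis wl : multilinear w.

Lemma multilinearD A i u v : w (set_row i (u + v) A) = w (set_row i u A) + w (set_row i v A).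
Proof. by rewrite -[u in LHS]scale1r wl mul1r. Qed.

Lemma multilinear0 A i : w (set_row i 0 A) = 0.
Proof. by apply: (addrI (w (set_row i 0 A))); rewrite addr0 -multilinearD addr0. Qed.

Lemma multilinearZ A i a u : w (set_row i (a *: u) A) = a * w (set_row i u A).
Proof. by rewrite -[a *: u]addr0 wl multilinear0 addr0. Qed.

Lemma multilinear_sum A i (I : finType) (P : pred I) (u : I -> 'rV_d) :
  w (set_row i (\sum_(j | P j) u j) A) = \sum_(j | P j) w (set_row i (u j) A).
Proof.
by elim/big_rec2 : _ => [|j y z _ <-]; [exact: multilinear0|exact: multilinearD].
Qed.

Lemma polarizeD A B C : polarize w A (B + C) = polarize w A B + polarize w A C.
Proof. by rewrite -big_split/=; apply: eq_bigr => i _; rewrite linearD multilinearD. Qed.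

Hypothesis wa : alternating w.

Lemma alternating_same A i j v : i != j -> w (set_row i v (set_row j v A)) = 0.
Proof.
move=> ij; apply: (wa ij); rewrite !rowK eqxx eq_sym (negbTE ij).
by rewrite eqxx.
Qed.

Lemma alternating_swap A i j u v : i != j ->
  w (set_row i u (set_row j v A)) = - w (set_row i v (set_row j u A)).
Proof.
move=> ij; apply/eqP; rewrite -addr_eq0; apply/eqP.
have := alternating_same A (u + v) ij.
rewrite multilinearD !(set_rowC _ _ _ ij) !multilinearD -!(set_rowC _ _ _ ij) !alternating_same//.
by rewrite add0r addr0.
Qed.

Lemma alternating_tperm A (i j : 'I_k) : i != j -> w (row_perm (tperm i j) A) = - w A.
Proof.
move=> ij; rewrite -[in RHS](set_row_id j A) -[in RHS](set_row_id i (set_row _ _ _)).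
rewrite [row i (set_row _ _ _)]rowK (negbTE ij) alternating_swap// opprK; congr w.
apply/row_matrixP => l; rewrite row_row_perm !rowK.
have [->|li] := eqVneq l i; first by rewrite tpermL.
have [->|lj] := eqVneq l j; first by rewrite tpermR.
by rewrite tpermD // eq_sym.
Qed.

Lemma alternating_perm A (s : 'S_k) : w (row_perm s A) = (-1) ^+ s * w A.
Proof.
have [ts -> dts] := prod_tpermP s.
elim: ts A dts => [|[i j] ts IH] A /=.
  by move=> _; rewrite big_nil odd_perm1 mul1r row_perm1.
move=> /andP[/= ij dts]; rewrite big_cons/= row_permM alternating_tperm// IH//.
by rewrite odd_permM odd_tperm ij addTb signrN mulNr.
Qed.

End Multilinear.

Lemma row_col0 k d (u : 'rV[R]_d) (A : 'M[R]_(k, d)) :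
  row ord0 (col_mx u A : 'M[R]_(k.+1, d)) = u.
Proof. by apply/rowP => z; rewrite !mxE; case: splitP => // i _; rewrite ord1. Qed.

Lemma row_colS k d (u : 'rV[R]_d) (A : 'M[R]_(k, d)) (i : 'I_k) :
  row (lift ord0 i) (col_mx u A : 'M[R]_(k.+1, d)) = row i A.
Proof.
apply/rowP => z; rewrite !mxE; case: splitP => [l|l /= E]; first by rewrite ord1.
by congr (A _ _); apply/val_inj; case: E.
Qed.

Lemma multilinear_col k d (w : 'M[R]_(k.+1, d) -> R) (u : 'rV[R]_d) :
  multilinear w -> multilinear (fun B : 'M[R]_(k, d) => w (col_mx u B : 'M[R]_(k.+1, d))).
Proof.
move=> wl A i a x y /=.
have E z : (col_mx u (set_row i z A) : 'M[R]_(k.+1, d)) = set_row (lift ord0 i) z (col_mx u A : 'M[R]_(k.+1, d)).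
  apply/row_matrixP => j; rewrite rowK; case: (unliftP ord0 j) => [l ->|->].
    by rewrite !row_colS rowK (inj_eq lift_inj).
  by rewrite !row_col0 (negbTE (neq_lift _ _)).
by rewrite !E wl.
Qed.

Lemma alternating_col k d (w : 'M[R]_(k.+1, d) -> R) (u : 'rV[R]_d) :
  alternating w -> alternating (fun B : 'M[R]_(k, d) => w (col_mx u B : 'M[R]_(k.+1, d))).
Proof.
move=> wa A i j ij E.
by apply: (wa _ (lift ord0 i) (lift ord0 j)); rewrite ?(inj_eq lift_inj)// !row_colS.
Qed.

(** Expanding the first row leaves a multilinear function of the others, to which induction applies.
    The purpose is to reduce values of a form on moving vectors to values on finitely many fixed
    ones, whose smoothness is known. *)
Lemma multilinear_expand k l d (w : 'M[R]_(k, d) -> R) (P : 'M[R]_(k, l)) (A : 'M[R]_(l, d)) :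
  multilinear w ->
  w (P *m A) = \sum_(f : {ffun 'I_k -> 'I_l}) (\prod_i P i (f i)) * w (\matrix_i row (f i) A).
Proof.
elim: k w P => [|k IH] w P wl.
  have F0 (f g : {ffun 'I_0 -> 'I_l}) : f = g by apply/ffunP => -[].
  have f0 : {ffun 'I_0 -> 'I_l} by apply: finfun => -[].
  rewrite (big_pred1 f0); last by move=> f; rewrite /= (F0 f f0) eqxx.
  by rewrite big_ord0 mul1r; congr w; apply/matrixP => -[].
(* A function on ['I_k.+1] is the pair of its value at [ord0] and of its values on the remaining
   indices. *)
pose F (p : 'I_l * {ffun 'I_k -> 'I_l}) : {ffun 'I_k.+1 -> 'I_l} :=
  [ffun i => if unlift ord0 i is Some j then p.2 j else p.1].
rewrite (reindex F)/=; last first.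
  exists (fun f => (f ord0, [ffun j => f (lift ord0 j)])).
    move=> [a f] _ /=; congr pair; first by rewrite ffunE unlift_none.
    by apply/ffunP => j; rewrite !ffunE liftK.
  move=> f _; apply/ffunP => j; rewrite !ffunE/=; case: unliftP => [i ->|->]//.
  by rewrite ffunE.
rewrite -(pair_bigA _ (fun a f => (\prod_i P i (F (a, f) i)) * w (\matrix_i row (F (a, f) i) A)))/=.
rewrite -[in LHS](set_row_id ord0 (P *m A)) row_mul.
have -> : row ord0 P *m A = \sum_a P ord0 a *: row a A.
  by rewrite mulmx_sum_row; apply: eq_bigr => a _; rewrite mxE.
rewrite multilinear_sum//; apply: eq_bigr => a _; rewrite multilinearZ//.
have -> : set_row ord0 (row a A) (P *m A) = (col_mx (row a A) (row' ord0 P *m A) : 'M[R]_(k.+1, d)).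
  apply/row_matrixP => j; rewrite rowK; case: (unliftP ord0 j) => [i ->|->].
    rewrite row_colS eq_sym (negbTE (neq_lift _ _)) !row_mul; congr (_ *m _).
    by apply/rowP => z; rewrite !mxE.
  by rewrite eqxx row_col0.
rewrite (IH _ _ (multilinear_col _ wl)) mulr_sumr; apply: eq_bigr => f _.
rewrite big_ord_recl mulrA ffunE unlift_none/=; congr (_ * _ * _).
  by apply: eq_bigr => i _; rewrite !mxE ffunE liftK.
congr w; apply/row_matrixP => j; rewrite rowK; case: (unliftP ord0 j) => [i ->|->].
  by rewrite row_colS rowK ffunE liftK.
by rewrite row_col0 ffunE unlift_none.
Qed.

(** In the multilinear expansion a non-injective choice of rows repeats a row and contributes 0; the
    injective ones are permutations and give Leibniz' formula for the determinant. *)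
Lemma alternating_mul k d (w : 'M[R]_(k, d) -> R) (P : 'M[R]_k) (A : 'M[R]_(k, d)) :
  multilinear w -> alternating w -> w (P *m A) = \det P * w A.
Proof.
move=> wl wa; rewrite multilinear_expand// (bigID (fun f : {ffun _} => injectiveb f))/= addrC big1 ?add0r; last first.
  move=> f /injectivePn[i [j ij fij]]; rewrite (wa _ i j) ?mulr0//.
  by rewrite !rowK fij.
rewrite (reindex (@pval _)) /=; last first.
  pose in_Sn := insubd (1%g : 'S_k).
  by exists in_Sn => /= f Uf; first apply: val_inj; apply: insubdK.
rewrite /determinant mulr_suml; apply: eq_big => /= [s|s _]; rewrite ?(valP s)//.
rewrite [(-1) ^+ s * _]mulrC -mulrA; congr (_ * _).
  by apply: eq_bigr => i _; rewrite pvalE.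
rewrite -(alternating_perm wl wa); congr w; apply/row_matrixP => i.
by rewrite row_row_perm rowK pvalE.
Qed.

(** Bringing row [i] to the top is a cycle of length i + 1, of sign (-1)^i. This reconciles the star
    operator and the exterior derivative, which put a vector first, with substitution in place. *)
Lemma set_row_colE k d (w : 'M[R]_(k.+1, d) -> R) (A : 'M[R]_(k.+1, d)) i u :
  multilinear w -> alternating w ->
  w (set_row i u A) = (-1) ^+ i * w (col_mx u (row' i A) : 'M[R]_(k.+1, d)).
Proof.
move=> wl wa; have -> : set_row i u A = row_perm (lift_perm i ord0 1%g) (col_mx u (row' i A) : 'M[R]_(k.+1, d)).
  apply/row_matrixP => j; rewrite row_row_perm rowK; case: (unliftP i j) => [l ->|->].
    rewrite eq_sym (negbTE (neq_lift _ _)) lift_perm_lift perm1.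
    by rewrite row_colS; apply/rowP => z; rewrite !mxE.
  by rewrite eqxx lift_perm_id row_col0.
rewrite alternating_perm// odd_lift_perm odd_perm1 addbF addbF; congr (_ * _).
by rewrite signr_odd.
Qed.

(** Row [i] of [T *m A] is a combination of the rows of [A]; all of them but the i-th still occur
    elsewhere in the argument, so only the diagonal entry T_ii survives. *)
Lemma polarize_mul k d (w : 'M[R]_(k, d) -> R) (A : 'M[R]_(k, d)) (T : 'M[R]_k) :
  multilinear w -> alternating w -> polarize w A (T *m A) = \tr T * w A.
Proof.
move=> wl wa; rewrite /polarize /mxtrace mulr_suml; apply: eq_bigr => i _.
rewrite row_mul mulmx_sum_row multilinear_sum// (bigD1 i)//= big1 ?addr0 => [|j ji].
  by rewrite multilinearZ// set_row_id mxE.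
rewrite multilinearZ// -[X in set_row i _ X](set_row_id j A) alternating_same ?mulr0//.
by rewrite eq_sym.
Qed.

End Algebra.

(** * Orthonormal systems and the consequence of comass one for normal vectors *)

Section Orthonormal.
Context {R : realType}.

Definition posdef n (g : 'M[R]_n) := g^T = g /\ forall v, v != 0 -> 0 < ip g v v.

Lemma ipC n (g : 'M[R]_n) (u v : 'rV[R]_n) : g^T = g -> ip g u v = ip g v u.
Proof.
by move=> gs; rewrite /ip -[in LHS](trmxK (u *m g *m v^T)) mxE !trmx_mul trmxK gs mulmxA.
Qed.

Lemma ip_linear n (g : 'M[R]_n) (v w : 'rV[R]_n) a u : ip g (a *: u + v) w = a * ip g u w + ip g v w.
Proof. by rewrite /ip !mulmxDl -!scalemxAl !mxE. Qed.

Lemma ipDl n (g : 'M[R]_n) (u v w : 'rV[R]_n) : ip g (u + v) w = ip g u w + ip g v w.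
Proof. by rewrite -[u]scale1r ip_linear scale1r mul1r. Qed.

Lemma ipZl n (g : 'M[R]_n) a (u w : 'rV[R]_n) : ip g (a *: u) w = a * ip g u w.
Proof. by rewrite /ip -!scalemxAl mxE. Qed.

Lemma ipNl n (g : 'M[R]_n) (u w : 'rV[R]_n) : ip g (- u) w = - ip g u w.
Proof. by rewrite -scaleN1r ipZl mulN1r. Qed.

Lemma ipBl n (g : 'M[R]_n) (u v w : 'rV[R]_n) : ip g (u - v) w = ip g u w - ip g v w.
Proof. by rewrite ipDl ipNl. Qed.

Lemma ip0l n (g : 'M[R]_n) (w : 'rV[R]_n) : ip g 0 w = 0.
Proof. by rewrite /ip !mul0mx mxE. Qed.

Lemma ip_suml n (g : 'M[R]_n) (I : finType) (P : pred I) (u : I -> 'rV[R]_n) w :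
  ip g (\sum_(i | P i) u i) w = \sum_(i | P i) ip g (u i) w.
Proof. by elim/big_rec2 : _ => [|i y z _ <-]; rewrite ?ip0l// ipDl. Qed.

Lemma ipDr n (g : 'M[R]_n) (u v w : 'rV[R]_n) : ip g u (v + w) = ip g u v + ip g u w.
Proof. by rewrite /ip linearD/= mulmxDr mxE. Qed.

Lemma ipZr n (g : 'M[R]_n) a (u w : 'rV[R]_n) : ip g u (a *: w) = a * ip g u w.
Proof. by rewrite /ip linearZ/= -scalemxAr mxE. Qed.

Lemma ip_mul n p (g : 'M[R]_n) (A : 'M[R]_(p, n)) (u v : 'rV[R]_p) :
  ip (A *m g *m A^T) u v = ip g (u *m A) (v *m A).
Proof. by rewrite /ip trmx_mul !mulmxA. Qed.

Lemma ip_row n p q (g : 'M[R]_n) (A : 'M[R]_(p, n)) (B : 'M[R]_(q, n)) i j :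
  ip g (row i A) (row j B) = (A *m g *m B^T) i j.
Proof. by rewrite /ip -row_mul tr_row !mxE; apply: eq_bigr => k _; rewrite !mxE. Qed.

Lemma row_row' n p (A : 'M[R]_(p, n)) i j : row j (row' i A) = row (lift i j) A.
Proof. by apply/rowP => k; rewrite !mxE. Qed.

Lemma mul_row'1 n p (A : 'M[R]_(p, n)) i : row' i 1%:M *m A = row' i A.
Proof. by apply/row_matrixP => j; rewrite row_mul !row_row' row1 -rowE. Qed.

Lemma minor_mul n p (G : 'M[R]_p) (A : 'M[R]_(n, p)) i :
  row' i (col' i (A *m G *m A^T)) = row' i A *m G *m (row' i A)^T.
Proof. by apply/matrixP => a b; rewrite -[RHS]ip_row !row_row' ip_row mxE mxE. Qed.

Lemma posdef_unit n (g : 'M[R]_n) : posdef g -> g \in unitmx.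
Proof.
move=> [gs gp]; rewrite -row_free_unit -kermx_eq0; apply/eqP/row_matrixP => i; rewrite row0.
apply/eqP; apply: contraT => /gp; rewrite /ip -row_mul mulmx_ker row0 mul0mx mxE ltxx//.
Qed.

Lemma posdef_mul n p (g : 'M[R]_n) (A : 'M[R]_(p, n)) :
  row_free A -> posdef g -> posdef (A *m g *m A^T).
Proof.
move=> fA [gs gp]; split; first by rewrite !trmx_mul trmxK gs mulmxA.
move=> v v0; rewrite ip_mul; apply: gp; apply: contra v0 => /eqP vA.
by apply/eqP; apply: (row_free_inj fA); rewrite vA mul0mx.
Qed.

(** The orthogonal complement of [k] rows is a kernel of rank at least n - k > 0; a nonzero vector
    of it is normalized. *)
Lemma orthonormal_extend n k (g : 'M[R]_n) (A : 'M[R]_(k, n)) : posdef g -> (k < n)%N ->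
  exists v : 'rV[R]_n, ip g v v = 1 /\ v *m g *m A^T = 0.
Proof.
move=> [gs gp] kn; pose K := kermx (g *m A^T).
have : K != 0.
  rewrite kermx_eq0 /row_free neq_ltn; apply/orP; left.
  exact: leq_ltn_trans (rank_leq_col _) kn.
move=> /eqP K0; have [i Ki] : exists i, row i K != 0.
  apply/existsP; rewrite -[X in is_true X]negbK negb_exists; apply/negP => /forallP H; apply: K0.
  by apply/row_matrixP => i; rewrite row0; have := H i; rewrite negbK => /eqP.
have p0 := gp _ Ki; set u := row i K in Ki p0.
have uA : u *m g *m A^T = 0 by rewrite -mulmxA -row_mul mulmx_ker row0.
exists ((Num.sqrt (ip g u u))^-1 *: u); split; last by rewrite -!scalemxAl uA scaler0.
rewrite ipZl ipZr mulrA -invfM -expr2 sqr_sqrtr ?ltW// mulVf// gt_eqF//.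
Qed.

Lemma orthonormal_col n k (g : 'M[R]_n) (v : 'rV[R]_n) (A : 'M[R]_(k, n)) (B := col_mx v A : 'M[R]_(k.+1, n)) :
  g^T = g -> ip g v v = 1 -> v *m g *m A^T = 0 -> A *m g *m A^T = 1%:M -> B *m g *m B^T = 1%:M.
Proof.
move=> gs vv vA AA; have vr j : ip g v (row j A) = 0.
  by rewrite -[v](row_id ord0) ip_row vA mxE.
apply/matrixP => i j; rewrite -ip_row /B mxE.
case: (unliftP ord0 i) => [a ->|->]; case: (unliftP ord0 j) => [b ->|->].
- by rewrite !row_colS ip_row AA mxE (inj_eq lift_inj).
- by rewrite row_colS row_col0 ipC// vr eq_sym (negbTE (neq_lift _ _)).
- by rewrite row_colS row_col0 vr (negbTE (neq_lift _ _)).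
- by rewrite row_col0 eqxx.
Qed.

Lemma mul_col k l n (v : 'rV[R]_l) (A : 'M[R]_(k, l)) (P : 'M[R]_(l, n)) :
  (col_mx v A : 'M[R]_(k.+1, l)) *m P = (col_mx (v *m P) (A *m P) : 'M[R]_(k.+1, n)).
Proof. exact: (mul_col_mx v A P). Qed.

Lemma orthonormal_system n k (g : 'M[R]_n) : posdef g -> (k <= n)%N ->
  exists A : 'M[R]_(k, n), A *m g *m A^T = 1%:M.
Proof.
move=> gp; elim: k => [_|k IH kn]; first by exists 0; apply/matrixP => -[].
have [A AA] := IH (ltnW kn); have [v [vv vA]] := orthonormal_extend A gp kn.
exists (col_mx v A : 'M[R]_(k.+1, n)); exact: orthonormal_col (proj1 gp) vv vA AA.
Qed.

(** An orthonormal system of full length has nonzero determinant; if it is negative, [D] reverses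
    the first vector. Dimension 0 is treated apart, having no vector to reverse. *)
Lemma orthonormal_frame n (g : 'M[R]_n) : posdef g ->
  exists X : 'M[R]_n, X *m g *m X^T = 1%:M /\ 0 < \det X.
Proof.
case: n g => [|n] g gp.
  by exists 1%:M; split; [apply/matrixP => -[]|rewrite det1 ltr01].
have [A AA] := orthonormal_system gp (leqnn n.+1).
have dA : \det A != 0.
  apply/eqP => dA; have := congr1 (fun M => \det M) AA.
  by rewrite det1 -mulmxA det_mulmx dA mul0r => /eqP; rewrite eq_sym oner_eq0.
have [dA0|dA0|/eqP] := ltgtP (\det A) 0; [|by exists A|by rewrite (negbTE dA)].
pose D : 'M[R]_n.+1 := diag_mx (\row_j (if j == ord0 then -1 else 1)).
have dD : \det D = -1.
  rewrite det_diag big_ord_recl mxE eqxx big1 ?mulr1// => i _.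
  by rewrite mxE eq_sym (negbTE (neq_lift _ _)).
have DD : D *m D^T = 1%:M.
  rewrite tr_diag_mx mulmx_diag; apply/matrixP => i j; rewrite !mxE.
  by case: (i == ord0); rewrite ?mulrNN mulr1.
exists (D *m A); split; last by rewrite det_mulmx dD mulN1r oppr_gt0.
by rewrite trmx_mul -!mulmxA (mulmxA A) (mulmxA (A *m g)) AA mul1mx.
Qed.

Lemma det_frame n (g X : 'M[R]_n) : X *m g *m X^T = 1%:M -> (\det X) ^+ 2 * \det g = 1.
Proof.
by move=> /(congr1 (fun M => \det M)); rewrite det1 !det_mulmx det_tr => <-; ring.
Qed.

Lemma det_frame_sqrt n (g X : 'M[R]_n) : X *m g *m X^T = 1%:M -> 0 < \det X ->
  \det X * Num.sqrt (\det g) = 1.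
Proof.
move=> /det_frame E dX; rewrite -(gtr0_norm dX) -sqrtr_sqr -sqrtrM ?sqr_ge0// E.
exact: sqrtr1.
Qed.

Lemma posdef_minor n (g : 'M[R]_n.+1) i : posdef g -> posdef (row' i (col' i g)).
Proof.
move=> gp; have -> : row' i (col' i g) = row' i 1%:M *m g *m (row' i 1%:M)^T.
  by rewrite -minor_mul mul1mx trmx1 mulmx1.
apply: posdef_mul => //; apply/row_freeP; exists (col' i 1%:M).
apply/matrixP => a b; rewrite !mxE (bigD1 (lift i b))//= big1 ?addr0 => [|c cb].
  by rewrite !mxE eqxx mulr1 (inj_eq lift_inj).
by rewrite !mxE (negbTE cb) mulr0.
Qed.

(* The unit vector cos(phi) nu + sin(phi) u together with an orthonormal basis of
   the hyperplane spanned by all the rows of A but one is an orthonormal system. *)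
Lemma comass_normal_bound k d (w : 'M[R]_(k.+1, d) -> R) (G : 'M[R]_d) (A : 'M[R]_(k.+1, d))
    (X : 'M[R]_k.+1) i (U : 'rV[R]_d) :
  multilinear w -> alternating w -> posdef G ->
  (forall B, B *m G *m B^T = 1%:M -> `|w B| <= 1) ->
  row_free A -> X *m (A *m G *m A^T) *m X^T = 1%:M -> U *m G *m A^T = 0 ->
  `|w (set_row i U A)| <= Num.sqrt (ip G U U) * Num.sqrt (1 - w (X *m A) ^+ 2) *
     Num.sqrt (\det (row' i (col' i (A *m G *m A^T)))).
Proof.
move=> wl wa Gp w1 fA XX UA; set g := A *m G *m A^T.
have gp : posdef g by exact: posdef_mul.
have [Gs _] := Gp; have [gs _] := gp.
(* [Q] turns the rows of [A] other than the i-th into an orthonormal basis [E] of the hyperplane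
   that they span; 1 / det Q is the volume density of this hyperplane. *)
have [Q [QQ dQ]] : exists Q : 'M[R]_k, Q *m row' i (col' i g) *m Q^T = 1%:M /\ 0 < \det Q.
  exact: orthonormal_frame (posdef_minor i gp).
have [->|U0] := eqVneq U 0.
  by rewrite multilinear0// normr0 !mulr_ge0// sqrtr_ge0.
pose A' : 'M[R]_(k, d) := row' i A; have gA' : row' i (col' i g) = A' *m G *m A'^T.
  exact: minor_mul.
pose Z : 'M[R]_(k, k.+1) := Q *m row' i (1%:M : 'M[R]_k.+1); pose E : 'M[R]_(k, d) := Q *m A'.
have ZA : Z *m A = E by rewrite /Z /E -(mulmxA Q); congr mulmx; exact: (mul_row'1 A i).
have EE : E *m G *m E^T = 1%:M by rewrite -QQ gA' /E trmx_mul !mulmxA.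
(* [nu] is the unit conormal: tangent, being a combination of the rows of [A], and orthogonal to
   [E]. *)
have [v [vv vZ]] := orthonormal_extend Z gp (ltnSn k).
pose nu := v *m A; have nn : ip G nu nu = 1 by rewrite -ip_mul.
have nE : nu *m G *m E^T = 0.
  by rewrite -vZ -ZA trmx_mul /nu /g !mulmxA.
pose r := Num.sqrt (ip G U U); have r0 : 0 < r by rewrite sqrtr_gt0; have [_] := Gp; exact.
have [u ru] : exists u, U = r *: u.
  by exists (r^-1 *: U); rewrite scalerA mulfV ?gt_eqF// scale1r.
have uu : ip G u u = 1.
  have r2 : r ^+ 2 = ip G U U by rewrite sqr_sqrtr ?ltW//; have [_] := Gp; exact.
  have r20 : r ^+ 2 != 0 by rewrite sqrf_eq0 gt_eqF.
  by apply: (mulfI r20); rewrite mulr1 [RHS]r2 ru ipZl ipZr mulrA.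
have uA : u *m G *m A^T = 0.
  by apply: (scalerI (lt0r_neq0 r0)); rewrite scaler0 !scalemxAl -ru.
have uE : u *m G *m E^T = 0 by rewrite -ZA trmx_mul mulmxA uA mul0mx.
have un : ip G u nu = 0 by rewrite /ip trmx_mul mulmxA uA mul0mx mxE.
have nu' : ip G nu u = 0 by rewrite ipC.
pose W (y : 'rV[R]_d) := w (col_mx y E : 'M[R]_(k.+1, d)).
have Wl a b : W (a *: nu + b *: u) = a * W nu + b * W u.
  have H y : W y = w (set_row ord0 y (col_mx (0 : 'rV[R]_d) E : 'M[R]_(k.+1, d))).
    rewrite /W; congr w; apply/row_matrixP => j; rewrite rowK.
    by case: (unliftP ord0 j) => [l ->|->]; rewrite ?row_col0// !row_colS.
  by rewrite !H wl multilinearZ.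
have W1 a b : a ^+ 2 + b ^+ 2 = 1 -> `|a * W nu + b * W u| <= 1.
  move=> ab; rewrite -Wl; apply: w1; set y := a *: nu + b *: u.
  have yE : y *m G *m E^T = 0 by rewrite /y !mulmxDl -!scalemxAl nE uE !scaler0 addr0.
  have yy : ip G y y = 1.
    by rewrite /y ipDl !ipDr !ipZl !ipZr nn uu un nu' !mulr1 !mulr0 addr0 add0r -!expr2.
  exact: orthonormal_col.
(* The best direction is (a, b) proportional to (W nu, W u); for it the left side of [W1] is the
   square root of the sum of squares. *)
have Wle : W nu ^+ 2 + W u ^+ 2 <= 1.
  set s := W nu ^+ 2 + W u ^+ 2; have s0 : 0 <= s by rewrite addr_ge0// sqr_ge0.
  have [->|sn0] := eqVneq s 0; first exact: ler01.
  have sp : 0 < s by rewrite lt_neqAle eq_sym sn0.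
  pose q := Num.sqrt s; have q0 : 0 < q by rewrite sqrtr_gt0.
  have qq : q ^+ 2 = s by rewrite sqr_sqrtr.
  have := W1 (W nu / q) (W u / q); rewrite !exprMn -mulrDl -/s exprVn qq divff// => /(_ erefl).
  have -> : W nu / q * W nu + W u / q * W u = q.
    by rewrite mulrAC [W u / q * _]mulrAC -mulrDl -!expr2 -/s -qq expr2 mulfK// gt_eqF.
  by rewrite gtr0_norm// -qq => ?; rewrite expr_le1// ltW.
(* The frames [Y] and [X] may have opposite orientations, so only squares are compared; both
   determinants have square 1 / det g. *)
have Wnu : W nu ^+ 2 = w (X *m A) ^+ 2.
  pose Y := col_mx v Z : 'M[R]_k.+1.
  have YY : Y *m g *m Y^T = 1%:M.
    apply: orthonormal_col => //.
    by rewrite /g !mulmxA ZA -mulmxA -trmx_mul ZA.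
  have -> : W nu = w (Y *m A) by rewrite /W /Y mul_col ZA.
  rewrite !alternating_mul// !exprMn; congr (_ * _).
  have dg : \det g != 0 by have := posdef_unit gp; rewrite unitmxE unitfE.
  by apply: (mulIf dg); rewrite (det_frame YY) (det_frame XX).
have dgi : \det Q * Num.sqrt (\det (row' i (col' i g))) = 1 by exact: det_frame_sqrt.
have AE : A' = invmx Q *m E by rewrite /E mulKmx// unitmxE unitfE gt_eqF.
have -> : w (set_row i U A) = (-1) ^+ i * ((\det Q)^-1 * (r * W u)).
  rewrite set_row_colE//; congr (_ * _); rewrite -/A' AE.
  have -> : r * W u = W U.
    by have := Wl 0 r; rewrite scale0r add0r mul0r add0r -ru => ->.
  by rewrite (alternating_mul (invmx Q) E (multilinear_col U wl) (alternating_col U wa)) det_inv.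
have dQi : (\det Q)^-1 = Num.sqrt (\det (row' i (col' i g))).
  by apply: (mulfI (lt0r_neq0 dQ)); rewrite dgi divff// gt_eqF.
rewrite normrM normrX normrN1 expr1n mul1r dQi !normrM (ger0_norm (sqrtr_ge0 _)) (gtr0_norm r0).
rewrite [leRHS]mulrC ler_wpM2l ?sqrtr_ge0// ler_wpM2l ?(ltW r0)//.
rewrite -(sqrtr_sqr (W u)) ler_sqrt ?subr_ge0; last by rewrite -Wnu (le_trans _ Wle)// lerDl sqr_ge0.
by rewrite lerBrDr addrC -Wnu.
Qed.

End Orthonormal.

(** * The geometry of an immersion in coordinates *)

Lemma row'_col (R : realType) k d (u : 'rV[R]_d) (A : 'M[R]_(k.+1, d)) (j : 'I_k.+1) :
  (row' (lift ord0 j) (col_mx u A : 'M[R]_(k.+2, d)) : 'M[R]_(k.+1, d)) =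
  (col_mx u (row' j A : 'M[R]_(k, d)) : 'M[R]_(k.+1, d)).
Proof.
have r p (B : 'M[R]_(p.+1, d)) a (i : 'I_p) : row i (row' a B : 'M[R]_(p, d)) = row (lift a i) B.
  exact: row_row'.
apply/row_matrixP => i; rewrite r; case: (unliftP ord0 i) => [l ->|->].
  rewrite row_colS r; have -> : lift (lift ord0 j) (lift ord0 l) = lift ord0 (lift j l).
    by apply/val_inj => /=; rewrite /bump/= !add1n ltnS; case: (j <= l)%N.
  by rewrite row_colS.
rewrite row_col0; have -> : lift (lift ord0 j) (ord0 : 'I_k.+1) = ord0 by apply/val_inj.
by rewrite row_col0.
Qed.

(** * Matrix-valued maps of class [Ck] and forms with moving arguments *)

Section MatrixCalculus.
Context {R : realType}.

Notation e_ i := (delta_mx 0 i).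

Lemma Ck_entry d p q k U (A : 'rV[R]_d -> 'M[R]_(p, q)) i j : open U ->
  Ck k U A -> Ck k U (fun x => A x i j : R^o).
Proof. by move=> oU /(Ck_mxP _ _ oU). Qed.

Lemma Ck_mulmx d p q r k U (A : 'rV[R]_d -> 'M[R]_(p, q)) (B : 'rV[R]_d -> 'M[R]_(q, r)) : open U ->
  Ck k U A -> Ck k U B -> Ck k U (fun x => A x *m B x).
Proof.
move=> oU CA CB; apply/Ck_mxP => // i j.
have -> : (fun x => (A x *m B x) i j : R^o) = fun x => \sum_l A x i l * B x l j : R^o.
  by apply/funext => x; rewrite mxE.
by apply: Ck_sum => // l _; apply: CkM => //; exact: Ck_entry.
Qed.

Lemma Ck_addmx d p q k U (A B : 'rV[R]_d -> 'M[R]_(p, q)) : open U ->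
  Ck k U A -> Ck k U B -> Ck k U (fun x => A x + B x).
Proof.
move=> oU CA CB; apply/Ck_mxP => // i j.
have -> : (fun x => (A x + B x) i j : R^o) = fun x => A x i j + B x i j : R^o.
  by apply/funext => x; rewrite mxE.
by apply: CkD => //; exact: Ck_entry.
Qed.

Lemma Ck_scalemx d p q k U (a : 'rV[R]_d -> R^o) (B : 'rV[R]_d -> 'M[R]_(p, q)) : open U ->
  Ck k U a -> Ck k U B -> Ck k U (fun x => a x *: B x).
Proof.
move=> oU CA CB; apply/Ck_mxP => // i j.
have -> : (fun x => (a x *: B x) i j : R^o) = fun x => a x * B x i j : R^o.
  by apply/funext => x; rewrite mxE.
by apply: CkM => //; exact: Ck_entry.
Qed.

Lemma Ck_oppmx d p q k U (B : 'rV[R]_d -> 'M[R]_(p, q)) : open U ->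
  Ck k U B -> Ck k U (fun x => - B x).
Proof.
move=> oU CB; have -> : (fun x => - B x) = fun x => (-1 : R) *: B x by apply/funext => x; rewrite scaleN1r.
by apply: Ck_scalemx => //; exact: Ck_cst.
Qed.

Lemma Ck_trmx d p q k U (A : 'rV[R]_d -> 'M[R]_(p, q)) : open U ->
  Ck k U A -> Ck k U (fun x => (A x)^T).
Proof.
move=> oU CA; apply/Ck_mxP => // i j.
have -> : (fun x => (A x)^T i j : R^o) = fun x => A x j i : R^o.
  by apply/funext => x; rewrite mxE.
exact: Ck_entry.
Qed.

Lemma Ck_det d n k U (A : 'rV[R]_d -> 'M[R]_n) : open U ->
  Ck k U A -> Ck k U (fun x => \det (A x) : R^o).
Proof.
move=> oU CA; apply: Ck_sum => // s _; apply: CkM => //; first exact: Ck_cst.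
by apply: Ck_prod => // i _; exact: Ck_entry.
Qed.

Lemma Ck_invmx d n k U (A : 'rV[R]_d -> 'M[R]_n) : open U ->
  (forall x, U x -> A x \in unitmx) -> Ck k U A -> Ck k U (fun x => invmx (A x)).
Proof.
move=> oU uA CA.
apply: (@Ck_ext _ _ _ _ _ (fun x => (\det (A x))^-1 *: \adj (A x))) => // [x /uA u|].
  by rewrite /invmx u.
apply: Ck_scalemx => //.
  by apply: CkV => //; [move=> x /uA; rewrite unitmxE unitfE|exact: Ck_det].
apply/Ck_mxP => // i j.
have -> : (fun x => (\adj (A x)) i j : R^o) = fun x => cofactor (A x) j i : R^o.
  by apply/funext => x; rewrite mxE.
apply: CkM => //; first exact: Ck_cst.
apply: Ck_det => //; apply/Ck_mxP => // a b.
have -> : (fun x => (row' j (col' i (A x))) a b : R^o) = fun x => A x (lift j a) (lift i b) : R^o.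
  by apply/funext => x; rewrite !mxE.
exact: Ck_entry.
Qed.

Lemma Ck_summx d p q k U (I : finType) (P : pred I) (A : I -> 'rV[R]_d -> 'M[R]_(p, q)) : open U ->
  (forall i, P i -> Ck k U (A i)) -> Ck k U (fun x => \sum_(i | P i) A i x).
Proof.
move=> oU CA; apply/Ck_mxP => // i j.
have -> : (fun x => (\sum_(l | P l) A l x) i j : R^o) = fun x => \sum_(l | P l) A l x i j : R^o.
  by apply/funext => x; rewrite summxE.
by apply: Ck_sum => // l Pl; apply: Ck_entry => //; exact: CA.
Qed.

Lemma Ck_ip d n k U (G : 'rV[R]_d -> 'M[R]_n) (u v : 'rV[R]_d -> 'rV[R]_n) : open U ->
  Ck k U G -> Ck k U u -> Ck k U v -> Ck k U (fun x => ip (G x) (u x) (v x) : R^o).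
Proof.
move=> oU CG Cu Cv; apply: Ck_entry => //; apply: Ck_mulmx => //; last exact: Ck_trmx.
exact: Ck_mulmx.
Qed.

Lemma Ck_compmx a b p q k U V (f : 'rV[R]_a -> 'rV[R]_b) (g : 'rV[R]_b -> 'M[R]_(p, q)) :
  open U -> open V -> (forall x, U x -> V (f x)) ->
  Ck k U f -> Ck k V g -> Ck k U (g \o f).
Proof.
move=> oU oV UV Cf Cg; apply/Ck_mxP => // i j.
by apply: (Ck_comp oU oV UV Cf (g := fun y => g y i j : R^o)); exact: Ck_entry.
Qed.

Lemma Ck_derive d (W : normedModType R) k U (f : 'rV[R]_d -> W) i :
  Ck k.+1 U f -> Ck k U ('D_(e_ i) f).
Proof. by move=> [_ /(_ i)[]]. Qed.

Lemma Ck_derivable d (W : normedModType R) k U (f : 'rV[R]_d -> W) i x :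
  Ck k.+1 U f -> U x -> derivable f x (e_ i).
Proof. by move=> [_ /(_ i)[+ _]]; exact. Qed.

Lemma row_jacobian a b (f : 'rV[R]_a -> 'rV[R]_b) x i : differentiable f x ->
  row i ('J f x) = 'D_(e_ i) f x.
Proof. by move=> df; rewrite rowE deriveEjacobian. Qed.

Lemma Ck_jacobian a b k U (f : 'rV[R]_a -> 'rV[R]_b) : open U -> Ck k.+1 U f -> Ck k U (jacobian f).
Proof.
move=> oU Cf; apply/Ck_mxP => // i j.
apply: (@Ck_ext _ _ _ _ _ (fun x => ('D_(e_ i) f x) 0 j : R^o)) => // [x Ux|].
  by have /rowP/(_ j) := row_jacobian i (Ck_differentiable oU Cf Ux); rewrite mxE => ->.
by apply: Ck_entry => //; exact: Ck_derive.
Qed.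

Lemma is_derive_mulmx (V : normedModType R) p q r (A : V -> 'M[R]_(p, q)) (B : V -> 'M[R]_(q, r)) x v :
  derivable A x v -> derivable B x v ->
  is_derive x v (fun z => A z *m B z) ('D_v A x *m B x + A x *m 'D_v B x).
Proof.
move=> dA dB.
have H i j : is_derive x v (fun z => (A z *m B z) i j : R^o)
    (\sum_l ('D_v (fun z => A z i l : R^o) x * B x l j + A x i l * 'D_v (fun z => B z l j : R^o) x)).
  have -> : (fun z => (A z *m B z) i j : R^o) = \sum_l (fun z => A z i l * B z l j : R^o).
    by apply/funext => z; rewrite mxE fct_sumE.
  apply: is_derive_sum => l.
  have a : is_derive x v (fun z => A z i l : R^o) ('D_v (fun z => A z i l : R^o) x).
    by apply: derivableP; move/derivable_mxP : dA; exact.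
  have b : is_derive x v (fun z => B z l j : R^o) ('D_v (fun z => B z l j : R^o) x).
    by apply: derivableP; move/derivable_mxP : dB; exact.
  apply: is_derive_eq (is_deriveM a b) _.
  by rewrite addrC /GRing.scale/= [B x l j * _]mulrC.
have D : derivable (fun z => A z *m B z) x v by apply/derivable_mxP => i j; have [] := H i j.
apply: DeriveDef => //; rewrite derive_mx// !derive_mx//; apply/matrixP => i j.
by rewrite !mxE; have [_ ->] := H i j; rewrite big_split/=; congr (_ + _); apply: eq_bigr => l _; rewrite !mxE.
Qed.

Lemma is_derive_trmx (V : normedModType R) p q (A : V -> 'M[R]_(p, q)) x v :
  derivable A x v -> is_derive x v (fun z => (A z)^T) ('D_v A x)^T.
Proof.
move=> dA; have E i j : (fun z => (A z)^T i j : R) = fun z => A z j i by apply/funext => z; rewrite mxE.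
have dd : derivable (fun z => (A z)^T) x v.
  by apply/derivable_mxP => i j; rewrite E; move/derivable_mxP : dA; exact.
apply: DeriveDef => //; rewrite derive_mx// derive_mx//; apply/matrixP => i j.
by rewrite mxE E mxE mxE.
Qed.

Lemma is_derive_set_row (V : normedModType R) n d (P : V -> 'rV[R]_d) (A : V -> 'M[R]_(n, d)) x v i :
  derivable P x v -> derivable A x v ->
  is_derive x v (fun z => set_row i (P z) (A z)) (set_row i ('D_v P x) ('D_v A x)).
Proof.
move=> dP dA; have E a b : (fun z => (set_row i (P z) (A z)) a b : R) =
    if a == i then fun z => P z 0 b else fun z => A z a b.
  by apply/funext => z; rewrite mxE; case: ifP => _; rewrite ?mxE.
have dd : derivable (fun z => set_row i (P z) (A z)) x v.
  apply/derivable_mxP => a b; rewrite E; case: ifP => _.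
    by move/derivable_mxP : dP; exact.
  by move/derivable_mxP : dA; exact.
apply: DeriveDef => //; rewrite (derive_mx dd) (derive_mx dP) (derive_mx dA).
apply/matrixP => a b; rewrite mxE E [RHS]mxE; case: ifP => _; rewrite [RHS]mxE; first by [].
by rewrite [RHS]mxE.
Qed.

Lemma schwarz_row a b U (f : 'rV[R]_a -> 'rV[R]_b) x i j : open U -> Ck 2 U f -> U x ->
  'D_(e_ i) ('D_(e_ j) f) x = 'D_(e_ j) ('D_(e_ i) f) x.
Proof.
move=> oU Cf Ux; apply/rowP => l.
have P i' j' : ('D_(e_ j') ('D_(e_ i') f) x) 0 l = 'D_(e_ j') ('D_(e_ i') (fun z => f z 0 l : R^o)) x.
  have dD : derivable ('D_(e_ i') f) x (e_ j').
    by apply: (Ck_derivable (k := 0) (U := U)) Ux; exact: Ck_derive Cf.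
  rewrite (derive_mx dD) mxE; apply: near_eq_derive; apply: (near_open oU Ux) => z Uz.
  have dz : derivable f z (e_ i') by exact: (Ck_derivable Cf Uz).
  by rewrite (derive_mx dz) mxE.
have C : Ck 2 U (fun z => f z 0 l : R^o) by exact: Ck_entry.
exact: etrans (P j i) (etrans (schwarz i j oU C Ux) (esym (P i j))).
Qed.

Lemma derive_jacobianC a b U (f : 'rV[R]_a -> 'rV[R]_b) x i j : open U -> Ck 2 U f -> U x ->
  row i ('D_(e_ j) (jacobian f) x) = row j ('D_(e_ i) (jacobian f) x).
Proof.
move=> oU Cf Ux; have CJ : Ck 1 U (jacobian f) by exact: Ck_jacobian.
have H i' j' : row i' ('D_(e_ j') (jacobian f) x) = 'D_(e_ j') ('D_(e_ i') f) x.
  have dD : derivable ('D_(e_ i') f) x (e_ j').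
    by apply: (Ck_derivable (k := 0) (U := U)) Ux; exact: Ck_derive Cf.
  have dJ : derivable (jacobian f) x (e_ j') by exact: (Ck_derivable CJ Ux).
  rewrite (derive_mx dJ) (derive_mx dD); apply/rowP => l; rewrite mxE mxE mxE.
  apply: near_eq_derive; apply: (near_open oU Ux) => z Uz.
  by have /rowP/(_ l) := row_jacobian i' (Ck_differentiable oU Cf Uz); rewrite mxE.
by rewrite !H; exact: (schwarz_row j i oU Cf Ux).
Qed.

(** Symmetry of the Hessian of [f] in arbitrary directions: it removes the asymmetric second
    derivatives from the transformation laws of the Christoffel term and of the exterior density. *)
Lemma mul_derive_jacobianC a b U (f : 'rV[R]_a -> 'rV[R]_b) x h k : open U -> Ck 2 U f -> U x ->
  k *m 'D_h (jacobian f) x = h *m 'D_k (jacobian f) x.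
Proof.
move=> oU Cf Ux.
have dJ : differentiable (jacobian f) x by apply: (Ck_differentiable (k := 0) oU _ Ux); exact: Ck_jacobian.
rewrite (derive_sum_partials h dJ) (derive_sum_partials k dJ) !mulmx_sumr.
under eq_bigr do rewrite -scalemxAr mulmx_sum_row scaler_sumr.
under [RHS]eq_bigr do rewrite -scalemxAr mulmx_sum_row scaler_sumr.
rewrite exchange_big; apply: eq_bigr => i _; apply: eq_bigr => j _.
by rewrite (derive_jacobianC i j oU Cf Ux) !scalerA mulrC.
Qed.

Lemma is_derive_prod (V : normedModType R) (I : finType) (f : I -> V -> R^o) (df : I -> R^o) x v :
  (forall i, is_derive x v (f i) (df i)) ->
  is_derive x v (fun z => \prod_i f i z : R^o) (\sum_i df i * \prod_(l | l != i) f l x).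
Proof.
move=> H; have : uniq (index_enum I) by exact: index_enum_uniq.
elim: (index_enum I) => [|a r IH] /=.
  move=> _; rewrite big_nil; have -> : (fun z => \prod_(i <- [::]) f i z : R^o) = cst 1.
    by apply/funext => z; rewrite big_nil.
  exact: is_derive_cst.
move=> /andP[ar ur].
have -> : (fun z => \prod_(i <- a :: r) f i z : R^o) = (f a) * (fun z => \prod_(i <- r) f i z : R^o).
  by apply/funext => z; rewrite big_cons.
apply: is_derive_eq (is_deriveM (H a) (IH ur)) _.
rewrite big_cons big_cons eqxx /= addrC; congr (_ + _).
  rewrite /GRing.scale/= mulrC; congr (_ * _); rewrite [LHS]big_seq_cond [RHS]big_seq_cond.
  apply: eq_bigl => i; rewrite andbT; case: (boolP (i \in r)) => // ir /=.
  by apply/esym; apply: contraNneq ar => <-.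
rewrite /GRing.scale/= mulr_sumr big_seq [RHS]big_seq; apply: eq_bigr => i ir.
rewrite big_cons; have -> : a != i by apply: contraNneq ar => ->.
by rewrite mulrCA.
Qed.

(** Both the form and its arguments depend on the point. In the expansion over fixed tuples [E f] of
    basis vectors the coefficients are products of entries and the form has fixed arguments, so the
    product rule applies. *)
Lemma is_derive_multilinear (V : normedModType R) k d (w : V -> 'M[R]_(k, d) -> R)
    (A : V -> 'M[R]_(k, d)) x v :
  (\forall z \near x, multilinear (w z)) ->
  (forall B, derivable (fun z => w z B : R^o) x v) -> derivable A x v ->
  is_derive x v (fun z => w z (A z) : R^o)
    ('D_v (fun z => w z (A x) : R^o) x + polarize (w x) (A x) ('D_v A x)).
Proof.
move=> wl dw dA.
pose E (f : {ffun 'I_k -> 'I_d}) : 'M[R]_(k, d) := \matrix_i row (f i) 1%:M.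
have ex z B : multilinear (w z) -> w z B = \sum_(f : {ffun 'I_k -> 'I_d}) (\prod_i B i (f i)) * w z (E f).
  by move=> wz; rewrite -{1}[B]mulmx1 multilinear_expand.
have wx : multilinear (w x) := nbhs_singleton wl.
have S (B : V -> 'M[R]_(k, d)) : derivable B x v -> is_derive x v (fun z => w z (B z) : R^o)
    (\sum_(f : {ffun 'I_k -> 'I_d}) ((\prod_i B x i (f i)) * 'D_v (fun z => w z (E f) : R^o) x
      + (\sum_i ('D_v B x) i (f i) * \prod_(l | l != i) B x l (f l)) * w x (E f))).
  move=> dB; apply: (@near_eq_is_derive _ _ _ (fun z => \sum_(f : {ffun 'I_k -> 'I_d}) (\prod_i B z i (f i)) * w z (E f) : R^o)).
    by apply: filterS wl => z /(ex z (B z)) ->.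
  have -> : (fun z => \sum_(f : {ffun 'I_k -> 'I_d}) (\prod_i B z i (f i)) * w z (E f) : R^o) =
    \sum_(f : {ffun 'I_k -> 'I_d}) (fun z => (\prod_i B z i (f i)) * w z (E f) : R^o).
    by apply/funext => z; rewrite fct_sumE.
  have SS : forall r : seq {ffun 'I_k -> 'I_d}, is_derive x v (\sum_(f <- r) (fun z => (\prod_i B z i (f i)) * w z (E f) : R^o))
    (\sum_(f <- r) ((\prod_i B x i (f i)) * 'D_v (fun z => w z (E f) : R^o) x
      + (\sum_i ('D_v B x) i (f i) * \prod_(l | l != i) B x l (f l)) * w x (E f))).
    elim=> [|f r IH]; first by rewrite !big_nil; exact: is_derive_cst.
    rewrite !big_cons; apply: is_deriveD => //.
    have b i : is_derive x v (fun z => B z i (f i) : R^o) (('D_v B x) i (f i)).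
      rewrite derive_mx// mxE; apply: derivableP; by move/derivable_mxP : dB; exact.
    have c : is_derive x v (fun z => w z (E f) : R^o) ('D_v (fun z => w z (E f) : R^o) x) by apply: derivableP.
    apply: is_derive_eq (is_deriveM (is_derive_prod b) c) _.
    by rewrite /GRing.scale/= [w x _ * _]mulrC.
  exact: SS.
apply: is_derive_eq (S _ dA) _; rewrite big_split/=; congr (_ + _).
  (* The same formula with the argument frozen at [A x] identifies the first half of the sum as the
     derivative of the form alone. *)
  have [_ ->] := S (cst (A x)) (derivable_cst (A x) x v); apply: eq_bigr => f _.
  rewrite derive_cst; rewrite [X in _ + X * _]big1 ?mul0r ?addr0// => i _.
  by rewrite mxE mul0r.
rewrite /polarize; under [RHS]eq_bigr do rewrite ex//.
rewrite exchange_big/=; apply: eq_bigr => f _; rewrite -mulr_suml; congr (_ * _).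
apply: eq_bigr => i _; rewrite [RHS](bigD1 i)//= !mxE eqxx !mxE; congr (_ * _).
by apply: eq_bigr => l li; rewrite !mxE (negbTE li) !mxE.
Qed.

(** [polarize w A B] is the derivative at 0 of [w (A + t *: B)], so the factor det P comes out of a
    derivative of one real variable. *)
Lemma polarize_mulmx k d (w : 'M[R]_(k, d) -> R) (P : 'M[R]_k) (A B : 'M[R]_(k, d)) :
  multilinear w -> alternating w -> polarize w (P *m A) (P *m B) = \det P * polarize w A B.
Proof.
move=> wl wa.
have D (C C' : 'M[R]_(k, d)) : is_derive (0 : R) (1 : R) (fun t : R => w (C + t *: C') : R^o) (polarize w C C').
  have l t : is_derive (t : R) (1 : R) (fun t : R => C + t *: C') C'.
    have -> : (fun t : R => C + t *: C') = cst C + (fun t : R => t *: C') by [].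
    have dl : is_derive (t : R) (1 : R) (fun t : R => t *: C') C'.
      have dd : differentiable (fun t : R => t *: C') t by exact: differentiableZl.
      apply: DeriveDef; first exact: diff_derivable.
      by rewrite deriveE// diffZl//= diff_val scale1r.
    by apply: is_derive_eq (is_deriveD _ dl) _ => //; rewrite add0r.
  have [dl El] := l 0.
  apply: is_derive_eq (is_derive_multilinear (w := fun=> w) _ _ dl) _; first by near=> z.
    by move=> B'; exact: derivable_cst.
  by rewrite El scale0r addr0 derive_cst add0r.
have [_ <-] := D (P *m A) (P *m B); have [dd <-] := D A B.
have -> : (fun t : R => w (P *m A + t *: (P *m B)) : R^o) = (fun t : R => \det P *: w (A + t *: B) : R^o).
  by apply/funext => t; rewrite scalemxAr -mulmxDr alternating_mul.
by rewrite [LHS](deriveZ (\det P) dd).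
Unshelve. all: by end_near. Qed.

End MatrixCalculus.

(** The local theory takes place between two Euclidean open sets under these hypotheses; manifolds
    enter through a proof of this record for a pair of charts. Multilinearity and the like are
    claimed on [V] only, because the components of a form carry no meaning off the chart. *)
Record local_data (R : realType) (m d : nat) (U : set 'rV[R]_m.+1) (V : set 'rV[R]_d)
    (f : 'rV[R]_m.+1 -> 'rV[R]_d) (G : 'rV[R]_d -> 'M[R]_d)
    (w : 'rV[R]_d -> 'M[R]_(m.+1, d) -> R) : Prop := LocalData {
  ld_openU : open U;
  ld_openV : open V;
  ld_maps : forall x, U x -> V (f x);
  ld_map : smooth_on U f;
  ld_immersion : forall x, U x -> row_free ('J f x);
  ld_metric : smooth_on V G;
  ld_posdef : forall y, V y -> posdef (G y);
  ld_form : forall A, smooth_on V (fun y => w y A : R^o);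
  ld_multilinear : forall y, V y -> multilinear (w y);
  ld_alternating : forall y, V y -> alternating (w y);
  ld_closed : forall y, V y -> forall A : 'M[R]_(m.+2, d),
    \sum_(i < m.+2) (-1) ^+ i * 'D_(row i A) (fun z => w z (row' i A) : R^o) y = 0 }.

(** * Levi-Civita derivative, mean curvature and the divergence identity *)

Section LocalGeometryTheory.
Context {R : realType} {m d : nat}.

Notation e_ i := (delta_mx 0 i).

Lemma ip_inj n (G : 'M[R]_n) (u v : 'rV[R]_n) : posdef G ->
  (forall l, ip G u l = ip G v l) -> u = v.
Proof.
move=> [_ Gp] H; apply/eqP; rewrite -subr_eq0; apply/negPn/negP => /Gp.
by rewrite ipBl H subrr ltxx.
Qed.

Lemma addr0_opp (a b c : R) : a + b = 0 -> b = c -> a = - c.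
Proof. by move=> /eqP; rewrite addr_eq0 => /eqP -> ->. Qed.

Lemma derive_linear (V W : normedModType R) (f : V -> W) y a u v : differentiable f y ->
  'D_(a *: u + v) f y = a *: 'D_u f y + 'D_v f y.
Proof. by move=> df; rewrite !deriveE// linearP. Qed.

Lemma mxE_lin n (L : 'rV[R]_n -> R) (l : 'rV[R]_n) :
  (forall a u v, L (a *: u + v) = a * L u + L v) ->
  ((\row_e L (e_ e)) *m l^T) 0 0 = L l.
Proof.
move=> HL; have L0 : L 0 = 0.
  have := HL 1 0 0; rewrite scaler0 addr0 mul1r => H.
  by apply: (addrI (L 0)); rewrite addr0 -H.
rewrite [in RHS](row_sum_delta l) mxE.
rewrite (_ : L _ = \sum_j l 0 j * L (e_ j)).
  by apply: eq_bigr => j _; rewrite !mxE mulrC.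
elim/big_rec2 : _ => [//|j y z _ <-]; exact: HL.
Qed.

Lemma ip_mxD n (G G' : 'M[R]_n) u v : ip (G + G') u v = ip G u v + ip G' u v.
Proof. by rewrite /ip mulmxDr mulmxDl mxE. Qed.

Lemma ip_mxZ n a (G : 'M[R]_n) u v : ip (a *: G) u v = a * ip G u v.
Proof. by rewrite /ip -scalemxAr -scalemxAl mxE. Qed.

Section Christoffel.
Variables (g : 'M[R]_d) (D : 'rV[R]_d -> 'M[R]_d).
Hypothesis gP : posdef g.
Hypothesis Dl : forall a u v, D (a *: u + v) = a *: D u + D v.
Hypothesis Ds : forall h, (D h)^T = D h.

(** [D h] stands for the derivative of the metric along [h], and this is twice the product of [l]
    with the Levi-Civita derivative of the constant field [k] along [h]: the bracket terms of
    Koszul's formula vanish. With [g] and [D] abstract, the identities are algebra at one point. *)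
Definition koszul (h k l : 'rV[R]_d) : R := ip (D h) k l + ip (D k) h l - ip (D l) h k.

Definition koszul_vector (h k : 'rV[R]_d) : 'rV[R]_d :=
  2^-1 *: ((\row_e koszul h k (e_ e)) *m invmx g).

Lemma koszul_vectorE h k l : ip g (koszul_vector h k) l = 2^-1 * koszul h k l.
Proof.
rewrite /koszul_vector ipZl; congr (_ * _).
rewrite /ip mulmxKV ?posdef_unit//; apply: (mxE_lin (L := koszul h k)) => a u v.
by rewrite /koszul !ipDr !ipZr Dl ip_mxD ip_mxZ; ring.
Qed.

Lemma koszul_vectorC h k : koszul_vector h k = koszul_vector k h.
Proof.
apply: (ip_inj gP) => l; rewrite !koszul_vectorE /koszul.
by rewrite [ip (D l) h k]ipC// [ip (D h) k l + _]addrC.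
Qed.

Lemma koszul_vector_linear h a k k' :
  koszul_vector h (a *: k + k') = a *: koszul_vector h k + koszul_vector h k'.
Proof.
apply: (ip_inj gP) => l; rewrite ip_linear !koszul_vectorE /koszul.
by rewrite !ipDl !ipZl !ipDr !ipZr Dl ip_mxD ip_mxZ; ring.
Qed.

(** In the sum of the two Koszul expressions the terms in [D h] and [D k] cancel by symmetry,
    leaving twice the term in [D u]. *)
Lemma koszul_vector_compatible u h k :
  ip (D u) h k = ip g (koszul_vector u h) k + ip g h (koszul_vector u k).
Proof.
have [gs _] := gP; rewrite [ip g h _]ipC// !koszul_vectorE /koszul.
rewrite (ipC u k (Ds h)) (ipC k h (Ds u)) (ipC u h (Ds k)).
by field.
Qed.

End Christoffel.

Section Data.
Variables (U : set 'rV[R]_m.+1) (V : set 'rV[R]_d) (f : 'rV[R]_m.+1 -> 'rV[R]_d)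
  (G : 'rV[R]_d -> 'M[R]_d) (w : 'rV[R]_d -> 'M[R]_(m.+1, d) -> R).
Hypothesis L : local_data U V f G w.

Let oU := ld_openU L.
Let oV := ld_openV L.
Let UV := ld_maps L.

Lemma metric_differentiable y : V y -> differentiable G y.
Proof. by move=> Vy; apply: Ck_differentiable oV (ld_metric L 1) Vy. Qed.

Lemma derive_metric_sym y h : V y -> ('D_h G y)^T = 'D_h G y.
Proof.
move=> Vy; have dG : derivable G y h by apply: diff_derivable; exact: metric_differentiable.
rewrite derive_mx//; apply/matrixP => i j; rewrite !mxE; apply: near_eq_derive.
apply: (near_open oV Vy) => z Vz; have [+ _] := ld_posdef L Vz.
by move=> /matrixP/(_ i j); rewrite mxE.
Qed.

Lemma derive_metric_linear y a u v : V y ->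
  'D_(a *: u + v) G y = a *: 'D_u G y + 'D_v G y.
Proof. by move=> Vy; apply: derive_linear; exact: metric_differentiable. Qed.

Lemma christoffelC y h k : V y -> christoffel G y h k = christoffel G y k h.
Proof.
move=> Vy; apply: (@koszul_vectorC (G y) (fun h => 'D_h G y)); first exact: ld_posdef L _ Vy.
  by move=> a u v; exact: derive_metric_linear.
by move=> l; exact: derive_metric_sym.
Qed.

Lemma christoffel_linear y h a k k' : V y ->
  christoffel G y h (a *: k + k') = a *: christoffel G y h k + christoffel G y h k'.
Proof.
move=> Vy; apply: (@koszul_vector_linear (G y) (fun h => 'D_h G y)); first exact: ld_posdef L _ Vy.
by move=> b u v; exact: derive_metric_linear.
Qed.

Lemma metric_compatible y u h k : V y ->
  ip ('D_u G y) h k = ip (G y) (christoffel G y u h) k + ip (G y) h (christoffel G y u k).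
Proof.
move=> Vy; apply: (@koszul_vector_compatible (G y) (fun h => 'D_h G y)); first exact: ld_posdef L _ Vy.
  by move=> b v v'; exact: derive_metric_linear.
by move=> l; exact: derive_metric_sym.
Qed.

Lemma map_differentiable x : U x -> differentiable f x.
Proof. by move=> Ux; apply: Ck_differentiable oU (ld_map L 1) Ux. Qed.

Lemma gram_posdef x : U x -> posdef (induced_gram f G x).
Proof. by move=> Ux; apply: posdef_mul; [exact: ld_immersion L _ Ux|exact: ld_posdef L _ (UV Ux)]. Qed.

Lemma smooth_gram : smooth_on U (induced_gram f G).
Proof.
move=> k; have CJ : Ck k U (jacobian f) by apply: Ck_jacobian => //; exact: ld_map L k.+1.
apply: Ck_mulmx => //; last exact: Ck_trmx.
by apply: Ck_mulmx => //; apply: (Ck_compmx oU oV UV (ld_map L k) (ld_metric L k)).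
Qed.

Lemma Ck_derive_along k (W : 'rV[R]_d -> 'M[R]_d) (P : 'rV[R]_m.+1 -> 'rV[R]_d) :
  smooth_on V W -> Ck k U P -> Ck k U (fun x => 'D_(P x) W (f x)).
Proof.
move=> SW CP; apply: (@Ck_ext _ _ _ _ _ (fun x => \sum_a P x 0 a *: 'D_(e_ a) W (f x))) => // [x Ux|].
  by rewrite -derive_sum_partials//; apply: Ck_differentiable oV (SW 1) (UV Ux).
apply: Ck_summx => // a _; apply: Ck_scalemx => //; first exact: Ck_entry.
apply: (Ck_compmx (g := 'D_(e_ a) W) oU oV UV (ld_map L k)).
exact: Ck_derive (SW k.+1).
Qed.

Lemma Ck_christoffel k (P Q : 'rV[R]_m.+1 -> 'rV[R]_d) :
  Ck k U P -> Ck k U Q -> Ck k U (fun x => christoffel G (f x) (P x) (Q x)).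
Proof.
move=> CP CQ; have CG : Ck k U (G \o f) := Ck_compmx oU oV UV (ld_map L k) (ld_metric L k).
apply: Ck_scalemx => //; first exact: Ck_cst.
apply: Ck_mulmx => //; last first.
  by apply: (Ck_invmx (A := G \o f)) => // x Ux; apply: posdef_unit; exact: ld_posdef L _ (UV Ux).
apply/Ck_mxP => // i j.
pose T x : R^o := ip ('D_(P x) G (f x)) (Q x) (e_ j) + ip ('D_(Q x) G (f x)) (P x) (e_ j)
  + (-1) * ip ('D_(e_ j) G (f x)) (P x) (Q x).
apply: (@Ck_ext _ _ _ _ _ T) => // [x Ux|]; first by rewrite mxE /T mulN1r.
have Ce : Ck k U (fun _ => e_ j : 'rV[R]_d) by exact: Ck_cst.
apply: CkD => //; first apply: CkD => //.
- by apply: Ck_ip => //; apply: Ck_derive_along => //; exact: ld_metric L.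
- by apply: Ck_ip => //; apply: Ck_derive_along => //; exact: ld_metric L.
apply: CkM => //; first exact: Ck_cst.
by apply: Ck_ip => //; apply: (Ck_derive_along (P := fun=> e_ j)) => //; exact: ld_metric L.
Qed.

Lemma Ck_normal_part k (P : 'rV[R]_m.+1 -> 'rV[R]_d) :
  Ck k U P -> Ck k U (fun x => normal_part f G x (P x)).
Proof.
move=> CP; have CG : Ck k U (G \o f) := Ck_compmx oU oV UV (ld_map L k) (ld_metric L k).
have CJ : Ck k U (jacobian f) by apply: Ck_jacobian => //; exact: ld_map L k.+1.
apply: Ck_addmx => //; apply: Ck_oppmx => //; apply: Ck_mulmx => //.
apply: Ck_mulmx => //; last first.
  by apply: Ck_invmx => // [x Ux|]; [exact: posdef_unit (gram_posdef Ux)|exact: smooth_gram].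
by apply: Ck_mulmx => //; [exact: Ck_mulmx|exact: Ck_trmx].
Qed.

Lemma smooth_mean_curvature : smooth_on U (mean_curvature f G).
Proof.
move=> k; have CJ n : Ck n U (jacobian f) by apply: Ck_jacobian => //; exact: ld_map L n.+1.
apply: Ck_scalemx => //; first exact: Ck_cst.
apply: Ck_summx => // i _; apply: Ck_summx => // j _; apply: Ck_scalemx => //.
  apply: Ck_entry => //; apply: Ck_invmx => // [x Ux|]; first exact: posdef_unit (gram_posdef Ux).
  exact: smooth_gram.
apply: Ck_normal_part; apply: Ck_addmx => //.
  apply: Ck_derive; apply: Ck_mulmx => //; exact: Ck_cst.
by apply: Ck_christoffel; apply: Ck_mulmx => //; exact: Ck_cst.
Qed.

(** The derivative of [G] along [f] supplies exactly the two Christoffel terms, by metric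
    compatibility. *)
Lemma is_derive_ip x u (P Q : 'rV[R]_m.+1 -> 'rV[R]_d) : U x -> derivable P x u -> derivable Q x u ->
  is_derive x u (fun z => ip (G (f z)) (P z) (Q z) : R^o)
    (ip (G (f x)) (covderiv f G x u P) (Q x) + ip (G (f x)) (P x) (covderiv f G x u Q)).
Proof.
move=> Ux dP dQ; have df := map_differentiable Ux.
have dG : is_derive x u (G \o f) ('D_(u *m 'J f x) G (f x)).
  rewrite -deriveEjacobian//; apply: is_derive_chain; first exact: diff_derivable.
  by apply: metric_differentiable; exact: UV.
have [dG' EG] := dG.
have [dPG EPG] := is_derive_mulmx dP dG'.
have [dQt EQt] := is_derive_trmx dQ.
have [dT ET] := is_derive_mulmx dPG dQt.
apply: DeriveDef; first by move/derivable_mxP : dT; exact.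
have -> : 'D_u (fun z => ip (G (f z)) (P z) (Q z) : R^o) x =
    ('D_u (fun z => P z *m (G \o f) z *m (Q z)^T) x) 0 0 by rewrite derive_mx// mxE.
rewrite ET EPG EQt EG /covderiv.
have := metric_compatible (u *m 'J f x) (P x) (Q x) (UV Ux).
move: ('D_u P x) ('D_u Q x) ('D_(u *m 'J f x) G (f x)) (christoffel _ _ _) => DP DQ DG Ga.
rewrite mxE mulmxDl mxE -[(_ *m _ *m _) 0 0]/(ip _ _ _) -[X in _ + X + _]/(ip _ _ _) -[X in _ + X = _]/(ip _ _ _) => ->.
by rewrite !ipDl !ipDr /comp/=; ring.
Qed.

Lemma normal_part_linear x a P Q : normal_part f G x (a *: P + Q) = a *: normal_part f G x P + normal_part f G x Q.
Proof. by rewrite /normal_part !mulmxDl -!scalemxAl scalerBr opprD addrACA. Qed.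

Lemma normal_part_tangent x (u : 'rV[R]_m.+1) : U x -> normal_part f G x (u *m 'J f x) = 0.
Proof.
move=> Ux; have gu := posdef_unit (gram_posdef Ux).
rewrite /normal_part.
have -> : u *m 'J f x *m G (f x) *m ('J f x)^T = u *m induced_gram f G x by rewrite /induced_gram !mulmxA.
by rewrite -!(mulmxA u) mulmxV// mul1mx subrr.
Qed.

Lemma normal_part_normal x P : U x -> normal_part f G x P *m G (f x) *m ('J f x)^T = 0.
Proof.
move=> Ux; have gu := posdef_unit (gram_posdef Ux).
rewrite /normal_part !mulmxBl -[X in _ - X]mulmxA -[X in _ - X]mulmxA [_ *m (G _ *m _)]mulmxA.
by rewrite -/(induced_gram f G x) mulmxKV// subrr.
Qed.

Lemma normal_is_normal x P : P *m G (f x) *m ('J f x)^T = 0 -> is_normal f G x P.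
Proof. by move=> H u; rewrite /ip trmx_mul mulmxA H mul0mx mxE. Qed.

Lemma mean_curvature_normal x : U x -> mean_curvature f G x *m G (f x) *m ('J f x)^T = 0.
Proof.
move=> Ux; rewrite /mean_curvature -!scalemxAl !mulmx_suml big1 ?scaler0// => i _.
by rewrite !mulmx_suml big1// => j _; rewrite -!scalemxAl normal_part_normal ?scaler0.
Qed.

Lemma derive_form_mul y h (P : 'M[R]_m.+1) A : V y ->
  'D_h (fun z => w z (P *m A) : R^o) y = \det P * 'D_h (fun z => w z A : R^o) y.
Proof.
move=> Vy; have dw : derivable (fun z => w z A : R^o) y h.
  by apply: diff_derivable; exact: Ck_differentiable1 oV (ld_form L A 1) Vy.
rewrite -[RHS](deriveZ (\det P) dw); apply: near_eq_derive.
apply: (near_open oV Vy) => z Vz.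
by rewrite alternating_mul//; [exact: ld_multilinear L _ Vz|exact: ld_alternating L _ Vz].
Qed.

Lemma christoffel_sum y h p n (P : 'M[R]_(p, n)) (A : 'M[R]_(n, d)) : V y ->
  \matrix_i christoffel G y h (row i (P *m A)) = P *m \matrix_i christoffel G y h (row i A).
Proof.
move=> Vy; have c0 : christoffel G y h 0 = 0.
  have := christoffel_linear h 1 0 0 Vy; rewrite scaler0 addr0 scale1r => H.
  by apply: (addrI (christoffel G y h 0)); rewrite addr0 -H.
apply/row_matrixP => i; rewrite rowK row_mul mulmx_sum_row row_mul mulmx_sum_row.
elim/big_rec2 : _ => [//|j a b _ <-].
by rewrite christoffel_linear// rowK.
Qed.

Lemma covderiv_formE y h A :
  covderiv_form G w y h A = 'D_h (fun z => w z A : R^o) y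
    - polarize (w y) A (\matrix_i christoffel G y h (row i A)).
Proof.
rewrite /covderiv_form /polarize; congr (_ - _); apply: eq_bigr => i _; congr w.
by apply/row_matrixP => j; rewrite !rowK; case: eqP => // ->.
Qed.

(** Both the derivative of the components and the Christoffel correction scale by det P, so the
    value on a frame is the determinant of the frame times the value on the coordinate basis. *)
Lemma covderiv_form_mul y h (P : 'M[R]_m.+1) A : V y ->
  covderiv_form G w y h (P *m A) = \det P * covderiv_form G w y h A.
Proof.
move=> Vy; rewrite !covderiv_formE derive_form_mul// christoffel_sum//.
rewrite polarize_mulmx ?mulrBr//; [exact: ld_multilinear L _ Vy|exact: ld_alternating L _ Vy].
Qed.

Lemma direct_frameP x : U x ->
  direct_frame f G x *m induced_gram f G x *m (direct_frame f G x)^T = 1%:M /\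
  0 < \det (direct_frame f G x).
Proof.
move=> Ux; have [X HX] := orthonormal_frame (gram_posdef Ux).
exact: (@xgetPex _ 0 [set X : 'M[R]_m.+1 |
    X *m induced_gram f G x *m X^T = 1%:M /\ 0 < \det X] (ex_intro _ X HX)).
Qed.

(** The sign (-1)^i of the star operator is the sign of moving [P] from the first place into row
    [i]. *)
Lemma form_starE x (P : 'rV[R]_d) v : U x ->
  form_star f G w x P v = \sum_i ip (induced_gram f G x) v (row i (direct_frame f G x)) *
     w (f x) (set_row i P (direct_frame f G x *m 'J f x)).
Proof.
move=> Ux; rewrite /form_star; apply: eq_bigr => i _; congr (_ * _).
rewrite set_row_colE; [|exact: ld_multilinear L _ (UV Ux)|exact: ld_alternating L _ (UV Ux)].
have -> : row' i (direct_frame f G x *m 'J f x) = row' i (direct_frame f G x) *m 'J f x; last by [].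
by apply/row_matrixP => j; rewrite row_mul !row_row' row_mul.
Qed.

(** [Phi] is chosen by [xget], so a solution must be produced: represent the functional by a vector
    [W] through the inverse metric, then project it to the normal space, which leaves products with
    normal vectors unchanged. *)
Lemma PhiP x v P : U x -> is_normal f G x P ->
  ip (G (f x)) (Phi f G w x v) P = form_star f G w x P v.
Proof.
move=> Ux nP.
have Gp := ld_posdef L (UV Ux); have wl := ld_multilinear L (UV Ux).
suff : [set W | is_normal f G x W /\
    forall Q, is_normal f G x Q -> ip (G (f x)) W Q = form_star f G w x Q v] (Phi f G w x v).
  by move=> [_]; exact.
apply: xgetPex.
pose l Q := form_star f G w x Q v.
have ll a Q Q' : l (a *: Q + Q') = a * l Q + l Q'.
  rewrite /l !form_starE// mulr_sumr -big_split; apply: eq_bigr => i _ /=.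
  by rewrite wl; ring.
pose W := (\row_e l (e_ e)) *m invmx (G (f x)).
exists (normal_part f G x W); split; first by apply: normal_is_normal; exact: normal_part_normal.
move=> Q nQ; rewrite -/(l Q) /normal_part ipBl [X in _ - X]ipC; last by case: Gp.
by rewrite nQ subr0 /ip /W mulmxKV ?posdef_unit// mxE_lin.
Qed.

Lemma covderiv_rows x (P : 'rV[R]_m.+1 -> 'rV[R]_d) : U x -> differentiable P x ->
  \matrix_i covderiv f G x (e_ i) P =
    'J P x + \matrix_i christoffel G (f x) (P x) (row i ('J f x)).
Proof.
move=> Ux dP; apply/row_matrixP => i.
transitivity ('D_(e_ i) P x + christoffel G (f x) (e_ i *m 'J f x) (P x)); first exact: rowK.
rewrite -(row_jacobian i dP) christoffelC; last exact: UV.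
by rewrite linearD/= [X in _ = _ + X]rowK -rowE.
Qed.

Lemma covderivE x u (P : 'rV[R]_m.+1 -> 'rV[R]_d) : U x -> differentiable P x ->
  covderiv f G x u P = u *m \matrix_i covderiv f G x (e_ i) P.
Proof.
move=> Ux dP; rewrite covderiv_rows//.
rewrite mulmxDr /covderiv deriveEjacobian//; congr (_ + _).
rewrite -(christoffel_sum (P x) u ('J f x) (UV Ux)) christoffelC; last exact: UV.
by apply/rowP => z; rewrite [RHS]mxE row_id.
Qed.

(* For closed w, the coefficient of d(P _| w) pulled back along f. *)
Definition exterior_density (P : 'rV[R]_m.+1 -> 'rV[R]_d) x : R :=
  'D_(P x) (fun z => w z ('J f x) : R^o) (f x) + polarize (w (f x)) ('J f x) ('J P x).

(** By symmetry of the Christoffel term, the correction in the covariant derivative of the form is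
    the opposite of the one in the rows nabla_i P. Hence d(P _| w) may be computed with ordinary or
    with covariant derivatives. *)
Lemma exterior_densityE x (P : 'rV[R]_m.+1 -> 'rV[R]_d) : U x -> differentiable P x ->
  exterior_density P x = covderiv_form G w (f x) (P x) ('J f x)
    + polarize (w (f x)) ('J f x) (\matrix_i covderiv f G x (e_ i) P).
Proof.
move=> Ux dP; have wl := ld_multilinear L (UV Ux).
rewrite covderiv_formE covderiv_rows//.
by rewrite polarizeD// addrA addrAC addrNK.
Qed.

Lemma mean_curvature_differentiable x : U x -> differentiable (mean_curvature f G) x.
Proof. by move=> Ux; exact: Ck_differentiable oU (smooth_mean_curvature 1) Ux. Qed.

(** Weingarten's equation: the product of H with the j-th coordinate field is 0, and is
    differentiated. A product with the normal vector H sees only the normal part of the second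
    derivative. *)
Lemma covderiv_mean_curvature x i j : U x ->
  ip (G (f x)) (covderiv f G x (e_ i) (mean_curvature f G)) (row j ('J f x)) =
  - ip (G (f x)) (mean_curvature f G x) (second_fundamental f G x (e_ i) (e_ j)).
Proof.
move=> Ux; pose Q (z : 'rV[R]_m.+1) := (e_ j : 'rV[R]_m.+1) *m 'J f z.
have dQ : derivable Q x (e_ i).
  apply: diff_derivable; apply: (Ck_differentiable (k := 0) oU _ Ux).
  by apply: Ck_mulmx => //; [exact: Ck_cst|apply: Ck_jacobian => //; exact: ld_map L 2].
have dH : derivable (mean_curvature f G) x (e_ i).
  by apply: diff_derivable; exact: mean_curvature_differentiable.
have [_ D] := is_derive_ip Ux dH dQ.
have : 'D_(e_ i) (fun z => ip (G (f z)) (mean_curvature f G z) (Q z) : R^o) x = 0.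
  rewrite (near_eq_derive (g := fun=> 0 : R^o)); first exact: derive_cst.
  apply: (near_open oU Ux) => z Uz; apply: normal_is_normal.
  exact: mean_curvature_normal.
move=> E; have {D}E := etrans (esym D) E.
have -> : row j ('J f x) = Q x by rewrite rowE.
apply: (addr0_opp E).
have [Gs _] := ld_posdef L (UV Ux).
rewrite [LHS]ipC// [RHS]ipC// /second_fundamental /normal_part ipBl.
by rewrite [X in _ - X]ipC// (normal_is_normal (mean_curvature_normal Ux)) subr0.
Qed.

Lemma divergence_formula x : U x ->
  exterior_density (mean_curvature f G) x * \det (direct_frame f G x) =
  - (m.+1)%:R * form_on_frame f G w x * ip (G (f x)) (mean_curvature f G x) (mean_curvature f G x)
  + hs_nablaH_Phi f G w x + nablaH_form f G w x.
Proof.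
move=> Ux; have dH := mean_curvature_differentiable Ux.
have wl := ld_multilinear L (UV Ux); have wa := ld_alternating L (UV Ux).
have [XX dX] := direct_frameP Ux; have Gp := ld_posdef L (UV Ux); have [Gs _] := Gp.
have gp := gram_posdef Ux; have gu := posdef_unit gp.
rewrite exterior_densityE// mulrDl addrC; congr (_ + _); last first.
  by rewrite /nablaH_form covderiv_form_mul; [rewrite mulrC|exact: UV].
set H := mean_curvature f G; set A := 'J f x; set X := direct_frame f G x in XX dX *.
pose C := \matrix_i covderiv f G x (e_ i) H.
pose N := \matrix_i normal_part f G x (row i C).
(* Row [i] of [T] holds the coordinates, in the basis [A], of the tangential part of nabla_i H; its
   trace produces the term in |H|^2. *)
pose T := C *m G (f x) *m A^T *m invmx (induced_gram f G x).
have CE : C = N + T *m A.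
  apply/row_matrixP => i; rewrite linearD/= [row i N]rowK /normal_part.
  by rewrite /T !row_mul subrK.
have trT : \tr T = - (m.+1)%:R * ip (G (f x)) (H x) (H x).
  have -> : \tr T = - \sum_i \sum_j invmx (induced_gram f G x) i j *
      ip (G (f x)) (H x) (second_fundamental f G x (e_ i) (e_ j)).
    rewrite /mxtrace -sumrN; apply: eq_bigr => i _; rewrite /T mxE -sumrN.
    apply: eq_bigr => j _; rewrite -ip_row rowK covderiv_mean_curvature// mulNr mulrC.
    congr (- (_ * _)); have [gs _] := gp.
    by rewrite -[in LHS]gs -trmx_inv mxE.
  rewrite mulNr; congr (- _).
  have HE : (m.+1)%:R *: H x = \sum_i \sum_j invmx (induced_gram f G x) i j *:
      second_fundamental f G x (e_ i) (e_ j).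
    by rewrite /H /mean_curvature scalerA divff ?pnatr_eq0// scale1r.
  rewrite -ipZr HE [RHS]ipC// ip_suml; apply: eq_bigr => i _.
  by rewrite ip_suml; apply: eq_bigr => j _; rewrite [RHS]ipZl; congr (_ * _); exact: ipC.
rewrite -/C CE polarizeD// polarize_mul// trT mulrDl addrC; congr (_ + _).
  rewrite /form_on_frame alternating_mul// -/A -/X; ring.
(* The determinant is absorbed into both arguments, which turns coordinate directions into frame
   directions. *)
rewrite mulrC -polarize_mulmx// /hs_nablaH_Phi /polarize.
apply: eq_bigr => i _.
have NE : row i (X *m N) = normal_connection f G x (row i X) H.
  rewrite /normal_connection covderivE// -/C row_mul.
  rewrite mulmx_sum_row [row i X *m C]mulmx_sum_row.
  have n0 : normal_part f G x 0 = 0 by rewrite /normal_part !mul0mx subr0.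
  elim/big_rec2 : _ => [//|j a b _ ->]; rewrite normal_part_linear rowK//.
rewrite NE [RHS]ipC//.
have nN : is_normal f G x (normal_connection f G x (row i X) H).
  by apply: normal_is_normal; exact: normal_part_normal.
(* On an orthonormal frame, [form_star] at the i-th vector has a single nonzero term. *)
rewrite PhiP// form_starE// (bigD1 i)//= big1 ?addr0 => [|k ki]; rewrite ip_row XX mxE.
  by rewrite eqxx mul1r.
by rewrite eq_sym (negbTE ki) mul0r.
Qed.

Lemma jacobian_derivable x v : U x -> derivable (jacobian f) x v.
Proof.
move=> Ux; apply: diff_derivable; apply: (Ck_differentiable (k := 0) oU _ Ux).
by apply: Ck_jacobian => //; exact: ld_map L 2.
Qed.

(** Differentiating the components of the form gives, by closedness, their derivative along P;
    differentiating the replaced row gives the rows of the Jacobian of P; differentiating any other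
    row gives second derivatives of [f], which cancel in pairs. *)
Lemma exterior_density_div x (P : 'rV[R]_m.+1 -> 'rV[R]_d) : U x ->
  (\forall z \near x, differentiable P z) ->
  (forall j, derivable (fun z => w (f z) (set_row j (P z) ('J f z)) : R^o) x (e_ j)) /\
  exterior_density P x = \sum_j 'D_(e_ j) (fun z => w (f z) (set_row j (P z) ('J f z)) : R^o) x.
Proof.
move=> Ux /nbhs_singleton dP; set A := 'J f x.
have wl := ld_multilinear L (UV Ux); have wa := ld_alternating L (UV Ux).
have dw B : differentiable (fun y => w y B : R^o) (f x).
  exact: Ck_differentiable1 oV (ld_form L B 1) (UV Ux).
have dfx v : derivable f x v by apply: diff_derivable; exact: map_differentiable.
have chain B j : is_derive x (e_ j) (fun z => w (f z) B : R^o) ('D_(row j A) (fun y => w y B : R^o) (f x)).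
  have := is_derive_chain (dfx (e_ j)) (dw B).
  by rewrite (row_jacobian j (map_differentiable Ux)).
have dPj j : derivable P x (e_ j) by exact: diff_derivable.
have dS j := is_derive_set_row j (dPj j) (jacobian_derivable Ux).
have D j : is_derive x (e_ j) (fun z => w (f z) (set_row j (P z) ('J f z)) : R^o)
   ('D_(row j A) (fun y => w y (set_row j (P x) A) : R^o) (f x) +
    polarize (w (f x)) (set_row j (P x) A) (set_row j ('D_(e_ j) P x) ('D_(e_ j) (jacobian f) x))).
  have [dSj ESj] := dS j.
  have wn : \forall z \near x, multilinear (w (f z)).
    by apply: (near_open oU Ux) => z Uz; exact: ld_multilinear L _ (UV Uz).
  have db B : derivable (fun z => w (f z) B : R^o) x (e_ j) by have [] := chain B j.
  have := is_derive_multilinear wn db dSj; rewrite ESj.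
  by have [_ ->] := chain (set_row j (P x) A) j.
split; first by move=> j; have [] := D j.
under eq_bigr do rewrite (@derive_val _ _ _ _ _ _ _ (D _)).
rewrite big_split /exterior_density -/A /=; congr (_ + _).
  (* Closedness is evaluated on P followed by the coordinate fields: its first term is the
     derivative along P, the others are those of the divergence up to sign. *)
  have := ld_closed L (UV Ux) (col_mx (P x) A : 'M[R]_(m.+2, d)).
  rewrite big_ord_recl expr0 mul1r row_col0.
  have -> : row' ord0 (col_mx (P x) A : 'M[R]_(m.+2, d)) = A.
    by apply/row_matrixP => i; rewrite row_row' row_colS.
  move=> /eqP; rewrite addr_eq0 => /eqP ->; rewrite -sumrN; apply: eq_bigr => j _.
  rewrite row_colS; have -> : (row' (lift ord0 j) (col_mx (P x) A : 'M[R]_(m.+2, d)) : 'M[R]_(m.+1, d)) =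
      (col_mx (P x) (row' j A) : 'M[R]_(m.+1, d)).
    exact: row'_col.
  have E : 'D_(row j A) (fun y => w y (set_row j (P x) A) : R^o) (f x) =
     (-1) ^+ j *: 'D_(row j A) (fun y => w y (col_mx (P x) (row' j A) : 'M[R]_(m.+1, d)) : R^o) (f x).
    have dd : derivable (fun y => w y (col_mx (P x) (row' j A) : 'M[R]_(m.+1, d)) : R^o) (f x) (row j A).
      by apply: diff_derivable; exact: dw.
    rewrite -(deriveZ ((-1) ^+ j) dd); apply: near_eq_derive.
    apply: (near_open oV (UV Ux)) => y Vy.
    by rewrite set_row_colE//; [exact: ld_multilinear L _ Vy|exact: ld_alternating L _ Vy].
  by rewrite E /bump/= exprS mulN1r mulNr opprK.
(* The second derivative [h] is symmetric while exchanging two rows changes the sign of the form, so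
   [t] is antisymmetric and its double sum is its own opposite. *)
pose h i j := row i ('D_(e_ j) (jacobian f) x).
have hC i j : h i j = h j i by exact: (derive_jacobianC i j oU (ld_map L 2) Ux).
pose t i j := if i == j then 0 else w (f x) (set_row i (h i j) (set_row j (P x) A)).
have tN i j : t i j = - t j i.
  rewrite /t; case: eqVneq => [_|ij]; first by rewrite oppr0.
  by rewrite (hC i j) alternating_swap// (set_rowC _ _ _ ij).
have S0 : \sum_j \sum_i t i j = 0.
  have : \sum_j \sum_i t i j = - \sum_j \sum_i t i j.
    rewrite [in LHS]exchange_big/= -sumrN; apply: eq_bigr => i _.
    by rewrite -sumrN; apply: eq_bigr => j _.
  by move: (\sum_j _) => s H; lra.
transitivity (polarize (w (f x)) A ('J P x) + \sum_j \sum_i t i j); first by rewrite S0 addr0.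
rewrite {1}/polarize -big_split; apply: eq_bigr => j _ /=.
rewrite [RHS]/polarize (bigD1 j)//= [in RHS](bigD1 j)//= {1}/t eqxx add0r.
rewrite set_rowK row_set_row eqxx; congr (_ + _).
  by rewrite row_jacobian.
by apply: eq_bigr => i ij; rewrite /t (negbTE ij) row_set_row (negbTE ij).
Qed.

End Data.
End LocalGeometryTheory.

(** * Invariance under changes of coordinates *)

(** [s] and [t] are the transitions of the source and of the target. Changing both at once includes
    changing the target alone, which is how [gram] is freed from its moving target chart. *)
Record chart_change (R : realType) (m d : nat) (W U' : set 'rV[R]_m.+1) (T V' : set 'rV[R]_d)
    (s : 'rV[R]_m.+1 -> 'rV[R]_m.+1) (t : 'rV[R]_d -> 'rV[R]_d)
    (f : 'rV[R]_m.+1 -> 'rV[R]_d) (G : 'rV[R]_d -> 'M[R]_d)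
    (w : 'rV[R]_d -> 'M[R]_(m.+1, d) -> R)
    (f' : 'rV[R]_m.+1 -> 'rV[R]_d) (G' : 'rV[R]_d -> 'M[R]_d)
    (w' : 'rV[R]_d -> 'M[R]_(m.+1, d) -> R) : Prop := ChartChange {
  cc_data : local_data W T f G w;
  cc_data' : local_data U' V' f' G' w';
  cc_source : smooth_on W s;
  cc_target : smooth_on T t;
  cc_source_maps : forall x, W x -> U' (s x);
  cc_target_maps : forall y, T y -> V' (t y);
  cc_map : forall x, W x -> f' (s x) = t (f x);
  cc_metric : forall y, T y -> G y = 'J t y *m G' (t y) *m ('J t y)^T;
  cc_form : forall y, T y -> forall A, w y A = w' (t y) (A *m 'J t y) }.

Section ChartChange.
Context {R : realType} {m d : nat}.

Notation e_ i := (delta_mx 0 i).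

Lemma row_mul_inj p q (A B : 'M[R]_(p, q)) : (forall v : 'rV[R]_p, v *m A = v *m B) -> A = B.
Proof. by move=> H; apply/row_matrixP => i; rewrite !rowE. Qed.

Lemma polarize_mulr k p q (w : 'M[R]_(k, q) -> R) (A B : 'M[R]_(k, p)) (K : 'M[R]_(p, q)) :
  polarize (fun C => w (C *m K)) A B = polarize w (A *m K) (B *m K).
Proof. by apply: eq_bigr => i _; rewrite set_row_mul row_mul. Qed.

Lemma is_derive_lmulmx (V : normedModType R) p q r (c : 'M[R]_(p, q)) (A : V -> 'M[R]_(q, r)) x v :
  derivable A x v -> is_derive x v (fun z => c *m A z) (c *m 'D_v A x).
Proof.
move=> dA; have := is_derive_mulmx (derivable_cst c x v) dA.
by rewrite derive_cst mul0mx add0r.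
Qed.

Lemma trace_change p (h h' S : 'M[R]_p) (B B' : 'I_p -> 'I_p -> 'rV[R]_d) (K : 'M[R]_d) :
  S^T *m h *m S = h' ->
  (forall i j, B i j *m K = \sum_k \sum_l (S i k * S j l) *: B' k l) ->
  (\sum_i \sum_j h i j *: B i j) *m K = \sum_k \sum_l h' k l *: B' k l.
Proof.
move=> <- BE; rewrite mulmx_suml.
under eq_bigr => i _ do rewrite mulmx_suml.
under eq_bigr => i _ do under eq_bigr => j _ do rewrite -scalemxAl BE scaler_sumr.
under eq_bigr do rewrite exchange_big.
rewrite exchange_big/=; apply: eq_bigr => k _.
under eq_bigr do under eq_bigr do rewrite scaler_sumr.
under eq_bigr do rewrite exchange_big.
rewrite exchange_big/=; apply: eq_bigr => l _.
under eq_bigr do under eq_bigr do rewrite scalerA.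
under eq_bigr do rewrite -scaler_suml.
rewrite -scaler_suml; congr (_ *: _).
rewrite mxE exchange_big /=; apply: eq_bigr => j _; rewrite mxE mulr_suml.
by apply: eq_bigr => i _; rewrite !mxE; ring.
Qed.

(** [D1] and [D2] are the derivatives of the two sides of the chain rule for Jacobians; the equation
    is solved for the second derivatives of [f]. *)
Lemma product_rule_change p q r (v : 'rV[R]_p) (D1 D2 : 'M[R]_(p, r)) (Df : 'M[R]_(p, q))
    (K DK : 'M[R]_(q, r)) (Ds S : 'M[R]_p) (A' DA Y : 'M[R]_(p, r)) (A : 'M[R]_(p, q)) (Q : 'M[R]_(q, r)) :
  D1 = Df *m K + A *m Q -> D2 = Ds *m A' + S *m Y -> D1 = D2 -> Q = DK -> Y = DA ->
  v *m Df *m K = v *m Ds *m A' + v *m S *m DA - v *m A *m DK.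
Proof.
move=> E1 E2 E E3 E4; have {E} : Df *m K + A *m DK = Ds *m A' + S *m DA.
  by rewrite -E3 -E4 -E1 -E2.
by move=> /(congr1 (fun M => v *m M)); rewrite !mulmxDr !mulmxA => <-; rewrite addrK.
Qed.

Lemma polarize_change k p (w : 'M[R]_(k, p) -> R) (S : 'M[R]_k) (B A' B' X Y : 'M[R]_(k, p)) :
  multilinear w -> alternating w -> B = S *m A' -> S *m B' = X + Y ->
  polarize w B X + polarize w B Y = \det S * polarize w A' B'.
Proof. by move=> wl wa -> E; rewrite -polarize_mulmx// E polarizeD. Qed.

Lemma addr_congr (a b c : R) : b = c -> a + b = a + c.
Proof. by move=> ->. Qed.

Lemma row_combination k p q r (S : 'M[R]_k) (B : 'M[R]_(k, r)) (P : 'M[R]_(k, p)) (K : 'M[R]_(p, r))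
    (A : 'M[R]_(k, q)) (Q : 'M[R]_(q, r)) :
  (forall v : 'rV[R]_k, v *m S *m B = v *m P *m K + v *m A *m Q) -> S *m B = A *m Q + P *m K.
Proof. by move=> H; apply: row_mul_inj => v; rewrite mulmxDr !mulmxA H addrC. Qed.

Lemma scaler_addACA p (c : R) (a b a' b' : 'rV[R]_p) :
  c *: a + a' + (c *: b + b') = c *: (a + b) + (a' + b').
Proof. by rewrite scalerDr addrACA. Qed.

Section GramChange.
Variables (A A' : 'M[R]_(m.+1, d)) (K g' : 'M[R]_d) (S : 'M[R]_m.+1).
Hypothesis AK : A *m K = S *m A'.

Lemma mx_gram_change :
  A *m (K *m g' *m K^T) *m A^T = S *m (A' *m g' *m A'^T) *m S^T.
Proof.
rewrite !mulmxA AK -(mulmxA _ K^T) -trmx_mul AK trmx_mul.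
by rewrite !mulmxA.
Qed.

Lemma mx_inverse_gram_change (g : 'M[R]_m.+1) (h : 'M[R]_m.+1) : g \in unitmx -> h \in unitmx -> S \in unitmx ->
  g = S *m h *m S^T -> S^T *m invmx g *m S = invmx h.
Proof.
move=> gu hu Su gE; have E : S^T *m invmx g *m S *m h = 1%:M.
  have Stu : S^T \in unitmx by rewrite unitmx_tr.
  rewrite -(mulmxK Stu (_ *m h)) -!mulmxA (mulmxA h) (mulmxA S) (mulmxA S) -gE (mulmxA _ g).
  by rewrite mulVmx// mul1mx mulmxV.
by rewrite -[LHS](mulmxK hu) E mul1mx.
Qed.

Lemma mx_normal_change (P : 'rV[R]_d) (g : 'M[R]_d) (h h' : 'M[R]_m.+1) :
  S^T *m h *m S = h' -> g = K *m g' *m K^T ->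
  P *m g *m A^T *m h *m A *m K = P *m K *m g' *m A'^T *m h' *m A'.
Proof.
move=> <- ->; rewrite -(mulmxA _ A K) AK !mulmxA -(mulmxA _ K^T) -trmx_mul AK trmx_mul.
by rewrite !mulmxA.
Qed.

Lemma mulmxA_eq p (u : 'M[R]_(p, m.+1)) : u *m A *m K = u *m S *m A'.
Proof. by rewrite -!mulmxA AK. Qed.

End GramChange.

Section KoszulChange.
Variables (g g' K : 'M[R]_d) (D D' DK : 'rV[R]_d -> 'M[R]_d).
Hypothesis gP : posdef g.
Hypothesis gP' : posdef g'.
Hypothesis Dl : forall a u v, D (a *: u + v) = a *: D u + D v.
Hypothesis Dl' : forall a u v, D' (a *: u + v) = a *: D' u + D' v.
Hypothesis gE : g = K *m g' *m K^T.
Hypothesis DE : forall h, D h = DK h *m g' *m K^T + K *m D' (h *m K) *m K^T + K *m g' *m (DK h)^T.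
Hypothesis DKC : forall h k, k *m DK h = h *m DK k.

(** The transformation law of the Christoffel symbols, with its inhomogeneous term. [DE] is the
    derivative of g = K g' K^T; in the three terms of Koszul's formula the derivatives of [K] cancel
    in pairs by [DKC], except for those that make up k DK h. *)
Lemma koszul_vector_change h k :
  koszul_vector g D h k *m K = koszul_vector g' D' (h *m K) (k *m K) + k *m DK h.
Proof.
have [gs _] := gP'.
have Ku : K \in unitmx.
  have := posdef_unit gP; rewrite gE !unitmxE !det_mulmx !unitfE !mulf_eq0 !negb_or.
  by case/andP => /andP[].
have DE' a b c : ip (D a) b c = ip g' (b *m DK a) (c *m K) + ip (D' (a *m K)) (b *m K) (c *m K)
    + ip g' (b *m K) (c *m DK a).
  by rewrite DE !ip_mxD; congr (_ + _ + _); rewrite /ip trmx_mul !mulmxA.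
apply: (ip_inj gP') => l; rewrite -(mulmxKV Ku l); set l' := l *m invmx K.
rewrite -ip_mul -gE ipDl (koszul_vectorE gP Dl) (koszul_vectorE gP' Dl') /koszul !DE'.
rewrite (DKC l' h) (DKC l' k) (DKC k h).
rewrite (ipC (h *m K) (l' *m DK k) gs) (ipC (k *m K) (l' *m DK h) gs).
by field.
Qed.

End KoszulChange.

Variables (W U' : set 'rV[R]_m.+1) (T V' : set 'rV[R]_d)
    (s : 'rV[R]_m.+1 -> 'rV[R]_m.+1) (t : 'rV[R]_d -> 'rV[R]_d)
    (f : 'rV[R]_m.+1 -> 'rV[R]_d) (G : 'rV[R]_d -> 'M[R]_d)
    (w : 'rV[R]_d -> 'M[R]_(m.+1, d) -> R)
    (f' : 'rV[R]_m.+1 -> 'rV[R]_d) (G' : 'rV[R]_d -> 'M[R]_d)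
    (w' : 'rV[R]_d -> 'M[R]_(m.+1, d) -> R).
Hypothesis C : chart_change W U' T V' s t f G w f' G' w'.

Let L := cc_data C.
Let L' := cc_data' C.
Let oW := ld_openU L.
Let oT := ld_openV L.
Let WT := ld_maps L.

Lemma source_differentiable x : W x -> differentiable s x.
Proof. by move=> Wx; exact: Ck_differentiable oW (cc_source C 1) Wx. Qed.

Lemma target_differentiable y : T y -> differentiable t y.
Proof. by move=> Ty; exact: Ck_differentiable oT (cc_target C 1) Ty. Qed.

Lemma target_jacobian_differentiable y : T y -> differentiable (jacobian t) y.
Proof.
move=> Ty; apply: (Ck_differentiable (k := 0) oT _ Ty).
by apply: Ck_jacobian => //; exact: cc_target C 2.
Qed.

Lemma jacobian_change x : W x -> 'J f x *m 'J t (f x) = 'J s x *m 'J f' (s x).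
Proof.
move=> Wx; apply: row_mul_inj => v; rewrite !mulmxA.
have dfx := map_differentiable L Wx; have dsx := source_differentiable Wx.
have [_ E1] := is_derive_chain (diff_derivable (v := v) dfx) (target_differentiable (WT Wx)).
have [_ E2] := is_derive_chain (diff_derivable (v := v) dsx) (map_differentiable L' (cc_source_maps C Wx)).
have df'x := map_differentiable L' (cc_source_maps C Wx).
have dtx := target_differentiable (WT Wx).
rewrite (deriveEjacobian _ dtx) (deriveEjacobian _ dfx) in E1.
rewrite (deriveEjacobian _ df'x) (deriveEjacobian _ dsx) in E2.
rewrite -E1 -E2; apply: near_eq_derive; apply: (near_open oW Wx) => z Wz /=.
by rewrite (cc_map C Wz).
Qed.

Lemma metric_change x : W x ->
  G (f x) = 'J t (f x) *m G' (f' (s x)) *m ('J t (f x))^T.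
Proof. by move=> Wx; rewrite (cc_map C Wx); exact: cc_metric C _ (WT Wx). Qed.

Lemma gram_change x : W x ->
  induced_gram f G x = 'J s x *m induced_gram f' G' (s x) *m ('J s x)^T.
Proof.
by move=> Wx; rewrite /induced_gram (metric_change Wx); exact: mx_gram_change (jacobian_change Wx).
Qed.

Lemma source_unit x : W x -> 'J s x \in unitmx.
Proof.
move=> Wx; have := posdef_unit (gram_posdef L Wx); rewrite gram_change//.
by rewrite !unitmxE !det_mulmx !unitfE !mulf_eq0 !negb_or => /andP[/andP[]].
Qed.

Lemma inverse_gram_change x : W x ->
  ('J s x)^T *m invmx (induced_gram f G x) *m 'J s x = invmx (induced_gram f' G' (s x)).
Proof.
move=> Wx; have Su := source_unit Wx.
have gu' := posdef_unit (gram_posdef L' (cc_source_maps C Wx)).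
exact: (mx_inverse_gram_change (posdef_unit (gram_posdef L Wx)) gu' Su (gram_change Wx)).
Qed.

Lemma christoffel_change y h k : T y ->
  christoffel G y h k *m 'J t y =
  christoffel G' (t y) (h *m 'J t y) (k *m 'J t y) + k *m 'D_h (jacobian t) y.
Proof.
move=> Ty; have Vt := cc_target_maps C Ty.
have dK v : derivable (jacobian t) y v by apply: diff_derivable; exact: target_jacobian_differentiable.
have dG' v : is_derive y v (G' \o t) ('D_(v *m 'J t y) G' (t y)).
  rewrite -deriveEjacobian; last exact: target_differentiable.
  apply: is_derive_chain; first by apply: diff_derivable; exact: target_differentiable.
  have H := metric_differentiable L' Vt.
  exact: H.
apply: (@koszul_vector_change (G y) (G' (t y)) ('J t y) (fun h => 'D_h G y) (fun h => 'D_h G' (t y))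
  (fun h => 'D_h (jacobian t) y)).
- exact: ld_posdef L _ Ty.
- exact: ld_posdef L' _ Vt.
- by move=> a u v; exact: (derive_metric_linear L a u v Ty).
- by move=> a u v; exact: (derive_metric_linear L' a u v Vt).
- exact: cc_metric C _ Ty.
- move=> v; have [d1 E1] := is_derive_mulmx (dK v) (@ex_derive _ _ _ _ _ _ _ (dG' v)).
  have [d2 E2] := is_derive_trmx (dK v).
  have [d3 E3] := is_derive_mulmx d1 d2.
  have -> : 'D_v G y = 'D_v (fun z => 'J t z *m (G' \o t) z *m ('J t z)^T) y.
    apply: near_eq_derive; apply: (near_open oT Ty) => z Tz; exact: cc_metric C _ Tz.
  rewrite E3 E1 E2 (@derive_val _ _ _ _ _ _ _ (dG' v)).
  by rewrite mulmxDl.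
- by move=> a b; exact: (mul_derive_jacobianC _ _ oT (cc_target C 2) Ty).
Qed.

Lemma derive_along x u (P P' : _ -> 'rV[R]_d) : W x ->
  (\forall z \near x, P' (s z) = P z *m 'J t (f z)) ->
  differentiable P x -> differentiable P' (s x) ->
  'D_(u *m 'J s x) P' (s x) = 'D_u P x *m 'J t (f x) + P x *m 'D_(u *m 'J f x) (jacobian t) (f x).
Proof.
move=> Wx PP' dP dP'.
have dsx := source_differentiable Wx; have dfx := map_differentiable L Wx.
have [_ E1] := is_derive_chain (diff_derivable (v := u) dsx) dP'.
have [d2 E2] := is_derive_chain (diff_derivable (v := u) dfx) (target_jacobian_differentiable (WT Wx)).
have [_ E3] := is_derive_mulmx (diff_derivable (v := u) dP) d2.
rewrite -(deriveEjacobian _ dsx) -(deriveEjacobian _ dfx) -E1 -E2 -E3.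
exact: near_eq_derive.
Qed.

Lemma normal_part_change x P : W x ->
  normal_part f G x P *m 'J t (f x) = normal_part f' G' (s x) (P *m 'J t (f x)).
Proof.
move=> Wx; rewrite /normal_part mulmxBl; congr (_ - _).
exact: (mx_normal_change (jacobian_change Wx) P (inverse_gram_change Wx) (metric_change Wx)).
Qed.

(** Differentiating the chain rule for Jacobians produces two extra terms. The Hessian of [t]
    cancels the inhomogeneous part of the Christoffel law, and the Hessian of [s] yields a vector
    tangent to the submanifold, which the normal projection kills. *)
Lemma second_fundamental_change x u v : W x ->
  second_fundamental f G x u v *m 'J t (f x) =
  second_fundamental f' G' (s x) (u *m 'J s x) (v *m 'J s x).
Proof.
move=> Wx; rewrite /second_fundamental (normal_part_change _ Wx).
have dsx := source_differentiable Wx; have dfx := map_differentiable L Wx.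
have Ux := cc_source_maps C Wx.
have dJf : derivable (jacobian f) x u := jacobian_derivable L Wx.
have dJf' : differentiable (jacobian f') (s x).
  apply: (Ck_differentiable (k := 0) (ld_openU L') _ Ux).
  by apply: Ck_jacobian (ld_openU L') _; exact: ld_map L' 2.
have dJs : derivable (jacobian s) x u.
  apply: diff_derivable; apply: (Ck_differentiable (k := 0) oW _ Wx).
  by apply: Ck_jacobian => //; exact: cc_source C 2.
have [d2 E2] := is_derive_chain (diff_derivable (v := u) dfx) (target_jacobian_differentiable (WT Wx)).
have [d3 E3] := is_derive_chain (diff_derivable (v := u) dsx) dJf'.
have [_ E4] := is_derive_mulmx dJf d2.
have [_ E5] := is_derive_mulmx dJs d3.
have E6 : 'D_u (fun z => 'J f z *m ((jacobian t) \o f) z) x = 'D_u (fun z => 'J s z *m ((jacobian f') \o s) z) x.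
  by apply: near_eq_derive; apply: (near_open oW Wx) => z Wz; exact: jacobian_change.
have {}E2 := etrans E2 (congr1 (fun v => 'D_v (jacobian t) (f x)) (deriveEjacobian u dfx)).
have {}E3 := etrans E3 (congr1 (fun v => 'D_v (jacobian f') (s x)) (deriveEjacobian u dsx)).
have {}E6 := product_rule_change v E4 E5 E6 E2 E3.
have [_ F1] := is_derive_lmulmx v dJf.
have [_ F2] := is_derive_lmulmx (v *m 'J s x) (diff_derivable (v := u *m 'J s x) dJf').
have ua (a : 'rV[R]_m.+1) : a *m 'J f x *m 'J t (f x) = a *m 'J s x *m 'J f' (s x) := mulmxA_eq (jacobian_change Wx) a.
have chr : christoffel G (f x) (u *m 'J f x) (v *m 'J f x) *m 'J t (f x) =
    christoffel G' (f' (s x)) (u *m 'J s x *m 'J f' (s x)) (v *m 'J s x *m 'J f' (s x))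
    + v *m 'J f x *m 'D_(u *m 'J f x) (jacobian t) (f x).
  apply: etrans (christoffel_change _ _ (WT Wx)) _; congr (_ + _); rewrite -(cc_map C Wx).
  exact: (f_equal2 (christoffel G' (f' (s x))) (ua u) (ua v)).
have -> : covderiv f G x u (fun z => v *m 'J f z) *m 'J t (f x) =
    1 *: (v *m 'D_u (jacobian s) x *m 'J f' (s x)) +
    covderiv f' G' (s x) (u *m 'J s x) (fun z => v *m 'J s x *m 'J f' z).
  have alg (a b c e D D' Ga GK : 'rV[R]_d) (K : 'M[R]_d) : D *m K = a + b - c -> D' = b -> Ga *m K = GK + c ->
      (D + Ga) *m K = 1 *: a + (D' + GK).
    by move=> h1 h2 h3; rewrite mulmxDl h1 h2 h3 scale1r [GK + c]addrC addrA subrK addrA.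
  have F1' := etrans (congr1 (fun M => M *m 'J t (f x)) F1) E6.
  exact: (alg _ _ _ 0 _ _ _ _ _ F1' F2 chr).
by rewrite (normal_part_linear f' G') scale1r (normal_part_tangent L' _ Ux) add0r.
Qed.

(** Wanted because the transformation law evaluates the second fundamental form on rows of ['J s x]
    rather than on basis vectors. Linearity in the first slot goes through the symmetry of the
    Christoffel term. *)
Lemma second_fundamental_bilinear x u v : U' x ->
  second_fundamental f' G' x u v =
  \sum_k \sum_l (u 0 k * v 0 l) *: second_fundamental f' G' x (e_ k) (e_ l).
Proof.
move=> Ux.
have dJ : differentiable (jacobian f') x.
  apply: (Ck_differentiable (k := 0) (ld_openU L') _ Ux).
  by apply: Ck_jacobian (ld_openU L') _; exact: ld_map L' 2.
have cd (a b : 'rV[R]_m.+1) : covderiv f' G' x a (fun z => b *m 'J f' z) =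
    b *m 'D_a (jacobian f') x + christoffel G' (f' x) (a *m 'J f' x) (b *m 'J f' x).
  rewrite /covderiv; congr (_ + _).
  have [_ ->] := is_derive_mulmx (derivable_cst b x a) (diff_derivable (v := a) dJ).
  by rewrite derive_cst mul0mx add0r.
have Vx := ld_maps L' Ux.
pose Q a b := second_fundamental f' G' x a b.
have Q1 a c b b' : Q a (c *: b + b') = c *: Q a b + Q a b'.
  rewrite /Q /second_fundamental -normal_part_linear !cd; congr normal_part.
  rewrite !mulmxDl -!scalemxAl (christoffel_linear L')//.
  exact: scaler_addACA.
have Q2 a a' c b : Q (c *: a + a') b = c *: Q a b + Q a' b.
  rewrite /Q /second_fundamental -normal_part_linear !cd; congr normal_part.
  rewrite derive_linear// !mulmxDl !mulmxDr -!scalemxAl -!scalemxAr.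
  rewrite ![christoffel _ _ _ (b *m _)](christoffelC L')// (christoffel_linear L')//.
  exact: scaler_addACA.
have Q10 a : Q a 0 = 0.
  by have := Q1 a 1 0 0; rewrite scaler0 addr0 scale1r => H; apply: (addrI (Q a 0)); rewrite addr0 -H.
have Q20 a : Q 0 a = 0.
  by have := Q2 0 0 1 a; rewrite scaler0 addr0 scale1r => H; apply: (addrI (Q 0 a)); rewrite addr0 -H.
rewrite -/(Q u v) [in LHS](row_sum_delta u).
have -> : Q (\sum_j u 0 j *: e_ j) v = \sum_j u 0 j *: Q (e_ j) v.
  by elim/big_rec2 : _ => [|j y z _ <-]; [exact: Q20|exact: Q2].
apply: eq_bigr => k _; rewrite [in LHS](row_sum_delta v).
have -> : Q (e_ k) (\sum_j v 0 j *: e_ j) = \sum_j v 0 j *: Q (e_ k) (e_ j).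
  by elim/big_rec2 : _ => [|j y z _ <-]; [exact: Q10|exact: Q1].
by rewrite scaler_sumr; apply: eq_bigr => l _; rewrite scalerA.
Qed.

Lemma mean_curvature_change x : W x ->
  mean_curvature f G x *m 'J t (f x) = mean_curvature f' G' (s x).
Proof.
move=> Wx; rewrite /mean_curvature -scalemxAl; congr (_ *: _).
apply: (trace_change (inverse_gram_change Wx)) => i j.
apply: etrans (second_fundamental_change _ _ Wx) _.
apply: etrans (second_fundamental_bilinear _ _ (cc_source_maps C Wx)) _.
apply: eq_bigr => k _; apply: eq_bigr => l _; congr (_ *: _).
by rewrite -!rowE !mxE.
Qed.

Lemma derive_form_change y h A : T y ->
  'D_h (fun z => w z A : R^o) y = 'D_(h *m 'J t y) (fun z => w' z (A *m 'J t y) : R^o) (t y)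
    + polarize (w' (t y)) (A *m 'J t y) (A *m 'D_h (jacobian t) y).
Proof.
move=> Ty; have dty := target_differentiable Ty; have Vt := cc_target_maps C Ty.
have dw B : differentiable (fun z => w' z B : R^o) (t y).
  exact: Ck_differentiable1 (ld_openV L') (ld_form L' B 1) Vt.
have dwt B : is_derive y h (fun z => w' (t z) B : R^o) ('D_(h *m 'J t y) (fun z => w' z B : R^o) (t y)).
  by rewrite -(deriveEjacobian _ dty); apply: is_derive_chain (diff_derivable dty) (dw B).
have dJ : derivable (jacobian t) y h by apply: diff_derivable; exact: target_jacobian_differentiable.
have [dAJ EAJ] := is_derive_lmulmx A dJ.
have wn : \forall z \near y, multilinear (w' (t z)).
  by apply: (near_open oT Ty) => z Tz; exact: ld_multilinear L' _ (cc_target_maps C Tz).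
have db B : derivable (fun z => w' (t z) B : R^o) y h by have [] := dwt B.
have [_ E] := is_derive_multilinear wn db dAJ.
have -> : 'D_h (fun z => w z A : R^o) y = 'D_h (fun z => w' (t z) (A *m 'J t z) : R^o) y.
  by apply: near_eq_derive; apply: (near_open oT Ty) => z Tz; exact: cc_form C _ Tz _.
apply: etrans E (f_equal2 +%R _ (f_equal (polarize _ _) EAJ)).
exact: (@derive_val _ _ _ _ _ _ _ (dwt (A *m 'J t y))).
Qed.

(** The derivative of the Jacobian of [t], which appears when the form is transported, is cancelled
    by the inhomogeneous term of the Christoffel law. *)
Lemma covderiv_form_change x h : W x ->
  covderiv_form G w (f x) h ('J f x) =
  \det ('J s x) * covderiv_form G' w' (f' (s x)) (h *m 'J t (f x)) ('J f' (s x)).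
Proof.
move=> Wx; have Ux := cc_source_maps C Wx; have Tx := WT Wx.
have Vt := cc_target_maps C Tx.
rewrite -(covderiv_form_mul L' _ _ _ (ld_maps L' Ux)) !covderiv_formE -(jacobian_change Wx).
rewrite (cc_map C Wx) (derive_form_change _ _ Tx) -addrA; congr (_ + _).
set A := 'J f x; set K := 'J t (f x).
have -> : polarize (w (f x)) A (\matrix_i christoffel G (f x) h (row i A)) =
    polarize (w' (t (f x))) (A *m K) ((\matrix_i christoffel G (f x) h (row i A)) *m K).
  by rewrite -polarize_mulr; apply: eq_bigr => i _; exact: cc_form C _ Tx _.
have -> : (\matrix_i christoffel G (f x) h (row i A)) *m K =
    \matrix_i christoffel G' (t (f x)) (h *m K) (row i (A *m K)) + A *m 'D_h (jacobian t) (f x).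
  apply/row_matrixP => i; rewrite row_mul linearD/= [row i (\matrix__ _)]rowK [row i (\matrix__ _)]rowK.
  by rewrite (christoffel_change _ _ Tx) !row_mul.
by rewrite (polarizeD (ld_multilinear L' Vt)) opprD addrC addrNK.
Qed.

(** The derivative of ['J t] along P and the Jacobian of P combine into the rows of
    ['J s x *m 'J P' (s x)], by [derive_along] and the symmetry of the Hessian of [t]. *)
Lemma exterior_density_change x (P P' : _ -> 'rV[R]_d) : W x ->
  (\forall z \near x, P' (s z) = P z *m 'J t (f z)) ->
  differentiable P x -> differentiable P' (s x) ->
  exterior_density f w P x = \det ('J s x) * exterior_density f' w' P' (s x).
Proof.
move=> Wx PP' dP dP'; have Ux := cc_source_maps C Wx; have Tx := WT Wx.
have Vt := cc_target_maps C Tx; have wl := ld_multilinear L' Vt; have wa := ld_alternating L' Vt.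
rewrite /exterior_density (derive_form_change _ _ Tx) mulrDr -addrA.
rewrite -(derive_form_mul L' _ _ _ (ld_maps L' Ux)) -(jacobian_change Wx) -(nbhs_singleton PP') (cc_map C Wx).
apply: addr_congr.
have X1 : polarize (w (f x)) ('J f x) ('J P x) = polarize (w' (t (f x))) ('J f x *m 'J t (f x)) ('J P x *m 'J t (f x)).
  by rewrite -polarize_mulr; apply: eq_bigr => i _; exact: cc_form C _ Tx _.
apply: etrans (congr1 (fun r => polarize (w' (t (f x))) ('J f x *m 'J t (f x)) ('J f x *m 'D_(P x) (jacobian t) (f x)) + r) X1) _.
apply: (polarize_change wl wa (jacobian_change Wx)).
apply: row_combination => v.
apply: etrans (esym (deriveEjacobian _ dP')) _.
apply: etrans (derive_along v Wx PP' dP dP') _.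
apply: (f_equal2 +%R (congr1 (fun z => z *m 'J t (f x)) (deriveEjacobian v dP))).
exact: (mul_derive_jacobianC _ _ oT (cc_target C 2) Tx).
Qed.

Lemma form_jacobian_change x : W x ->
  w (f x) ('J f x) = \det ('J s x) * w' (f' (s x)) ('J f' (s x)).
Proof.
move=> Wx; have Vt := cc_target_maps C (WT Wx).
rewrite (cc_form C (WT Wx)) jacobian_change// (cc_map C Wx) alternating_mul//.
  exact: ld_multilinear L' _ Vt.
exact: ld_alternating L' _ Vt.
Qed.

Lemma mean_curvature_norm_change x : W x ->
  ip (G (f x)) (mean_curvature f G x) (mean_curvature f G x) =
  ip (G' (f' (s x))) (mean_curvature f' G' (s x)) (mean_curvature f' G' (s x)).
Proof. by move=> Wx; rewrite (metric_change Wx) ip_mul mean_curvature_change. Qed.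

End ChartChange.

(** * Lebesgue measure on row vectors and the divergence theorem *)

Section Transfer.
Context d1 d2 (T : measurableType d1) (X : measurableType d2) (R : realType).
Variables (nu : {measure set T -> \bar R}) (mu : {measure set X -> \bar R}).
Variables (e : X -> T) (J : X -> \bar R) (B : set T).
Hypotheses (me : measurable_fun setT e) (mJ : measurable_fun setT J).
Hypotheses (J0 : forall x, (0 <= J x)%E) (mB : measurable B).
Hypothesis nuE : forall A, measurable A -> A `<=` B ->
  nu A = (\int[mu]_x ((\1_A (e x))%:E * J x))%E.

Import HBNNSimple.
Local Open Scope ereal_scope.

Lemma measurable_indic_comp A : measurable A ->
  measurable_fun setT (fun x => (\1_A (e x))%:E : \bar R).
Proof.
move=> mA; apply/measurable_EFinP; exact: measurableT_comp.
Qed.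

Lemma transfer_nnsfun (s : {nnsfun T >-> R}) :
  \int[nu]_(p in B) (s p)%:E = \int[mu]_x ((\1_B (e x))%:E * (s (e x))%:E * J x).
Proof.
transitivity (\sum_(r \in range s) r%:E * nu (B `&` (s @^-1` [set r]))).
  rewrite (eq_integral (fun p => \sum_(r \in range s) (r * \1_(s @^-1` [set r]) p)%:E)); last first.
    by move=> p _; rewrite [in LHS](fimfunE s) -fsumEFin.
  rewrite ge0_integral_fsum//; first last.
  - by move=> n p _; rewrite nnfun_muleindic_ge0.
  - by move=> n; apply/measurable_EFinP; apply: measurable_funM.
  apply: eq_fsbigr => r _.
  rewrite integralZl_indic_nnsfun//.
  by rewrite integral_indic//= setIC.
transitivity (\sum_(r \in range s) \int[mu]_x (r%:E * ((\1_(B `&` s @^-1` [set r]) (e x))%:E * J x))).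
  apply: eq_fsbigr => r /set_mem [p _ <-].
  have mm : measurable (B `&` s @^-1` [set s p]) by apply: measurableI.
  rewrite nuE// ge0_integralZl//.
  - by apply: emeasurable_funM => //; exact: measurable_indic_comp.
  - by move=> x _; rewrite mule_ge0// lee_fin.
  - by rewrite lee_fin.
rewrite -ge0_integral_fsum//; first last.
- move=> r x _; have [r0|r0] := leP 0%R r; first by rewrite mule_ge0 ?lee_fin// mule_ge0 ?lee_fin.
  by rewrite preimage_nnfun0// setI0 indic0 mul0e mule0.
- move=> r; apply: measurable_funeM; apply: emeasurable_funM => //.
  by apply: measurable_indic_comp; apply: measurableI.
apply: eq_integral => x _.
rewrite [in RHS](fimfunE s) -fsumEFin// ge0_mule_fsumr; last first.
  by move=> r; rewrite nnfun_muleindic_ge0.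
rewrite ge0_mule_fsuml; last first.
  by move=> r; apply: mule_ge0; rewrite ?lee_fin// -lee_fin EFinM nnfun_muleindic_ge0.
apply: eq_fsbigr => r _.
rewrite indicI EFinM EFinM !muleA; congr (_ * _).
by rewrite -muleA muleCA muleA.
Qed.

(** Known on simple functions, the formula passes to [f] by monotone convergence on both sides. *)
Lemma ge0_integral_transfer (f : T -> \bar R) :
  measurable_fun setT f -> (forall p, 0 <= f p) ->
  \int[nu]_(p in B) f p = \int[mu]_x ((\1_B (e x))%:E * f (e x) * J x).
Proof.
move=> mf f0; pose s := nnsfun_approx measurableT mf.
have cs p : (s n p)%:E @[n --> \oo] --> f p by apply: cvg_nnsfun_approx.
have nds : nondecreasing_seq (s : (T -> R)^nat) by exact: nd_nnsfun_approx.
have ms n : measurable_fun setT (fun x => (\1_B (e x))%:E * (s n (e x))%:E * J x).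
  apply: emeasurable_funM => //; apply: emeasurable_funM; first exact: measurable_indic_comp.
  by apply/measurable_EFinP; apply: measurableT_comp.
transitivity (limn (fun n => \int[nu]_(p in B) (s n p)%:E)).
  rewrite -monotone_convergence//.
  - by apply: eq_integral => p _; apply/esym/cvg_lim.
  - by move=> n; apply/measurable_EFinP; exact: measurable_funP.
  - by move=> n p _; rewrite lee_fin.
  - by move=> p _ i j ij; rewrite lee_fin; exact/lefP/nds.
rewrite (_ : (fun n => _) = fun n => \int[mu]_x ((\1_B (e x))%:E * (s n (e x))%:E * J x)); last first.
  by apply/funext => n; exact: transfer_nnsfun.
rewrite -monotone_convergence//.
- apply: eq_integral => x _; apply/cvg_lim => //.
  have [Bx|Bx] := pselect (B (e x)); last first.
    rewrite indicE memNset// mul0e mul0e.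
    by under eq_fun do rewrite mul0e mul0e; exact: cvg_cst.
  rewrite indicE mem_set// mul1e.
  under eq_fun do rewrite mul1e.
  have [->|J1] := eqVneq (J x) 0.
    by rewrite mule0; under eq_fun do rewrite mule0; exact: cvg_cst.
  have := J0 x; case: (J x) J1 => [r| |] //= J1 r0.
    by apply: cvgeZr => //; exact: cs.
  (* The density is infinite here. Either [f] vanishes, and so do its lower approximations, or some
     approximation is positive and the products are infinite from there on. *)
  have [f1|f1] := eqVneq (f (e x)) 0.
    have s0 n : (s n (e x))%:E = 0.
      apply/eqP; rewrite eq_le -{1}f1 lee_fin fun_ge0 andbT.
      rewrite -(cvg_lim _ (cs (e x)))//; apply: lime_ge; first by apply/cvg_ex; exists (f (e x)).
      by near=> k; rewrite lee_fin; apply/lefP/nds; near: k; exact: nbhs_infty_ge.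
    by rewrite f1 mul0e; under eq_fun do rewrite s0 mul0e; exact: cvg_cst.
  have fp : 0 < f (e x) by rewrite lt_neqAle eq_sym f1 f0.
  rewrite gt0_muley//.
  have [n sn] : exists n, (0 < s n (e x))%R.
    apply: contrapT => /forallNP H.
    suff : f (e x) = 0 by move/eqP; rewrite (negbTE f1).
    rewrite -(cvg_lim _ (cs (e x)))// (_ : (fun n => _) = fun=> 0) ?lim_cst//.
    by apply/funext => n; apply: le_anti; rewrite !lee_fin fun_ge0 andbT leNgt; apply/negP/H.
  apply: cvg_near_cst.
  near=> k; rewrite gt0_muley// lte_fin (lt_le_trans sn)//.
  by apply/lefP/nds; near: k; exact: nbhs_infty_ge.
- by move=> n x _; rewrite mule_ge0// mule_ge0 ?lee_fin.
- move=> x _ i j ij; rewrite lee_wpmul2r// lee_wpmul2l ?lee_fin//.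
  exact/lefP/nds.
Unshelve. all: by end_near. Qed.

End Transfer.

Section SigmaFinite.
Context d (T : measurableType d) (R : realType) (mu : {measure set T -> \bar R}).

(* An alias that records the hypothesis, so that it can be inferred as a structure. *)
Definition as_sigma_finite (_ : sigma_finite setT mu) : set T -> \bar R := mu.

Variable mu_sigma_finite : sigma_finite setT mu.

HB.instance Definition _ := Measure.on (as_sigma_finite mu_sigma_finite).
HB.instance Definition _ :=
  Measure_isSigmaFinite.Build _ _ _ (as_sigma_finite mu_sigma_finite) mu_sigma_finite.

End SigmaFinite.

Lemma open_preimage (T T' : topologicalType) (U : set T) (f : T -> T') (V : set T') :
  open U -> (forall x, U x -> {for x, continuous f}) -> open V -> open (U `&` f @^-1` V).
Proof.
move=> oU cf oV; rewrite openE => x [Ux Vx]; apply: filterI; first exact: open_nbhs_nbhs.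
by apply: (cf x Ux); exact: open_nbhs_nbhs.
Qed.

Lemma borel_measurable_fun (T T' : ptopologicalType) (U : set T) (f : T -> T') :
  open U -> (forall x, U x -> {for x, continuous f}) ->
  measurable_fun (U : set (g_sigma_algebraType (@open T)))
                 (f : _ -> g_sigma_algebraType (@open T')).
Proof.
move=> oU cf.
apply: (@measurability _ _ (g_sigma_algebraType (@open T)) (g_sigma_algebraType (@open T')) U f (@open T') erefl).
move=> _ [V oV <-]; apply: sub_sigma_algebra; exact: open_preimage.
Qed.

Lemma borel_measurable_real (R : realType) (T : ptopologicalType) (U : set T) (f : T -> R) :
  open U -> (forall x, U x -> {for x, continuous f}) ->
  measurable_fun (U : set (g_sigma_algebraType (@open T))) f.
Proof.
move=> oU cf; apply: (measurability _ (RGenOpens.measurableE R)) => _ [_ [a [b ->]] <-].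
apply: sub_sigma_algebra; apply: open_preimage => //; exact: itv_open.
Qed.

(** * Lebesgue measure on rows and slicing along a coordinate *)

Section BorelRows.
Context {R : realType}.
Notation Rv k := (g_sigma_algebraType (@open 'rV[R]_k)).

(** Countably many cubes suffice, those contained in [O] with rational centre and half-width
    1/(n+1). Taking it below half the radius leaves room for the triangle inequality. As a
    consequence a map into rows is Borel as soon as its coordinates are. *)
Lemma open_rV_bigcup k (O : set 'rV[R]_k) : open O ->
  O = \bigcup_(q in [set q : 'rV[rat]_k * nat |
         forall y : 'rV[R]_k, (forall i, `|y 0 i - ratr (q.1 0 i)| < q.2.+1%:R^-1) -> O y])
       [set y | forall i, `|y 0 i - ratr (q.1 0 i)| < q.2.+1%:R^-1].
Proof.
move=> oO; apply/seteqP; split=> [x Ox|x [q /= qO]]; last exact: qO.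
have := open_nbhs_nbhs (conj oO Ox); rewrite -nbhs_ballE => -[e /= e0 eO].
have [n n2] : exists n : nat, n.+1%:R^-1 < e / 2.
  have [n] := near_infty_natSinv_lt (PosNum (divr_gt0 e0 (ltr0n R 2))).
  by move=> _ H; exists n; apply: H => /=.
have q_ i : {q : rat | `|x 0 i - ratr q| < n.+1%:R^-1}.
  apply: cid; have [q] := @rat_in_itvoo R (x 0 i - n.+1%:R^-1) (x 0 i + n.+1%:R^-1) ltac:(by rewrite ltrD2l gtrN ?invr_gt0).
  by rewrite in_itv /= => /andP[q1 q2]; exists q; rewrite ltr_distlC q1 q2.
exists (\row_i sval (q_ i), n) => /=; last by move=> i; rewrite mxE; exact: (svalP (q_ i)).
move=> y yq; apply: eO; split=> // i j; rewrite (ord1 i) /ball /=.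
have := yq j; rewrite mxE; have := svalP (q_ j) => /=.
by move: (n.+1%:R^-1) n2 (ratr _) => c ce r; rewrite !ltr_norml => /andP[? ?] /andP[? ?]; apply/andP; split; lra.
Qed.

Lemma measurable_fun_row d (T : measurableType d) k (h : T -> 'rV[R]_k) :
  (forall i, measurable_fun setT (fun p => h p 0 i)) -> measurable_fun setT (h : T -> Rv k).
Proof.
move=> mh; apply: (@measurability _ _ T (Rv k) setT h (@open 'rV[R]_k) erefl).
move=> _ [V oV <-]; rewrite setTI (open_rV_bigcup oV) preimage_bigcup.
rewrite bigcup_mkcond; apply: countable_bigcupT_measurable => // q.
case: ifPn => // _.
rewrite (_ : _ @^-1` _ = \bigcap_(i in setT) [set p | `|h p 0 i - ratr (q.1 0 i)| < q.2.+1%:R^-1]); last first.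
  by apply/seteqP; split=> p /= H i; [move=> _; exact: H|exact: H].
apply: fin_bigcap_measurable => // i _.
rewrite (_ : [set p | _] = setT `&` (fun p => h p 0 i) @^-1` `]ratr (q.1 0 i) - q.2.+1%:R^-1, ratr (q.1 0 i) + q.2.+1%:R^-1[%classic).
  by apply: mh.
by rewrite setTI; apply/seteqP; split=> p /=; rewrite in_itv /= ltr_distl.
Qed.

Definition insert k (i : 'I_k.+1) (t : R) (y : 'rV[R]_k) : 'rV[R]_k.+1 :=
  \row_j (if unlift i j is Some l then y 0 l else t).

Lemma insert_at k (i : 'I_k.+1) t (y : 'rV[R]_k) : insert i t y 0 i = t.
Proof. by rewrite mxE unlift_none. Qed.

Lemma insert_off k (i : 'I_k.+1) t (y : 'rV[R]_k) l : insert i t y 0 (lift i l) = y 0 l.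
Proof. by rewrite mxE liftK. Qed.

Lemma insert_ord0 k t (y : 'rV[R]_k) : insert ord0 t y = row_mx (t%:M : 'M[R]_1) y.
Proof.
apply/rowP => j; case: (unliftP ord0 j) => [l ->|->].
  rewrite insert_off (_ : lift ord0 l = rshift 1 (l : 'I_k)); last exact: val_inj.
  by rewrite (row_mxEr (t%:M : 'M[R]_1) y).
rewrite insert_at (_ : ord0 = lshift k (ord0 : 'I_1)); last exact: val_inj.
by rewrite (row_mxEl (t%:M : 'M[R]_1) y) mxE.
Qed.

Lemma insert_lift k (i : 'I_k.+1) s t (y : 'rV[R]_k) :
  insert (lift ord0 i) t (insert ord0 s y) = insert ord0 s (insert i t y).
Proof.
apply/rowP => j; case: (unliftP (lift ord0 i) j) => [l ->|->]; last by rewrite insert_off !insert_at.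
rewrite insert_off; case: (unliftP ord0 l) => [l' ->|->].
  rewrite insert_off (_ : lift _ _ = lift ord0 (lift i l')) ?insert_off//.
  by apply: val_inj; rewrite /= /bump /= !add1n ltnS addnS.
by rewrite insert_at (_ : lift _ _ = ord0) ?insert_at//; exact: val_inj.
Qed.

Definition cube k (B : R) : set 'rV[R]_k := [set x | forall i, `|x 0 i| <= B].

Lemma measurable_coord k (i : 'I_k) : measurable_fun setT (fun x : Rv k => (x : 'rV[R]_k) 0 i).
Proof.
apply: borel_measurable_real; first exact: openT.
by move=> x _; exact: coord_continuous.
Qed.

Lemma measurable_cube k B : measurable (cube B : set (Rv k)).
Proof.
rewrite (_ : cube B = \bigcap_(i in setT) ((fun x : Rv k => (x : 'rV[R]_k) 0 i) @^-1` `[-B, B])); last first.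
  by apply/seteqP; split=> x H i => [_|]; have := H i; rewrite /= in_itv /= ler_norml//; apply.
apply: fin_bigcap_measurable => // i _; rewrite -[X in measurable X]setTI.
exact: measurable_coord.
Qed.

Lemma cube_sigma_finite k (mu : {measure set (Rv k) -> \bar R}) :
  (forall B, (mu (cube B) < +oo)%E) -> sigma_finite setT mu.
Proof.
move=> muB; exists (fun n => cube n%:R).
  apply/esym; rewrite -subTset => x _.
  exists (Num.bound (\sum_i `|x 0 i|)) => // i.
  apply/ltW; apply: le_lt_trans (archi_boundP _); last by apply: sumr_ge0.
  by rewrite (bigD1 i) //= lerDl sumr_ge0.
move=> n; split=> //; exact: measurable_cube.
Qed.

(** [lebesgue_int] is an iterated integral, not integration against a measure. The measure is built
    as the image of a product under insertion of the first coordinate, and Tonelli matches the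
    iteration; finiteness on cubes is carried along because the product needs sigma-finiteness. *)
Lemma lebesgue_rV_measure k : exists mu : {measure set (Rv k) -> \bar R},
  (forall B, (mu (cube B) < +oo)%E) /\
  forall f, measurable_fun setT (f : Rv k -> \bar R) -> (forall x, (0 <= f x)%E) ->
    lebesgue_int f = (\int[mu]_x f x)%E.
Proof.
elim: k => [|k [mu [muB muE]]].
  exists (dirac (0 : Rv 0)); split=> [B|f mf f0].
    by rewrite /dirac /= ltry.
  by rewrite /= integral_dirac// diracT mul1e.
pose ms : {sigma_finite_measure set (Rv k) -> \bar R} := as_sigma_finite (cube_sigma_finite muB).
pose h (z : R * Rv k) : Rv k.+1 := insert ord0 z.1 z.2.
have mh : measurable_fun setT h.
  apply: measurable_fun_row => i; rewrite /h.
  case: (unliftP ord0 i) => [l ->|->].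
    under eq_fun do rewrite insert_off.
    exact: (measurableT_comp (measurable_coord l) measurable_snd).
  under eq_fun do rewrite insert_at.
  exact: measurable_fst.
pose nu := measure_function_pushforward__canonical__measure_function_Measure
  (lebesgue_measure \x ms)%E mh.
exists nu; split=> [B|f mf f0].
  rewrite /nu /= /pushforward (_ : _ @^-1` _ = `[-B, B]%classic `*` (cube B : set (Rv k))); last first.
    apply/seteqP; split=> z /= H.
      split; first by have := H ord0; rewrite insert_at ler_norml in_itv.
      by move=> i; have := H (lift ord0 i); rewrite insert_off.
    case: H => H1 H2 i; case: (unliftP ord0 i) => [l ->|->]; first by rewrite insert_off.
    by rewrite insert_at ler_norml; rewrite in_itv in H1.
  rewrite product_measure1E//; last exact: measurable_cube.
  apply: lte_mul_pinfty => //.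
  - by rewrite /= lebesgue_measure_itv /=; case: ifP.
  - exact: muB.
rewrite /nu ge0_integral_pushforward//.
rewrite preimage_setT fubini_tonelli1//.
apply: eq_integral => t _; rewrite /fubini_F /= -muE//.
- congr (lebesgue_int _); apply/funext => v.
  by rewrite /h /= insert_ord0.
- by apply: (measurableT_comp mf); apply: (measurableT_comp mh); exact: pair1_measurable.
- exact: (measurableT_comp mf mh).
- by move=> z; exact: f0.
Qed.

Definition mu_rV k : {measure set (Rv k) -> \bar R} := sval (cid (lebesgue_rV_measure k)).

Lemma mu_rV_cube k B : (mu_rV k (cube B) < +oo)%E.
Proof. exact: (svalP (cid (lebesgue_rV_measure k))).1. Qed.

Lemma lebesgue_intE k f : measurable_fun setT (f : Rv k -> \bar R) ->
  (forall x, (0 <= f x)%E) -> lebesgue_int f = (\int[mu_rV k]_x f x)%E.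
Proof. exact: (svalP (cid (lebesgue_rV_measure k))).2. Qed.

Lemma measurable_insert k (i : 'I_k.+1) :
  measurable_fun setT (fun z : R * Rv k => insert i z.1 z.2 : Rv k.+1).
Proof.
apply: measurable_fun_row => j; case: (unliftP i j) => [l ->|->].
  under eq_fun do rewrite insert_off.
  exact: (measurableT_comp (measurable_coord l) measurable_snd).
under eq_fun do rewrite insert_at.
exact: measurable_fst.
Qed.

Section Slices.
Variables (k : nat) (i : 'I_k.+1) (f : Rv k.+1 -> \bar R).
Hypotheses (mf : measurable_fun setT f) (f0 : forall x, (0 <= f x)%E).

Let mfh := measurableT_comp mf (measurable_insert i).
Let f0h (z : R * Rv k) : (0 <= f (insert i z.1 z.2))%E := f0 _.

Lemma measurable_slice : measurable_fun setT (fun y : Rv k =>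
  (\int[lebesgue_measure]_(t in [set: R]) f (insert i t y))%E).
Proof. exact: (@measurable_fun_fubini_tonelli_G _ _ _ _ _ lebesgue_measure _ mfh f0h). Qed.

Lemma slice_ge0 y : (0 <= \int[lebesgue_measure]_(t in [set: R]) f (insert i t y))%E.
Proof. by apply: integral_ge0 => t _; exact: f0. Qed.

Lemma integral_slice_swap :
  (\int[lebesgue_measure]_t \int[mu_rV k]_y f (insert i t y) =
   \int[mu_rV k]_y \int[lebesgue_measure]_(t in [set: R]) f (insert i t y))%E.
Proof.
pose ms : {sigma_finite_measure set (Rv k) -> \bar R} :=
  as_sigma_finite (cube_sigma_finite (@mu_rV_cube k)).
exact: (@fubini_tonelli _ _ _ _ _ lebesgue_measure ms _ mfh f0h).
Qed.

End Slices.

Lemma lebesgue_int_slice0 k (f : Rv k.+1 -> \bar R) :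
  measurable_fun setT f -> (forall x, (0 <= f x)%E) ->
  lebesgue_int f = lebesgue_int (fun y : 'rV[R]_k =>
    (\int[lebesgue_measure]_(t in [set: R]) f (insert ord0 t y))%E).
Proof.
move=> mf f0; rewrite [RHS]lebesgue_intE; first last.
- exact: slice_ge0.
- exact: measurable_slice.
rewrite -integral_slice_swap//.
transitivity (\int[lebesgue_measure]_(t in [set: R])
  lebesgue_int (fun v : 'rV[R]_k => f (row_mx (t%:M : 'M[R]_1) v : 'rV[R]_k.+1)))%E => //.
apply: eq_integral => t _.
have -> : (fun v => f (row_mx (t%:M : 'M[R]_1) v)) = fun v => f (insert ord0 t v).
  by apply/funext => v; rewrite insert_ord0.
rewrite lebesgue_intE//.
apply: (measurableT_comp mf).
exact: (measurableT_comp (measurable_insert ord0) (pair1_measurable (t : R))).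
Qed.

(** [lebesgue_int] integrates the first coordinate outermost, while the fundamental theorem of
    calculus wants the i-th one innermost. For [ord0] this is Tonelli; any other coordinate is moved
    under the outermost integral by induction. *)
Lemma lebesgue_int_slice k (i : 'I_k.+1) (f : Rv k.+1 -> \bar R) :
  measurable_fun setT f -> (forall x, (0 <= f x)%E) ->
  lebesgue_int f = lebesgue_int (fun y : 'rV[R]_k =>
    (\int[lebesgue_measure]_(t in [set: R]) f (insert i t y))%E).
Proof.
elim: k i f => [|k IH] i f mf f0; case: (unliftP ord0 i) => [i' ->|->].
- by case: i' => [[]].
- exact: lebesgue_int_slice0.
- transitivity (\int[lebesgue_measure]_(s in [set: R])
    lebesgue_int (fun v : 'rV[R]_k.+1 => f (row_mx (s%:M : 'M[R]_1) v : 'rV[R]_k.+2)))%E => //.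
  transitivity (\int[lebesgue_measure]_(s in [set: R]) lebesgue_int (fun y : 'rV[R]_k =>
    \int[lebesgue_measure]_(t in [set: R])
      f (insert (lift ord0 i') t (row_mx (s%:M : 'M[R]_1) y : 'rV[R]_k.+1))))%E => //.
  apply: eq_integral => s _.
  have -> : (fun v : 'rV[R]_k.+1 => f (row_mx (s%:M : 'M[R]_1) v)) = fun v => f (insert ord0 s v).
    by apply/funext => v; rewrite insert_ord0.
  rewrite (IH i'); first last.
  + by move=> v; exact: f0.
  + apply: (measurableT_comp mf).
    exact: (measurableT_comp (measurable_insert ord0) (pair1_measurable (s : R))).
  congr (lebesgue_int _); apply/funext => y; apply: eq_integral => t _.
  by rewrite -insert_lift insert_ord0.
- exact: lebesgue_int_slice0.
Qed.

Lemma integral_slice k (i : 'I_k.+1) (f : Rv k.+1 -> \bar R) :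
  measurable_fun setT f -> (forall x, (0 <= f x)%E) ->
  (\int[mu_rV k.+1]_x f x =
   \int[mu_rV k]_y \int[lebesgue_measure]_(t in [set: R]) f (insert i t y))%E.
Proof.
move=> mf f0; rewrite -!lebesgue_intE//; first exact: lebesgue_int_slice.
  exact: measurable_slice.
exact: slice_ge0.
Qed.

Lemma compact_cube k (B : R) : compact (cube B : set 'rV[R]_k).
Proof.
rewrite (_ : cube B = [set v : 'rV[R]_k | forall i, `[-B, B]%classic (v ord0 i)]).
  by apply: (@rV_compact R k (fun=> `[- B, B]%classic)) => i; exact: segment_compact.
by apply/seteqP; split=> v H i; have := H i; rewrite /= in_itv /= ler_norml.
Qed.

Lemma compact_support_bounded k (F : 'rV[R]_k -> R) (B : R) :
  (forall x, {for x, continuous F}) -> (forall x, ~ cube B x -> F x = 0) ->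
  exists C, forall x, `|F x| <= C.
Proof.
move=> cF F0.
have /compact_bounded[C [_ HC]] : compact (F @` (cube B : set 'rV[R]_k)).
  apply: continuous_compact; last exact: compact_cube.
  by apply: continuous_subspaceT => x; exact: cF.
exists (`|C| + 1) => x; have [xB|xB] := pselect (cube B x).
  by apply: HC; [rewrite (le_lt_trans (ler_norm C))// ltrDl|exists x].
by rewrite F0// normr0 addr_ge0.
Qed.

Lemma bounded_support_integrable d (T : measurableType d) (mu : {measure set T -> \bar R})
    (A : set T) (F : T -> R) (C : R) :
  measurable A -> (mu A < +oo)%E -> measurable_fun setT F ->
  (forall x, `|F x| <= C) -> (forall x, ~ A x -> F x = 0) ->
  mu.-integrable setT (EFin \o F).
Proof.
move=> mA muA mF FC F0.
have -> : EFin \o F = (EFin \o F) \_ A.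
  apply/funext => x; rewrite patchE /=; case: ifPn => // /negP xA; by rewrite /= F0// => Ax; apply: xA; exact: mem_set.
apply/(integrable_mkcond (EFin \o F) mA)/measurable_bounded_integrable => //.
  exact: measurable_funS mF.
exists C; split=> [|M CM x _]; first exact: num_real.
exact: le_trans (FC x) (ltW CM).
Qed.

(** * The fundamental theorem of calculus and the divergence theorem on a half space *)

Section FTC.
Variables (phi dphi : R -> R) (B : R).
Hypotheses (B0 : 0 < B) (dphiE : forall t : R, is_derive t (1 : R) (phi : R -> R^o) (dphi t)).
Hypotheses (cdphi : continuous dphi) (phi0 : forall t, B < `|t| -> phi t = 0).

Lemma dphi0 t : B < `|t| -> dphi t = 0.
Proof.
move=> Bt; have H : \forall s \near (t : R^o), (phi : R^o -> R^o) s = (fun=> 0 : R^o) s.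
  apply: (near_open (U := [set s : R | B < `|s|])) => //.
  rewrite (_ : [set s : R | _] = [set s | s < - B] `|` [set s | s > B]).
    by apply: openU; [exact: open_lt|exact: open_gt].
  by apply/seteqP; split=> s /=; rewrite ltr_normr ltrNr; [move/orP => []; [right|left]|move=> []-> //; rewrite orbT].
have [_ <-] := near_eq_is_derive H (dphiE t); exact: derive_cst.
Qed.

Lemma integral_ftc (a b : R) : a < b ->
  (\int[lebesgue_measure]_(t in `[a, b]) (dphi t)%:E = (phi b - phi a)%:E)%E.
Proof.
move=> ab; rewrite (@continuous_FTC2 _ dphi phi a b)// ?EFinB//.
- exact: continuous_subspaceT.
- have cphi x : {for x, continuous (phi : R -> R^o)}.
    by apply: differentiable_continuous; apply/derivable1_diffP; have := dphiE x; apply: @ex_derive.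
  split.
  + by move=> x _; have := dphiE x; apply: @ex_derive.
  + exact: (cvg_at_right_filter (cphi a)).
  + exact: (cvg_at_left_filter (cphi b)).
- by move=> x _; rewrite derive1E; exact: derive_val.
Qed.

Lemma integral_derive_full :
  (\int[lebesgue_measure]_(t in [set: R]) (dphi t)%:E = 0)%E.
Proof.
have ab : - B - 1 < B + 1 by have := B0; lra.
rewrite (_ : (fun t => (dphi t)%:E) = (fun t => (dphi t)%:E) \_ `[- B - 1, B + 1]).
  rewrite -integral_mkcond integral_ftc// !phi0 ?subrr//.
    by rewrite -opprD normrN ger0_norm; have := B0; lra.
  by rewrite ger0_norm; have := B0; lra.
apply/funext => t; rewrite patchE; case: ifPn => // /negP H; congr EFin; apply: dphi0.
rewrite ltNge; apply/negP; rewrite ler_norml => /andP[? ?]; apply: H.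
by apply: mem_set; rewrite /= in_itv /=; apply/andP; split; lra.
Qed.

Lemma integral_derive_half :
  (\int[lebesgue_measure]_(t in [set: R]) (if (t < 0)%R then dphi t else 0)%:E = (phi 0)%:E)%E.
Proof.
have ab : - B - 1 < 0 by have := B0; lra.
(* The integrand vanishes beyond B, so the half line may be cut at -B - 1; the open end at 0 has
   measure zero. *)
rewrite (_ : (fun t => _) = (fun t => (dphi t)%:E) \_ `[- B - 1, 0[).
  rewrite -integral_mkcond integral_itv_bndo_bndc; last first.
    by apply/measurable_EFinP; apply: measurable_funTS; exact: continuous_measurable_fun.
  rewrite integral_ftc// [phi (- B - 1)]phi0 ?subr0//.
  by rewrite -opprD normrN ger0_norm; have := B0; lra.
apply/funext => t; rewrite patchE mem_setE in_itv /=; case: (ltP t 0) => t0; last by rewrite andbF.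
case: ifPn => // /negP H; congr EFin; apply: dphi0.
rewrite ltr0_norm//; move: H; rewrite andbT => /negP; rewrite -ltNge; have := B0; lra.
Qed.

Lemma dphi_bounded : exists C, forall x, `|dphi x| <= C.
Proof.
have /compact_bounded[C [_ HC]] : compact (dphi @` `[- B, B]%classic).
  apply: continuous_compact; last exact: segment_compact.
  by apply: continuous_subspaceT.
exists (`|C| + 1) => x; have [xB|xB] := leP `|x| B.
  apply: HC; first by rewrite (le_lt_trans (ler_norm C))// ltrDl.
  by exists x => //=; rewrite in_itv /= -ler_norml.
by rewrite dphi0// normr0 addr_ge0.
Qed.

Lemma dphi_restrict_integrable (e : R -> bool) : measurable_fun setT e ->
  lebesgue_measure.-integrable setT (fun t => (if e t then dphi t else 0)%:E).
Proof.
move=> me; have [C HC] := dphi_bounded.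
apply: (@bounded_support_integrable _ _ lebesgue_measure `[- B, B]%classic
  (fun t => if e t then dphi t else 0) `|C|).
- exact: measurable_itv.
- have : (lebesgue_measure ([set` `[(- B)%R, B]] : set R) < +oo)%E; last exact.
  by rewrite lebesgue_measure_itv; case: ifP => _ //; exact: ltry.
- by apply: measurable_fun_ifT => //; exact: continuous_measurable_fun.
- move=> x; case: ifP => _; last by rewrite normr0.
  by rewrite (le_trans (HC x))// ler_norm.
- move=> x xB; case: ifP => // _; apply: dphi0.
  by rewrite ltNge; apply/negP; rewrite ler_norml => H; apply: xB; rewrite /= in_itv.
Qed.

End FTC.

Lemma fin_num_subr_le (p n c : \bar R) : p \is a fin_num -> n \is a fin_num ->
  (p <= n + c -> p - n <= c)%E.
Proof.
case: p => // p _; case: n => // n _; case: c => [c| |] //=; rewrite ?leey//.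
by rewrite -EFinD !lee_fin; lra.
Qed.

(** The inequality is additive in the positive and negative parts, so that each can be sliced by
    Tonelli and the estimates on lines integrated. *)
Lemma integral_pos_le d (T : measurableType d) (mu : {measure set T -> \bar R}) (g : T -> \bar R) c :
  mu.-integrable setT g -> (\int[mu]_x g x = c%:E)%E ->
  (\int[mu]_x g^\+ x <= \int[mu]_x g^\- x + `|c|%:E)%E.
Proof.
move=> ig; rewrite integralE.
have := integrable_pos_fin_num measurableT ig; have := integrable_neg_fin_num measurableT ig.
case: (\int[mu]_x g^\- x)%E => // a _; case: (\int[mu]_x g^\+ x)%E => // b _.
by move=> [<-]; rewrite -EFinD lee_fin; have := ler_norm (b - a); lra.
Qed.

(** [None] serves charts lying inside the domain, [Some i] charts in which the domain is the half
    space x_i < 0. *)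
Definition side k (o : option 'I_k) (x : 'rV[R]_k) : bool :=
  if o is Some i then x 0 i < 0 else true.

Lemma measurable_side k (o : option 'I_k) : measurable_fun setT (side o : Rv k -> bool).
Proof.
case: o => [i|]; last exact: measurable_cst.
apply: measurable_fun_ltr; [exact: measurable_coord|exact: measurable_cst].
Qed.

Lemma side_insert k (o : option 'I_k.+1) j t (y : 'rV[R]_k) :
  side o (insert j t y) = if o == Some j then t < 0 else side o (insert j 0 y).
Proof.
case: o => [i|] //=; case: eqP => [[->]|ij]; first by rewrite insert_at.
case: (unliftP j i) ij => [l ->|-> //] _; by rewrite !insert_off.
Qed.

(** On each line parallel to the j-th axis the derivative integrates to 0, or to the value on the
    face when the half space is cut along [j]. The lines are reassembled by slicing positive and
    negative parts separately. *)
Lemma derive_along_le k (j : 'I_k.+1) (h : 'rV[R]_k.+1 -> R^o) (B : R) (o : option 'I_k.+1) :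
  0 < B -> (forall x, {for x, continuous h}) -> (forall x, derivable h x (delta_mx 0 j)) ->
  (forall x, {for x, continuous ('D_(delta_mx 0 j) h)}) ->
  (forall x, ~ cube B x -> h x = 0) ->
  let g x : R := if side o x then 'D_(delta_mx 0 j) h x else 0 in
  (mu_rV k.+1).-integrable setT (EFin \o g) /\
  (\int[mu_rV k.+1]_x (g x)%:E <=
   \int[mu_rV k]_y (if o == Some j then `|h (insert0 j y)| else 0)%:E)%E.
Proof.
move=> B0 ch dh cdh h0 g.
have E t y : insert j t y = t *: delta_mx 0 j + insert j 0 y.
  apply/rowP => l; rewrite !mxE; case: unliftP => [a ->|->]; rewrite !eqxx /=.
    by rewrite eq_sym (negbTE (neq_lift _ _)) mulr0 add0r.
  by rewrite mulr1 addr0.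
pose phi y t := h (insert j t y); pose dphi y t : R := 'D_(delta_mx 0 j) h (insert j t y).
have dphiE y (t : R) : is_derive t (1 : R) (phi y : R -> R^o) (dphi y t).
  rewrite /phi /dphi; under eq_fun do rewrite E.
  by rewrite (E t y); apply: (@is_derive_line R _ _ h); exact: dh.
have cdphi y : continuous (dphi y).
  move=> t; apply: (@continuous_comp _ _ _ (fun t => insert j t y) ('D_(delta_mx 0 j) h)); last exact: cdh.
  rewrite (_ : (insert j)^~ y = fun t => t *: delta_mx 0 j + insert j 0 y); last by apply/funext => s; exact: E.
  by apply: continuousD; [apply: scalel_continuous|exact: cst_continuous].
have phi0 y t : B < `|t| -> phi y t = 0.
  by move=> Bt; apply: h0 => /(_ j); rewrite insert_at leNgt Bt.
have mg : measurable_fun setT (g : Rv k.+1 -> R).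
  apply: measurable_fun_ifT; [exact: measurable_side| |exact: measurable_cst].
  by apply: borel_measurable_real; [exact: openT|move=> x _; exact: cdh].
have ig : (mu_rV k.+1).-integrable setT (EFin \o g).
  have dh0 x : ~ cube B x -> 'D_(delta_mx 0 j) h x = 0.
    move=> xB; rewrite (near_eq_derive _ (g := fun=> 0 : R^o)) ?derive_cst//.
    apply: (near_open (U := ~` cube B)) => //; apply: closed_openC.
    by apply: compact_closed; [exact: norm_hausdorff|exact: compact_cube].
  have [C HC] := compact_support_bounded cdh dh0.
  apply: (@bounded_support_integrable _ (Rv k.+1) (mu_rV k.+1) (cube B) g `|C|) => //.
  - exact: measurable_cube.
  - exact: mu_rV_cube.
  - move=> x; rewrite /g; case: ifP => _; last by rewrite normr0.
    by rewrite (le_trans (HC x))// ler_norm.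
  - by move=> x xB; rewrite /g dh0// if_same.
split=> //.
have mg' : measurable_fun setT (EFin \o g : Rv k.+1 -> \bar R) by exact/measurable_EFinP.
pose b y : R := if o == Some j then `|h (insert0 j y)| else 0.
have b0 y : 0 <= b y by rewrite /b; case: ifP.
have mb : measurable_fun setT (b : Rv k -> R).
  rewrite /b; case: (o == Some j); last exact: measurable_cst.
  apply: measurableT_comp; first exact: normr_measurable.
  have mh : measurable_fun setT (h : Rv k.+1 -> R).
    by apply: borel_measurable_real; [exact: openT|move=> x _; exact: ch].
  apply: (measurableT_comp mh).
  exact: (measurableT_comp (measurable_insert j) (pair1_measurable (0 : R))).
suff H : (\int[mu_rV k.+1]_x (EFin \o g)^\+ x <=
          \int[mu_rV k.+1]_x (EFin \o g)^\- x + \int[mu_rV k]_y (b y)%:E)%E.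
  rewrite [leLHS]integralE; exact: (fin_num_subr_le (integrable_pos_fin_num measurableT ig)
    (integrable_neg_fin_num measurableT ig) H).
rewrite (integral_slice j) ?(integral_slice j (f := (EFin \o g)^\-%E))//; first last.
- exact: measurable_funepos.
- exact: measurable_funeneg.
rewrite -ge0_integralD//; first last.
- exact/measurable_EFinP.
- by move=> y _; rewrite lee_fin.
- by apply: measurable_slice => //; exact: measurable_funeneg.
- by move=> y _; apply: integral_ge0.
apply: ge0_le_integral => //.
- by move=> y _; apply: integral_ge0.
- by apply: measurable_slice => //; exact: measurable_funepos.
- apply: emeasurable_funD; last exact/measurable_EFinP.
  by apply: measurable_slice => //; exact: measurable_funeneg.
move=> y _.
have gE : (fun t => (EFin \o g) (insert j t y)) =
    fun t => (if (if o == Some j then t < 0 else side o (insert j 0 y)) then dphi y t else 0)%:E.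
  by apply/funext => t; rewrite /= /g side_insert.
set G := fun t => _ in gE.
have Gi : lebesgue_measure.-integrable setT G.
  rewrite gE; apply: (@dphi_restrict_integrable _ _ _ (dphiE y) (cdphi y) (phi0 y)).
  case: (o == Some j); last exact: measurable_cst.
  by apply: measurable_fun_ltr; [exact: measurable_id|exact: measurable_cst].
have GP : (fun t => (EFin \o g)^\+ (insert j t y))%E = (G^\+)%E.
  by apply/funext => t; rewrite !funeposE.
have GN : (fun t => (EFin \o g)^\- (insert j t y))%E = (G^\-)%E.
  by apply/funext => t; rewrite !funenegE.
rewrite GP GN.
rewrite /b; case: (o == Some j) gE => gE.
  apply: (integral_pos_le (c := phi y 0) Gi).
  by rewrite gE; exact: (@integral_derive_half _ _ _ B0 (dphiE y) (cdphi y) (phi0 y)).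
rewrite -(normr0 R); apply: (integral_pos_le (c := 0) Gi).
rewrite gE; case: (side _ _); last by rewrite integral0.
exact: (@integral_derive_full _ _ _ B0 (dphiE y) (cdphi y) (phi0 y)).
Qed.

Section Divergence.
Variables (k : nat) (B : R) (o : option 'I_k.+1).
Implicit Types h : 'I_k.+1 -> 'rV[R]_k.+1 -> R^o.

Definition half_divergence h (x : 'rV[R]_k.+1) : R :=
  if side o x then \sum_j 'D_(delta_mx 0 j) (h j) x else 0.

Definition compact_C1 h : Prop := forall j,
  [/\ forall x, {for x, continuous (h j)}, forall x, derivable (h j) x (delta_mx 0 j),
      forall x, {for x, continuous ('D_(delta_mx 0 j) (h j))} & forall x, ~ cube B x -> h j x = 0].

Lemma half_divergence_le h : 0 < B -> compact_C1 h ->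
  (mu_rV k.+1).-integrable setT (EFin \o half_divergence h) /\
  (\int[mu_rV k.+1]_x (half_divergence h x)%:E <=
   \int[mu_rV k]_y (if o is Some i then `|h i (insert0 i y)| else 0)%:E)%E.
Proof.
move=> B0 hC.
pose g j x : R := if side o x then 'D_(delta_mx 0 j) (h j) x else 0.
have hj j : (mu_rV k.+1).-integrable setT (EFin \o g j) /\
  (\int[mu_rV k.+1]_x (g j x)%:E <=
   \int[mu_rV k]_y (if o == Some j then `|h j (insert0 j y)| else 0)%:E)%E.
  by have [a b c d] := hC j; exact: derive_along_le B0 a b c d.
have gE : EFin \o half_divergence h = (fun x => \sum_j (EFin \o g j) x)%E.
  apply/funext => x; rewrite sumEFin /= /half_divergence /g.
  by case: (side o x) => //; rewrite big1.
split.
  by rewrite gE; apply: integrable_sum => // j _; exact: (hj j).1.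
rewrite [X in (\int[_]_x X x <= _)%E]gE.
rewrite integral_sum//; last by move=> j; exact: (hj j).1.
apply: (@le_trans _ _ (\sum_j \int[mu_rV k]_y (if o == Some j then `|h j (insert0 j y)| else 0)%:E)%E).
  by apply: lee_sum => j _; exact: (hj j).2.
case: o => [i|]; last by rewrite big1 ?integral0// => j _; rewrite integral0.
rewrite (bigD1 i) //= eqxx big1 ?adde0// => j ij.
by rewrite (inj_eq Some_inj) eq_sym (negbTE ij) integral0.
Qed.

(** The one-sided bound is applied to the field and to its opposite. *)
Lemma abs_half_divergence_le h : 0 < B -> compact_C1 h ->
  (`|\int[mu_rV k.+1]_x (half_divergence h x)%:E| <=
   \int[mu_rV k]_y (if o is Some i then `|h i (insert0 i y)| else 0)%:E)%E.
Proof.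
move=> B0 hC; have [ih lh] := half_divergence_le B0 hC.
pose nh j x : R^o := - h j x.
have nC : compact_C1 nh.
  move=> j; have [a b c d] := hC j; split=> x.
  - exact: (@continuousN R R^o _ (h j) x (a x)).
  - exact: derivableN.
  - have -> : 'D_(delta_mx 0 j) (nh j) = fun z => - 'D_(delta_mx 0 j) (h j) z.
      by apply/funext => z; exact: deriveN.
    exact: (@continuousN R R^o _ ('D_(delta_mx 0 j) (h j)) x (c x)).
  - by move=> xB; rewrite /nh d// oppr0.
have [inh lnh] := half_divergence_le B0 nC.
have E : (fun x => (half_divergence nh x)%:E) = (fun x => - (half_divergence h x)%:E)%E.
  apply/funext => x; rewrite /half_divergence; case: (side o x); last by rewrite oppe0.
  rewrite -EFinN -sumrN; congr EFin; apply: eq_bigr => j _.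
  by have [_ b _ _] := hC j; exact: deriveN.
have F := integrable_fin_num measurableT ih.
move: lnh; rewrite E integralN ?fin_num_adde_defl//; last first.
  by rewrite fin_numN; exact: (integrable_neg_fin_num measurableT ih).
move: lh F => /=; set I := (\int[_]_x _)%E; set J := (\int[_]_y _)%E.
have -> : (\int[mu_rV k]_y (if o is Some i then `|nh i (insert0 i y)| else 0)%:E)%E = J.
  by apply: eq_integral => y _; case: o => // i; rewrite /nh normrN.
case: I => // I; case: J => [J| |] //; rewrite -?EFinN ?lee_fin /= ?leey// => ? _ ?.
by rewrite ler_norml; apply/andP; split; lra.
Qed.

End Divergence.

End BorelRows.

(** * Charts and the integrand on the manifold *)

Section ChartTheory.
Context {R : realType} {d : nat} {T : topologicalType}.
Implicit Types c : chart R d T.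

Lemma chart_codE c x : chart_cod c x -> chart_dom c (chart_inv c x) /\ chart_map c (chart_inv c x) = x.
Proof. by move=> [p cp <-]; rewrite chart_mapK. Qed.

Lemma chart_mem_cod c p : chart_dom c p -> chart_cod c (chart_map c p).
Proof. by move=> cp; exists p. Qed.

Lemma chart_overlapE c c' x :
  chart_overlap c c' x <-> chart_cod c x /\ chart_dom c' (chart_inv c x).
Proof.
split=> [[p [cp c'p] <-]|[cx c'x]]; first by rewrite chart_mapK//; split=> //; exists p.
by have [ci <-] := chart_codE cx; exists (chart_inv c x) => //; rewrite -(chart_codE cx).2.
Qed.

Lemma chart_overlap_mem c c' p : chart_dom c p -> chart_dom c' p -> chart_overlap c c' (chart_map c p).
Proof. by move=> cp c'p; exists p. Qed.

Lemma open_chart_preimage c W : open W -> open (chart_cod c `&` chart_inv c @^-1` W).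
Proof. by apply: open_preimage; [exact: chart_cod_open|exact: chart_inv_continuous]. Qed.

Lemma open_overlap c c' : open (chart_overlap c c').
Proof.
rewrite (_ : chart_overlap c c' = chart_cod c `&` chart_inv c @^-1` chart_dom c').
  exact/open_chart_preimage/chart_dom_open.
by apply/seteqP; split=> x; rewrite chart_overlapE.
Qed.

Lemma open_chart_cod c : open (chart_cod c).
Proof. exact: chart_cod_open. Qed.

Section Restrict.
Variables (c : chart R d T) (W : set T) (oW : open W).

Let restrict_cod_open : open (chart_map c @` (chart_dom c `&` W)).
Proof.
rewrite (_ : _ @` _ = chart_cod c `&` chart_inv c @^-1` W); first exact: open_chart_preimage.
apply/seteqP; split=> [_ [p [cp Wp] <-]|x [cx Wx]].
  by split; [exists p|rewrite /= chart_mapK].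
by have [ci E] := chart_codE cx; exists (chart_inv c x).
Qed.

Let restrict_inv_continuous x : (chart_map c @` (chart_dom c `&` W)) x ->
  {for x, continuous (chart_inv c)}.
Proof. by move=> [p [cp _] <-]; apply: chart_inv_continuous; exists p. Qed.

Definition restrict_chart : chart R d T :=
  @Chart R d T (chart_dom c `&` W) (chart_map c) (chart_inv c)
    (openI (chart_dom_open c) oW) restrict_cod_open
    (fun p cp => chart_mapK cp.1) (fun p cp => chart_map_continuous cp.1)
    restrict_inv_continuous.

End Restrict.

End ChartTheory.

Arguments open_overlap {R d T} c c'.
Arguments open_chart_cod {R d T} c.

Lemma det_left_neq0 (R : fieldType) n (A B : 'M[R]_n) : A *m B = 1%:M -> \det A != 0.
Proof. by move/mulmx1_unit => [+ _]; rewrite unitmxE unitfE. Qed.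

Section SmoothCharts.
Context {R : realType} {d : nat} (M : manifold R d).
Implicit Types c : chart R d M.

Lemma atlas_smooth_chart c : atlas c -> smooth_chart c.
Proof. by move=> cM c'; exact: atlas_compatible. Qed.

Lemma chart_at_smooth (p : M) : smooth_chart (chart_at p).
Proof. exact/atlas_smooth_chart/chart_at_atlas. Qed.

Lemma restrict_smooth_chart c (W : set M) (oW : open W) :
  smooth_chart c -> smooth_chart (restrict_chart c oW).
Proof.
move=> sc c' c'M; have [a b] := sc _ c'M; split=> k.
  by apply: Ck_sub (a k) => x /chart_overlapE[[p [cp Wp] <-] c'p]; apply/chart_overlapE; split=> //; exists p.
by apply: Ck_sub (b k) => x /chart_overlapE[c'x [cp Wp]]; apply/chart_overlapE.
Qed.

(** Charts of the maximal atlas are by definition compatible with charts of the given atlas only;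
    near each point the transition is factored through an atlas chart [a]. *)
Lemma smooth_transition c c' : smooth_chart c -> smooth_chart c' ->
  smooth_on (chart_overlap c c') (transition c c').
Proof.
move=> sc sc' k; apply: Ck_local => x /chart_overlapE[cx c'x].
set p := chart_inv c x in c'x; pose a := chart_at p.
have aM : atlas a := chart_at_atlas p.
pose U := chart_cod c `&` chart_inv c @^-1` (chart_dom c' `&` chart_dom a).
have oU : open U by apply: open_chart_preimage; apply: openI; exact: chart_dom_open.
exists U; split; first by split=> //; split=> //; exact: chart_at_dom.
have [ca _] := sc _ aM; have [_ ac'] := sc' _ aM.
apply: (Ck_ext (f := transition a c' \o transition c a)) => //.
  by move=> z [cz [_ az]]; rewrite /= /transition chart_mapK.
apply: (Ck_compmx oU (open_overlap a c')).
- move=> z [cz [c'z az]]; apply/chart_overlapE; split; first exact: chart_mem_cod.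
  by rewrite chart_mapK.
- by apply: Ck_sub (ca k) => z [cz [_ az]]; apply/chart_overlapE.
- exact: ac'.
Qed.

Lemma transition_jacobian c c' c'' x : smooth_chart c -> smooth_chart c' -> smooth_chart c'' ->
  chart_cod c x -> chart_dom c' (chart_inv c x) -> chart_dom c'' (chart_inv c x) ->
  'J (transition c c'') x = 'J (transition c c') x *m 'J (transition c' c'') (transition c c' x).
Proof.
move=> sc sc' sc'' cx c'x c''x; apply: row_mul_inj => v; rewrite mulmxA.
have D (a b : chart R d M) y : smooth_chart a -> smooth_chart b -> chart_overlap a b y -> differentiable (transition a b) y.
  by move=> sa sb; exact: (Ck_differentiable (k := 0) (open_overlap a b) (smooth_transition sa sb 1)).
have d1 : differentiable (transition c c') x by apply: D => //; exact/chart_overlapE.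
have d2 : differentiable (transition c' c'') (transition c c' x).
  by apply: D => //; apply/chart_overlapE; split; [exact: chart_mem_cod|rewrite /transition chart_mapK].
have d3 : differentiable (transition c c'') x by apply: D => //; exact/chart_overlapE.
have [_ E] := is_derive_chain (diff_derivable (v := v) d1) d2.
rewrite (deriveEjacobian _ d2) (deriveEjacobian _ d1) in E.
rewrite -E -(deriveEjacobian _ d3); apply: near_eq_derive.
apply: (near_open (open_overlap c c')); first exact/chart_overlapE.
by move=> z /chart_overlapE[cz c'z]; rewrite /= /transition chart_mapK.
Qed.

Lemma transition_id c x : smooth_chart c -> chart_cod c x -> 'J (transition c c) x = 1%:M.
Proof.
move=> sc cx; apply: row_mul_inj => v; rewrite mulmx1.
have E : \forall z \near x, id z = transition c c z.
  by apply: (near_open (open_chart_cod c) cx) => z /chart_codE[_]; rewrite /transition => ->.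
have dx : differentiable (transition c c) x.
  apply: (Ck_differentiable (k := 0) (open_overlap c c) (smooth_transition sc sc 1)).
  by apply/chart_overlapE; split=> //; exact: (chart_codE cx).1.
rewrite -(deriveEjacobian _ dx) -(near_eq_derive _ E).
exact: derive_id.
Qed.

Lemma transition_det_unit c c' x : smooth_chart c -> smooth_chart c' ->
  chart_overlap c c' x -> \det ('J (transition c c') x) != 0.
Proof.
move=> sc sc' /chart_overlapE[cx c'x]; have [ci _] := chart_codE cx.
exact: (det_left_neq0 (etrans (esym (transition_jacobian sc sc' sc cx c'x ci)) (transition_id sc cx))).
Qed.

End SmoothCharts.

Section LocalData.
Context {R : realType} {m d : nat}.
Variables (M : manifold R m.+1) (N : manifold R d).
Variables (g : riem_metric N) (w : diff_form N m.+1) (F : M -> N).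
Hypotheses (hw : closed_form w) (hF : immersion F).

Lemma form_local_multilinear b y : smooth_chart b -> chart_cod b y -> multilinear (w b y).
Proof.
move=> sb yb A i a u v; rewrite -[w b y (set_row i v A)]mul1r.
apply: (form_multilinear w sb yb (i := i)).
- by rewrite !row_set_row eqxx scale1r.
- by apply/row_matrixP => j; rewrite !row_row' !row_set_row eq_sym (negbTE (neq_lift _ _)).
- by apply/row_matrixP => j; rewrite !row_row' !row_set_row eq_sym (negbTE (neq_lift _ _)).
Qed.

Lemma form_local_alternating b y : smooth_chart b -> chart_cod b y -> alternating (w b y).
Proof. by move=> sb yb A i j; exact: form_alternate. Qed.

Lemma met_posdef b y : smooth_chart b -> chart_cod b y -> posdef (g b y).
Proof. by move=> sb yb; split; [exact: met_sym|exact: met_pos]. Qed.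

Lemma local_dataP c b : smooth_chart c -> smooth_chart b ->
  (forall p, chart_dom c p -> chart_dom b (F p)) ->
  local_data (chart_cod c) (chart_cod b) (local_map F c b) (g b) (w b).
Proof.
move=> sc sb cb; have [cF HF] := hF; have := HF c b sc sb => -[].
have -> : chart_map c @` (chart_dom c `&` F @^-1` chart_dom b) = chart_cod c.
  by apply/seteqP; split=> _ [p + <-]; [case|]; exists p => //; split=> //; exact: cb.
move=> sF rF; split=> //.
- exact: chart_cod_open.
- exact: chart_cod_open.
- by move=> x /chart_codE[cx _]; exact/chart_mem_cod/cb.
- exact: met_smooth.
- by move=> y; exact: met_posdef.
- by move=> A; exact: form_smooth.
- by move=> y; exact: form_local_multilinear.
- by move=> y; exact: form_local_alternating.
- by move=> y yb A; exact: (hw sb yb A).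
Qed.

End LocalData.

Lemma local_data_sub (R : realType) (m d : nat) (U U' : set 'rV[R]_m.+1) (V V' : set 'rV[R]_d) f G w :
  local_data U V f G w -> open U' -> open V' -> U' `<=` U -> V' `<=` V ->
  (forall x, U' x -> V' (f x)) -> local_data U' V' f G w.
Proof.
case=> oU oV UV sf rf sG pG sw ml al cl oU' oV' UU VV UV'; split=> //.
- by move=> k; apply: Ck_sub (sf k).
- by move=> x /UU; exact: rf.
- by move=> k; apply: Ck_sub (sG k).
- by move=> y /VV; exact: pG.
- by move=> A k; apply: Ck_sub (sw A k).
- by move=> y /VV; exact: ml.
- by move=> y /VV; exact: al.
- by move=> y /VV; exact: cl.
Qed.

Section Change.
Context {R : realType} {m d : nat}.
Variables (M : manifold R m.+1) (N : manifold R d).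
Variables (g : riem_metric N) (w : diff_form N m.+1) (F : M -> N).
Hypotheses (hw : closed_form w) (hF : immersion F).
Variables (c c' : chart R m.+1 M) (b b' : chart R d N).
Hypotheses (sc : smooth_chart c) (sc' : smooth_chart c') (sb : smooth_chart b) (sb' : smooth_chart b').
Hypotheses (cb : forall p, chart_dom c p -> chart_dom b (F p)).
Hypotheses (cb' : forall p, chart_dom c' p -> chart_dom b' (F p)).

Lemma chart_changeP :
  chart_change (chart_overlap c c') (chart_cod c') (chart_overlap b b') (chart_cod b')
    (transition c c') (transition b b')
    (local_map F c b) (g b) (w b) (local_map F c' b') (g b') (w b').
Proof.
split.
- apply: (local_data_sub (local_dataP g hw hF sc sb cb)).
  + exact: open_overlap.
  + exact: open_overlap.
  + by move=> x /chart_overlapE[].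
  + by move=> x /chart_overlapE[].
  + move=> x /chart_overlapE[cx c'x]; have [ci _] := chart_codE cx.
    by apply: chart_overlap_mem; [exact: cb|exact: cb'].
- exact: (local_dataP g hw hF sc' sb' cb').
- exact: smooth_transition.
- exact: smooth_transition.
- by move=> x /chart_overlapE[cx c'x]; exact: chart_mem_cod.
- by move=> x /chart_overlapE[cx c'x]; exact: chart_mem_cod.
- move=> x /chart_overlapE[cx c'x]; have [ci _] := chart_codE cx.
  by rewrite /local_map /transition !chart_mapK//; exact: cb.
- by move=> y yb; exact: (met_change g sb sb' yb).
- by move=> y yb A; exact: (form_change w sb sb' yb).
Qed.

End Change.

(** In the applications [K] is the Jacobian determinant of a transition, [g] and [g'] are Gram
    determinants, [D] is the determinant of the direct frame and [E], [E'] are coordinate densities: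
    the frame value times the volume density is the coordinate density up to the sign of [K]. *)
Lemma sg_mul_sqrt (R : rcfType) (K g g' D E E' : R) :
  g = K ^+ 2 * g' -> D * Num.sqrt g' = 1 -> E = K * E' ->
  E' * D * Num.sqrt g = Num.sg K * E.
Proof.
move=> -> Dg ->; rewrite sqrtrM ?sqr_ge0// sqrtr_sqr -mulrA [D * _]mulrCA Dg mulr1.
by rewrite mulrA -normrEsg mulrC.
Qed.

(** Squaring removes the sign of [K], so the square of the cosine of the angle is the same
    coordinate expression in every chart. *)
Lemma frame_value_sqr (R : rcfType) (K g g' D E E' V : R) :
  0 < g' -> K != 0 -> g = K ^+ 2 * g' -> D * Num.sqrt g' = 1 -> E = K * E' -> V = D * E' ->
  V ^+ 2 = E ^+ 2 / g.
Proof.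
move=> g0 K0 -> Dg -> ->.
have D2 : D ^+ 2 * g' = 1 by rewrite -(sqr_sqrtr (ltW g0)) -exprMn Dg expr1n.
have K2 : K ^+ 2 != 0 by rewrite expf_neq0.
apply: (mulIf (mulf_neq0 K2 (lt0r_neq0 g0))).
rewrite (divfK (mulf_neq0 K2 (lt0r_neq0 g0))) !exprMn.
transitivity (K ^+ 2 * E' ^+ 2 * (D ^+ 2 * g')); first by ring.
by rewrite D2 mulr1.
Qed.

Lemma posdef_det_gt0 (R : realType) n (h : 'M[R]_n) : posdef h -> 0 < \det h.
Proof.
move=> /orthonormal_frame[X [/det_frame XX X0]].
by rewrite -(pmulr_rgt0 _ (exprn_gt0 2 X0)) XX.
Qed.

Lemma posdef_ip_ge0 (R : realType) n (h : 'M[R]_n) u : posdef h -> 0 <= ip h u u.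
Proof.
move=> [_ hp]; have [->|/hp/ltW//] := eqVneq u 0.
by rewrite /ip !mul0mx mxE.
Qed.

Lemma det_congruence (R : comPzRingType) n (S h : 'M[R]_n) : \det (S *m h *m S^T) = \det S ^+ 2 * \det h.
Proof. by rewrite !det_mulmx det_tr mulrAC expr2. Qed.

(** * Geometric quantities read in an arbitrary chart *)

Section Pointwise.
Context {R : realType} {m d : nat}.
Variables (M : manifold R m.+1) (N : manifold R d).
Variables (g : riem_metric N) (w : diff_form N m.+1) (F : M -> N).
Hypotheses (hw : closed_form w) (hF : immersion F).

(* The value of d(rho H _| w) on a direct orthonormal frame. *)
Definition form_density (rho : M -> R) (p : M) : R :=
  let c := chart_at p in let b := chart_at (F p) in
  exterior_density (local_map F c b) (w b)
    (fun z => rho (chart_inv c z) *: mean_curvature (local_map F c b) (g b) z) (chart_map c p) *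
  \det (direct_frame (local_map F c b) (g b) (chart_map c p)).

(** One derivative is what the divergence theorem consumes, and what the bumps below provide. *)
Definition C1_function (rho : M -> R) : Prop :=
  forall c : chart R m.+1 M, smooth_chart c -> Ck 1 (chart_cod c) (fun z => rho (chart_inv c z) : R^o).

Let opre b : open (F @^-1` chart_dom (b : chart R d N)).
Proof. by have [cF _] := hF; apply: open_comp => [z _|]; [exact: cF|exact: chart_dom_open]. Qed.

(** [gram] picks a target chart at each point, which hides its regularity. Comparing two target
    charts, with the identity as source transition, shows that the matrix does not depend on the
    choice. *)
Lemma gramE c b x : smooth_chart c -> smooth_chart b ->
  (forall p, chart_dom c p -> chart_dom b (F p)) -> chart_cod c x ->
  gram g F c x = induced_gram (local_map F c b) (g b) x.
Proof.
move=> sc sb cb cx; have [cp xE] := chart_codE cx.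
set p := chart_inv c x in cp xE *; set e := chart_at (F p).
have se : smooth_chart e := chart_at_smooth _.
pose c0 := restrict_chart c (opre e).
have sc0 : smooth_chart c0 := restrict_smooth_chart (opre e) sc.
have c0p : chart_dom c0 p by split=> //; exact: chart_at_dom.
have C := chart_changeP g hw hF sc0 sc se sb (fun q h => h.2) cb.
have ov : chart_overlap c0 c x by apply/chart_overlapE; split; [exists p|].
have := gram_change C ov.
rewrite (_ : 'J (transition c0 c) x = 1%:M); last exact: (transition_id sc cx).
by rewrite mul1mx trmx1 mulmx1 (_ : transition c0 c x = x).
Qed.

Section At.
Variables (c : chart R m.+1 M) (b : chart R d N) (p : M).
Hypotheses (sc : smooth_chart c) (sb : smooth_chart b).
Hypotheses (cb : forall p, chart_dom c p -> chart_dom b (F p)) (cp : chart_dom c p).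

Let a := chart_at p.
Let e := chart_at (F p).
(** [chart_at p] is shrunk so that [F] maps its domain into [chart_at (F p)], as the local theory
    requires; coordinates are unchanged. *)
Let c' := restrict_chart a (opre e).
Let f := local_map F c b.
Let f' := local_map F c' e.
Let x := chart_map c p.
Let x' := chart_map a p.
Let s := transition c c'.
Let se : smooth_chart e := chart_at_smooth _.
Let sc' : smooth_chart c' := restrict_smooth_chart (opre e) (chart_at_smooth p).
Let c'p : chart_dom c' p := conj (chart_at_dom p) (chart_at_dom (F p)).
Let cx : chart_cod c x := chart_mem_cod cp.
Let c'x : chart_cod c' x' := chart_mem_cod c'p.
Let ov : chart_overlap c c' x := chart_overlap_mem cp c'p.
Let sx : s x = x'.
Proof. by rewrite /s /transition chart_mapK. Qed.
Let L := local_dataP g hw hF sc sb cb.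
Let L' := local_dataP g hw hF sc' se (fun q h => h.2).
Let C := chart_changeP g hw hF sc sc' sb se cb (fun q h => h.2).

(** Its sign compares the orientation of [c] with that of the positive chart at [p]. As [chart_at p]
    varies with [p], the sign is constant on a patch but the value need not be. *)
Definition chart_det : R := \det ('J (transition c (chart_at p)) (chart_map c p)).

Lemma chart_det_neq0 : chart_det != 0.
Proof. exact: (transition_det_unit sc sc' ov). Qed.

Lemma gram_det_change : \det (gram g F c x) = chart_det ^+ 2 * \det (induced_gram f' (g e) x').
Proof.
apply: etrans (congr1 determinant (gramE sc sb cb cx)) _.
apply: etrans (congr1 determinant (gram_change C ov)) _.
apply: etrans (det_congruence _ _) _.
exact: (f_equal (fun z => chart_det ^+ 2 * \det (induced_gram f' (g e) z)) sx).
Qed.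

Lemma frame_det : \det (direct_frame f' (g e) x') * Num.sqrt (\det (induced_gram f' (g e) x')) = 1.
Proof. by have [X1 X2] := direct_frameP L' c'x; exact: det_frame_sqrt. Qed.

Lemma form_density_chart rho : C1_function rho ->
  form_density rho p * Num.sqrt (\det (gram g F c x)) =
  Num.sg chart_det * exterior_density f (w b)
    (fun z => rho (chart_inv c z) *: mean_curvature f (g b) z) x.
Proof.
move=> rhoC; apply: (sg_mul_sqrt gram_det_change frame_det).
pose P z := rho (chart_inv c z) *: mean_curvature f (g b) z.
pose P' z := rho (chart_inv c' z) *: mean_curvature f' (g e) z.
have dP : differentiable P x.
  apply: (Ck_differentiable (k := 0) (open_chart_cod c) _ cx).
  apply: Ck_scalemx; [exact: open_chart_cod|exact: rhoC|exact: (smooth_mean_curvature L 1)].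
have dP' : differentiable P' (s x).
  rewrite sx; apply: (Ck_differentiable (k := 0) (open_chart_cod c') _ c'x).
  apply: Ck_scalemx; [exact: open_chart_cod|exact: rhoC|exact: (smooth_mean_curvature L' 1)].
have := exterior_density_change C ov _ dP dP'; rewrite -/s sx; apply.
apply: (near_open (open_overlap c c') ov) => z ovz.
rewrite /P /P' -scalemxAl (mean_curvature_change C ovz).
have [cz c'z] := (chart_overlapE c c' z).1 ovz.
by congr (rho _ *: _); rewrite /transition; exact: (chart_mapK c'z).
Qed.

Lemma nablaH_Omega_chart :
  nablaH_Omega g w F p * Num.sqrt (\det (gram g F c x)) =
  Num.sg chart_det * covderiv_form (g b) (w b) (f x) (mean_curvature f (g b) x) ('J f x).
Proof.
have -> : nablaH_Omega g w F p = covderiv_form (g e) (w e) (f' x') (mean_curvature f' (g e) x') ('J f' x')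
    * \det (direct_frame f' (g e) x').
  rewrite mulrC; exact: (covderiv_form_mul L' _ _ _ (ld_maps L' c'x)).
apply: (sg_mul_sqrt gram_det_change frame_det).
apply: etrans (covderiv_form_change C (mean_curvature f (g b) x) ov) _.
apply: (f_equal (fun z => chart_det * z)).
apply: etrans (f_equal (fun z => covderiv_form (g e) (w e) (f' (s x)) z ('J f' (s x))) (mean_curvature_change C ov)) _.
exact: (f_equal (fun z => covderiv_form (g e) (w e) (f' z) (mean_curvature f' (g e) z) ('J f' z)) sx).
Qed.

Hypothesis comass : comass_one g w.

Lemma form_on_frame_le1 : -1 <= form_on_frame f' (g e) (w e) x' <= 1.
Proof.
rewrite -ler_norml; have [H _] := comass se (ld_maps L' c'x); apply: H.
have [X1 _] := direct_frameP L' c'x; rewrite /orthonormal_rows.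
by rewrite -X1 /induced_gram trmx_mul !mulmxA.
Qed.

Lemma normH_sqr : normH g F p ^+ 2 = ip (g b (f x)) (mean_curvature f (g b) x) (mean_curvature f (g b) x).
Proof.
rewrite (mean_curvature_norm_change C ov) -/s sx /normH /mean_curvature_norm sqr_sqrtr//.
exact: posdef_ip_ge0 (ld_posdef L' (ld_maps L' c'x)).
Qed.

Lemma form_on_frame_sqr :
  form_on_frame f' (g e) (w e) x' ^+ 2 = (w b (f x) ('J f x)) ^+ 2 / \det (gram g F c x).
Proof.
apply: (frame_value_sqr _ chart_det_neq0 gram_det_change frame_det (E' := w e (f' x') ('J f' x'))).
- exact/posdef_det_gt0/(gram_posdef L').
- apply: etrans (form_jacobian_change C ov) _.
  exact: (f_equal (fun z => chart_det * w e (f' z) ('J f' z)) sx).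
- apply: alternating_mul; [exact: ld_multilinear L' _ (ld_maps L' c'x)|exact: ld_alternating L' _ (ld_maps L' c'x)].
Qed.

(** The left side uses [acos] and a frame picked at each point; the right side is built from
    continuous coordinate expressions. The identity sin (acos x) = sqrt (1 - x^2) requires |x| <= 1,
    which is comass one. *)
Lemma boundary_integrand :
  sin (Omega_angle g w F p) * normH g F p =
  Num.sqrt (1 - (w b (f x) ('J f x)) ^+ 2 / \det (gram g F c x)) *
  Num.sqrt (ip (g b (f x)) (mean_curvature f (g b) x) (mean_curvature f (g b) x)).
Proof.
rewrite -normH_sqr sqrtr_sqr ger0_norm ?sqrtr_ge0// -form_on_frame_sqr.
by rewrite -sin_acos// form_on_frame_le1.
Qed.

Lemma form_density1 :
  form_density (fun=> 1) p =
  - (m.+1)%:R * cos (Omega_angle g w F p) * normH g F p ^+ 2 + nablaH_Phi g w F p + nablaH_Omega g w F p.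
Proof.
have -> : cos (Omega_angle g w F p) = form_on_frame f' (g e) (w e) x'.
  by apply: acosK; rewrite in_itv /= form_on_frame_le1.
have -> : normH g F p ^+ 2 = ip (g e (f' x')) (mean_curvature f' (g e) x') (mean_curvature f' (g e) x').
  by rewrite sqr_sqrtr//; exact: posdef_ip_ge0 (ld_posdef L' (ld_maps L' c'x)).
apply: etrans (divergence_formula L' c'x).
have E : (fun z => 1 *: mean_curvature f' (g e) z) = mean_curvature f' (g e).
  by apply/funext => z; exact: scale1r.
exact: (f_equal (fun Q => exterior_density f' (w e) Q x' * \det (direct_frame f' (g e) x')) E).
Qed.

End At.

End Pointwise.

(** * Integration in charts *)

Lemma max0_mul (R : realDomainType) (a j x : R) : 0 <= a -> 0 <= j ->
  a * Num.max x 0 * j = Num.max (a * x * j) 0.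
Proof.
move=> a0 j0; rewrite mulrAC [a * x * j]mulrAC maxr_pMr ?mulr_ge0// mulr0//.
Qed.

Section SignedTransfer.
Context d1 d2 (T : measurableType d1) (X : measurableType d2) (R : realType).
Variables (nu : {measure set T -> \bar R}) (mu : {measure set X -> \bar R}).
Variables (e : X -> T) (J : X -> R) (B : set T).
Hypotheses (me : measurable_fun setT e) (mJ : measurable_fun setT J).
Hypotheses (J0 : forall x, 0 <= J x) (mB : measurable B).
Hypothesis nuE : forall A, measurable A -> A `<=` B ->
  nu A = (\int[mu]_x (\1_A (e x) * J x)%:E)%E.

Lemma integral_transfer (f : T -> R) : measurable_fun setT f ->
  (\int[nu]_(p in B) (f p)%:E = \int[mu]_x (\1_B (e x) * f (e x) * J x)%:E)%E.
Proof.
move=> mf; rewrite integralE [RHS]integralE.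
have mf' : measurable_fun setT (EFin \o f) by exact/measurable_EFinP.
have mJ' : measurable_fun setT (EFin \o J) by exact/measurable_EFinP.
have J0' x : (0 <= (EFin \o J) x)%E by rewrite lee_fin.
congr (_ - _)%E.
- rewrite (ge0_integral_transfer me mJ' J0' mB nuE)//; last exact: measurable_funepos.
  apply: eq_integral => x _; rewrite !funeposE /= -!EFin_max -!EFinM.
  by rewrite max0_mul.
- rewrite (ge0_integral_transfer me mJ' J0' mB nuE)//; last exact: measurable_funeneg.
  apply: eq_integral => x _; rewrite !funenegE /= -!EFin_max -!EFinM.
  by rewrite max0_mul// mulrN mulNr.
Qed.

End SignedTransfer.

Section Parametrized.
Context {R : realType} {T : ptopologicalType} {k : nat}.
Variables (Y : set 'rV[R]_k) (e : 'rV[R]_k -> T) (J : 'rV[R]_k -> R).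
Hypotheses (oY : open Y) (ce : forall y, Y y -> {for y, continuous e}).
Hypotheses (cJ : forall y, Y y -> {for y, continuous (J : _ -> R^o)}) (J0 : forall y, Y y -> 0 <= J y).
Notation Rv := (g_sigma_algebraType (@open 'rV[R]_k)).
Notation bT := (g_sigma_algebraType (@open T)).

(** [e] and [J] are regular on [Y] only. They are restricted to [Y] with default values outside,
    where the new density vanishes and the arbitrary value of the parametrization has no weight. *)
Lemma integral_parametrized (nu : {measure set bT -> \bar R}) (B : set bT) (f : T -> R) :
  measurable B ->
  (forall A : set bT, measurable A -> A `<=` B ->
    nu A = lebesgue_int (fun y => (\1_(Y `&` e @^-1` A) y * J y)%:E)) ->
  measurable_fun setT (f : bT -> R) ->
  (\int[nu]_(p in B) (f p)%:E =
   \int[mu_rV k]_y (\1_(Y `&` e @^-1` B) y * f (e y) * J y)%:E)%E.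
Proof.
move=> mB nuE mf; have mY : measurable (Y : set Rv) by exact: sub_sigma_algebra.
pose e' : Rv -> bT := (e : Rv -> bT) \_ Y; pose J' : Rv -> R := (J : Rv -> R) \_ Y.
have me' : measurable_fun setT e'.
  by apply/(measurable_restrictT (e : Rv -> bT) mY); exact: borel_measurable_fun.
have mJ' : measurable_fun setT J'.
  by apply/(measurable_restrictT (J : Rv -> R) mY); exact: borel_measurable_real.
have J'0 y : 0 <= J' y.
  by rewrite /J' patchE; case: ifPn => // /set_mem; exact: J0.
have E (A : set bT) (h : T -> R) y : \1_A (e' y) * h (e' y) * J' y = \1_(Y `&` e @^-1` A) y * h (e y) * J y.
  rewrite /e' /J' !patchE; case: ifPn => yY.
    by rewrite !indicE in_setI yY /=; congr (_%:R * _ * _); apply: asbool_equiv_eq.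
  by rewrite [\1_(Y `&` _) y]indicE in_setI (negbTE yY) /= mul0r mul0r; exact: mulr0.
rewrite (integral_transfer (mu := mu_rV k) me' mJ' J'0 mB _ mf); last first.
  move=> A mA AB; rewrite nuE//.
  have EA : (fun y => (\1_(Y `&` e @^-1` A) y * J y)%:E) = (fun y => (\1_A (e' y) * J' y)%:E).
    by apply/funext => y; have := E A (fun=> 1) y; rewrite !mulr1 => ->.
  rewrite EA lebesgue_intE//.
  - apply/measurable_EFinP; apply: measurable_funM => //.
    by apply: measurableT_comp => //.
  - by move=> y; rewrite lee_fin mulr_ge0.
by apply: eq_integral => y _; rewrite E.
Qed.

End Parametrized.

Section ChartIntegrals.
Context {R : realType} {m d : nat}.
Variables (M : manifold R m.+1) (N : manifold R d).
Variables (g : riem_metric N) (w : diff_form N m.+1) (F : M -> N).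
Hypotheses (hw : closed_form w) (hF : immersion F).
Variables (c : chart R m.+1 M) (b : chart R d N).
Hypotheses (sc : smooth_chart c) (sb : smooth_chart b).
Hypotheses (cb : forall p, chart_dom c p -> chart_dom b (F p)).

Let L := local_dataP g hw hF sc sb cb.

Definition volume_density x : R := Num.sqrt (\det (gram g F c x)).
Definition area_density i x : R := Num.sqrt (\det (row' i (col' i (gram g F c x)))).

Lemma Ck_gram k : Ck k (chart_cod c) (gram g F c).
Proof.
apply: (Ck_ext (open_chart_cod c) _ (smooth_gram L k)) => x cx.
exact: (esym (gramE g hw hF sc sb cb cx)).
Qed.

Lemma volume_density_gt0 x : chart_cod c x -> 0 < volume_density x.
Proof.
move=> cx; rewrite sqrtr_gt0 (gramE g hw hF sc sb cb cx).
exact/posdef_det_gt0/(gram_posdef L).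
Qed.

Lemma continuous_volume_density x : chart_cod c x -> {for x, continuous (volume_density : _ -> R^o)}.
Proof.
move=> cx; apply: (@continuous_comp _ _ _ (fun x => \det (gram g F c x) : R^o) (@Num.sqrt R)).
  exact: (Ck_continuous (Ck_det (open_chart_cod c) (Ck_gram 0)) cx).
exact: sqrt_continuous.
Qed.

Lemma continuous_area_density i x : chart_cod c x -> {for x, continuous (area_density i : _ -> R^o)}.
Proof.
move=> cx; apply: (@continuous_comp _ _ _ (fun x => \det (row' i (col' i (gram g F c x))) : R^o) (@Num.sqrt R)).
  apply: (Ck_continuous (k := 0) _ cx); apply: Ck_det; first exact: open_chart_cod.
  apply/Ck_mxP => [|a a']; first exact: open_chart_cod.
  have E : (fun x => row' i (col' i (gram g F c x)) a a' : R^o) = fun x => gram g F c x (lift i a) (lift i a').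
    by apply/funext => z; rewrite !mxE.
  by rewrite E; apply: Ck_entry; [exact: open_chart_cod|exact: Ck_gram].
exact: sqrt_continuous.
Qed.

Lemma chart_image_preimage (A : set M) : A `<=` chart_dom c ->
  chart_map c @` A = chart_cod c `&` chart_inv c @^-1` A.
Proof.
move=> Ac; apply/seteqP; split=> [_ [p Ap <-]|x [cx Ax]].
  by split; [exists p => //; exact: Ac|rewrite /= chart_mapK//; exact: Ac].
by exists (chart_inv c x) => //; rewrite (chart_codE cx).2.
Qed.

Lemma volume_integral (vol : {measure set (borel M) -> \bar R}) (E : set (borel M)) (phi : M -> R) :
  is_volume_measure g F vol -> measurable E -> measurable_fun setT (phi : borel M -> R) ->
  (\int[vol]_(p in chart_dom c `&` E) (phi p)%:E =
   \int[mu_rV m.+1]_x (\1_(chart_cod c `&` chart_inv c @^-1` E) x *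
      phi (chart_inv c x) * volume_density x)%:E)%E.
Proof.
move=> hvol mE mphi; have mc : measurable (chart_dom c : set (borel M)).
  by apply: sub_sigma_algebra; exact: chart_dom_open.
rewrite (integral_parametrized (open_chart_cod c) (e := chart_inv c) (J := volume_density)); first last.
- exact: mphi.
- move=> A mA Ac; rewrite (hvol c sc A mA (fun p Ap => (Ac p Ap).1)).
  by rewrite -(chart_image_preimage (fun p Ap => (Ac p Ap).1)).
- exact: measurableI.
- by move=> x cx; exact: ltW (volume_density_gt0 cx).
- exact: continuous_volume_density.
- exact: chart_inv_continuous.
have -> // : chart_cod c `&` chart_inv c @^-1` (chart_dom c `&` E) = chart_cod c `&` chart_inv c @^-1` E.
apply/seteqP; split=> x [cx]; first by case.
by move=> Ex; split=> //; split=> //; exact: (chart_codE cx).1.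
Qed.

Lemma continuous_insert0 (i : 'I_m.+1) (y : 'rV[R]_m) : {for y, continuous (@insert0 R m i)}.
Proof.
apply/continuous_mxP => a j; rewrite (_ : (fun x => _) = fun x : 'rV[R]_m => if unlift i j is Some l then x 0 l else 0 : R^o); last first.
  by apply/funext => z; rewrite (ord1 a) mxE.
by case: unlift => [l|]; [exact: coord_continuous|exact: cst_continuous].
Qed.

Lemma area_integral (D : set M) (area : {measure set (borel M) -> \bar R}) i (phi : M -> R) :
  is_boundary_measure g F D area -> straightens D c i -> measurable (bdry D : set (borel M)) ->
  measurable_fun setT (phi : borel M -> R) ->
  (\int[area]_(p in chart_dom c `&` bdry D) (phi p)%:E =
   \int[mu_rV m]_y (\1_[set y | chart_cod c (insert0 i y) /\ bdry D (chart_inv c (insert0 i y))] y *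
      phi (chart_inv c (insert0 i y)) * area_density i (insert0 i y))%:E)%E.
Proof.
move=> harea sD mbD mphi; have mc : measurable (chart_dom c : set (borel M)).
  by apply: sub_sigma_algebra; exact: chart_dom_open.
pose Y : set 'rV[R]_m := [set y | chart_cod c (insert0 i y)].
have oY : open Y.
  rewrite (_ : Y = setT `&` insert0 i @^-1` chart_cod c); last by rewrite setTI.
  apply: open_preimage; [exact: openT|by move=> y _; exact: continuous_insert0|exact: open_chart_cod].
rewrite (integral_parametrized oY (e := chart_inv c \o insert0 i) (J := area_density i \o insert0 i)); first last.
- exact: mphi.
- move=> A mA Ac; rewrite (harea c i sD A mA Ac).
  by rewrite (chart_image_preimage (fun p Ap => (Ac p Ap).1)).
- exact: measurableI.
- by move=> y _; exact: sqrtr_ge0.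
- by move=> y cy; apply: continuous_comp; [exact: continuous_insert0|exact: continuous_area_density].
- by move=> y cy; apply: continuous_comp; [exact: continuous_insert0|exact: chart_inv_continuous].
have -> // : Y `&` (chart_inv c \o insert0 i) @^-1` (chart_dom c `&` bdry D) =
  [set y | chart_cod c (insert0 i y) /\ bdry D (chart_inv c (insert0 i y))].
apply/seteqP; split=> x [cx]; first by case.
by move=> Ex; split=> //; split=> //; exact: (chart_codE cx).1.
Qed.

End ChartIntegrals.

Lemma sg_mul_pos (R : realDomainType) (D D' E K : R) :
  E = D' * K -> 0 < K -> 0 < Num.sg D * D' -> Num.sg E = Num.sg D.
Proof.
move=> -> K0; rewrite sgrM (gtr0_sg K0) mulr1; case: (sgrP D) => // _.
- by rewrite mul0r ltxx.
- by rewrite mul1r => /gtr0_sg.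
- by rewrite mulN1r oppr_gt0 => /ltr0_sg.
Qed.

Lemma eq_divr (R : numFieldType) (x y v : R) : 0 < v -> x * v = y -> x = y / v.
Proof. by move=> v0 <-; rewrite mulfK// gt_eqF. Qed.

Lemma continuous_div (R : realType) (T : topologicalType) (f h : T -> R^o) x :
  {for x, continuous f} -> h x != 0 -> {for x, continuous h} -> {for x, continuous (fun z => f z / h z : R^o)}.
Proof. by move=> cf h0 ch; apply: (@continuousM R _ f (fun z => (h z)^-1)) => //; exact: (@continuousV R). Qed.

Definition box (R : realType) k (a : 'rV[R]_k) (r : R) : set 'rV[R]_k :=
  [set x | forall i, `|x 0 i - a 0 i| <= r].

Lemma compact_box (R : realType) k (a : 'rV[R]_k) (r : R) : compact (box a r).
Proof.
rewrite (_ : box a r = [set v : 'rV[R]_k | forall i, `[a 0 i - r, a 0 i + r]%classic (v ord0 i)]).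
  by apply: (@rV_compact R k (fun i => `[a 0 i - r, a 0 i + r]%classic)) => i; exact: segment_compact.
by apply/seteqP; split=> v h i; have := h i; rewrite /= in_itv /= ler_distl.
Qed.

Lemma closed_box (R : realType) k (a : 'rV[R]_k) (r : R) : closed (box a r).
Proof. by apply: compact_closed; [exact: norm_hausdorff|exact: compact_box]. Qed.

Lemma box_sub_cube (R : realType) k (a : 'rV[R]_k) (r : R) :
  exists B, 0 < B /\ box a r `<=` cube B.
Proof.
exists (`|a| + `|r| + 1); split; first by rewrite ltr_wpDl// addr_ge0.
move=> x h i; have := h i; have := coord_le_norm a 0 i; have := ler_norm r.
have := ler_normD (x 0 i - a 0 i) (a 0 i); rewrite subrK; lra.
Qed.

(** * Extension by zero and regularity of local expressions *)

Section ExtendByZero.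
Context {R : realType} {k : nat}.
Variables (U K : set 'rV[R]_k).
Hypotheses (oU : open U) (cK : closed K) (KU : K `<=` U).

Definition zero_extend (h : 'rV[R]_k -> R) (x : 'rV[R]_k) : R^o := if `[<U x>] then h x else 0.

Lemma zero_extendE h x : U x -> zero_extend h x = h x.
Proof. by move=> Ux; rewrite /zero_extend asboolT. Qed.

Lemma zero_extend0 h x : (forall x, U x -> ~ K x -> h x = 0) -> ~ K x -> zero_extend h x = 0.
Proof.
move=> h0 Kx; rewrite /zero_extend; case: ifP => // /asboolP Ux; exact: h0.
Qed.

(** [U] and the complement of [K] are open and cover the space, since [K] is closed and contained in
    [U]; on the complement the extension is 0. *)
Lemma Ck_zero_extend n (h : 'rV[R]_k -> R^o) : (forall x, U x -> ~ K x -> h x = 0) ->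
  Ck n U h -> Ck n setT (zero_extend h).
Proof.
move=> h0 Ch; apply: Ck_local => x _; have [Ux|Ux] := pselect (U x).
  exists U; split=> //; apply: (Ck_ext oU _ Ch) => z Uz.
  by rewrite zero_extendE.
exists (~` K); split; first by move=> /KU.
apply: (Ck_ext (closed_openC cK) _ (Ck_cst n (~` K) (0 : R^o))) => z Kz.
exact: (esym (zero_extend0 h0 Kz)).
Qed.

End ExtendByZero.

Section LocalRegularity.
Context {R : realType} {m d : nat}.
Notation e_ i := (delta_mx 0 i).
Variables (U : set 'rV[R]_m.+1) (V : set 'rV[R]_d).
Variables (f : 'rV[R]_m.+1 -> 'rV[R]_d) (G : 'rV[R]_d -> 'M[R]_d).
Variable w : 'rV[R]_d -> 'M[R]_(m.+1, d) -> R.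
Hypothesis L : local_data U V f G w.

Let oU := ld_openU L.
Let UV := ld_maps L.

Lemma Ck_form k (A : 'rV[R]_m.+1 -> 'M[R]_(m.+1, d)) :
  Ck k U A -> Ck k U (fun x => w (f x) (A x) : R^o).
Proof.
move=> CA; pose Q (h : {ffun 'I_m.+1 -> 'I_d}) : 'M[R]_(m.+1, d) := \matrix_i row (h i) 1%:M.
apply: (Ck_ext (f := fun x => \sum_(h : {ffun 'I_m.+1 -> 'I_d}) (\prod_i A x i (h i)) * w (f x) (Q h) : R^o)) => //.
  move=> x Ux; rewrite -[A x in RHS]mulmx1; apply: esym.
  exact: (multilinear_expand (A x) 1%:M (ld_multilinear L (UV Ux))).
apply: Ck_sum => // h _; apply: CkM => //; first by apply: Ck_prod => // i _; exact: Ck_entry.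
exact: (Ck_comp oU (ld_openV L) UV (ld_map L k) (ld_form L (Q h) k)).
Qed.

Lemma Ck_local_jacobian k : Ck k U (jacobian f).
Proof. by apply: Ck_jacobian => //; exact: ld_map L k.+1. Qed.

Lemma Ck_set_row k j (P : 'rV[R]_m.+1 -> 'rV[R]_d) :
  Ck k U P -> Ck k U (fun x => set_row j (P x) ('J f x)).
Proof.
move=> CP; apply/Ck_mxP => // i l.
have -> : (fun x => set_row j (P x) ('J f x) i l : R^o) =
    fun x => if i == j then P x 0 l else 'J f x i l.
  by apply/funext => x; rewrite mxE; case: (i == j) => //; rewrite mxE.
case: (i == j); first exact: Ck_entry.
by apply: Ck_entry => //; exact: Ck_local_jacobian.
Qed.

(* Up to signs, the components of the pull-back of P _| w. *)
Definition current (P : 'rV[R]_m.+1 -> 'rV[R]_d) j x : R^o := w (f x) (set_row j (P x) ('J f x)).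

Lemma Ck_current k P j : Ck k U P -> Ck k U (current P j).
Proof. by move=> CP; apply: Ck_form; exact: Ck_set_row. Qed.

Lemma exterior_density_current P x : Ck 1 U P -> U x ->
  exterior_density f w P x = \sum_j 'D_(e_ j) (current P j) x.
Proof.
move=> CP Ux; have dP : \forall z \near x, differentiable P z.
  by apply: (near_open oU Ux) => z; exact: (Ck_differentiable (k := 0) oU CP).
exact: (exterior_density_div L Ux dP).2.
Qed.

Lemma continuous_exterior_density P x : Ck 1 U P -> U x ->
  {for x, continuous (exterior_density f w P : _ -> R^o)}.
Proof.
move=> CP Ux; apply: (near_eq_continuous (f := fun x => \sum_j 'D_(e_ j) (current P j) x : R^o)).
  by apply: (near_open oU Ux) => z Uz; exact: (esym (exterior_density_current CP Uz)).
apply: continuous_at_sum => j.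
exact: (Ck_continuous (Ck_derive j (Ck_current j CP)) Ux).
Qed.

(** The covariant derivative is read off from [exterior_densityE] as the exterior density minus a
    polarization, two expressions whose continuity comes from that of form values on moving
    vectors. *)
Lemma continuous_covderiv_form x : U x ->
  {for x, continuous (fun x => covderiv_form G w (f x) (mean_curvature f G x) ('J f x) : R^o)}.
Proof.
move=> Ux; have CH := smooth_mean_curvature L.
pose P z := \matrix_i covderiv f G z (e_ i) (mean_curvature f G).
apply: (near_eq_continuous (f := fun x => exterior_density f w (mean_curvature f G) x
   - polarize (w (f x)) ('J f x) (P x) : R^o)).
  apply: (near_open oU Ux) => z Uz.
  have dH := mean_curvature_differentiable L Uz.
  by rewrite (exterior_densityE L Uz dH) addrK.
apply: (@continuousB R R^o); first by apply: continuous_exterior_density.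
apply: continuous_at_sum => i.
apply: (Ck_continuous (k := 0) _ Ux); apply: Ck_form; apply: Ck_set_row.
have -> : (fun z => row i (P z)) = fun z => covderiv f G z (e_ i) (mean_curvature f G).
  by apply/funext => z; exact: rowK.
apply: (Ck_addmx oU (Ck_derive i (CH 1%N))).
apply: (Ck_christoffel L _ (CH 0%N)).
exact: (Ck_mulmx oU (Ck_cst _ _ _) (Ck_local_jacobian 0)).
Qed.

End LocalRegularity.

(** * Patches on which the orientation sign is constant *)

Section OrientedPatch.
Context {R : realType} {m d : nat}.
Variables (M : manifold R m.+1) (N : manifold R d).
Variables (g : riem_metric N) (w : diff_form N m.+1) (F : M -> N).
Hypotheses (hw : closed_form w) (hF : immersion F) (hM : oriented M).

(** [eps] compares the orientation of [c] with that of [M], uniformly over the domain. Being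
    constant, it comes out of the integral, where [op_bound] disposes of it. *)
Record oriented_patch (c : chart R m.+1 M) (b : chart R d N) (eps : R) : Prop := OrientedPatch {
  op_source : smooth_chart c;
  op_target : smooth_chart b;
  op_maps : forall p, chart_dom c p -> chart_dom b (F p);
  op_sign : forall p, chart_dom c p -> Num.sg (chart_det c p) = eps;
  op_bound : `|eps| <= 1 }.

(** Near [p] the determinant of the transition from [c] to the fixed chart [a] keeps its sign by
    continuity; at another point q, [chart_at q] differs from [a] by a positive determinant, both
    being charts of the oriented atlas. *)
Lemma oriented_patch_exists (c : chart R m.+1 M) (W : set M) p :
  smooth_chart c -> open W -> W p -> chart_dom c p ->
  exists (W' : set M) (oW' : open W') b eps,
    [/\ oriented_patch (restrict_chart c oW') b eps, W' p & W' `<=` W].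
Proof.
move=> sc oW Wp cp; pose a := chart_at p; pose b := chart_at (F p).
have sa : smooth_chart a := chart_at_smooth p.
pose D (q : M) : R := \det ('J (transition c a) (chart_map c q)).
pose eps := Num.sg (D p).
have ap : chart_dom a p := chart_at_dom p.
have D0 q : chart_dom c q -> chart_dom a q -> D q != 0.
  by move=> cq aq; apply: transition_det_unit => //; exact: chart_overlap_mem.
pose W1 := (chart_dom c `&` chart_dom a) `&` (fun q => eps * D q) @^-1` [set z | 0 < z].
have oW1 : open W1.
  apply: open_preimage; first by apply: openI; exact: chart_dom_open.
    move=> q [cq aq].
    apply: (@continuous_comp _ _ _ (chart_map c) (fun x => eps * \det ('J (transition c a) x) : R^o)).
      exact: chart_map_continuous.
    apply: (@continuousM R); first exact: cst_continuous.
    apply: (Ck_continuous (k := 0) (U := chart_overlap c a)); last exact: chart_overlap_mem.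
    apply: Ck_det; first exact: open_overlap.
    by apply: Ck_jacobian; [exact: open_overlap|exact: (smooth_transition sc sa 1)].
  exact: open_gt.
have W1p : W1 p by split=> //=; rewrite /eps -normrEsg normr_gt0 D0.
have oF : open (F @^-1` chart_dom b).
  by have [cF _] := hF; apply: open_comp => [z _|]; [exact: cF|exact: chart_dom_open].
have oW' : open (W `&` W1 `&` F @^-1` chart_dom b) by apply: openI => //; exact: openI.
exists (W `&` W1 `&` F @^-1` chart_dom b), oW', b, eps; split; last 2 first.
- by split=> //; exact: chart_at_dom.
- by move=> q [[]].
split; last by rewrite normr_sg lern1; case: (D p != 0).
- exact: restrict_smooth_chart.
- exact: chart_at_smooth.
- by move=> q [_ []].
move=> q [cq [[_ [[_ aq] /= Dq]] _]].
pose e := chart_at q.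
have E : chart_det c q = D q * \det ('J (transition a e) (chart_map a q)).
  have cx := chart_mem_cod cq.
  have H := transition_jacobian sc sa (chart_at_smooth q) cx.
  have mk := chart_mapK cq.
  have H1 : chart_dom a (chart_inv c (chart_map c q)) by rewrite mk.
  have H2 : chart_dom e (chart_inv c (chart_map c q)) by rewrite mk; exact: chart_at_dom.
  apply: etrans (congr1 determinant (H H1 H2)) _.
  apply: etrans (det_mulmx _ _) _.
  have sq : transition c a (chart_map c q) = chart_map a q by rewrite /transition mk.
  exact: (f_equal (fun z => D q * \det ('J (transition a e) z)) sq).
have Epos : 0 < \det ('J (transition a e) (chart_map a q)).
  apply: hM; [exact: chart_at_atlas|exact: chart_at_atlas|].
  by apply: chart_overlap_mem => //; exact: chart_at_dom.
exact: (sg_mul_pos E Epos Dq).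
Qed.

Lemma continuous_via_chart (T : topologicalType) (c : chart R m.+1 M) (phi : M -> T) p : chart_dom c p ->
  {for chart_map c p, continuous (phi \o chart_inv c)} -> {for p, continuous phi}.
Proof.
move=> cp cphi.
apply: (near_eq_continuous (f := (phi \o chart_inv c) \o chart_map c)).
  by apply: (near_open (chart_dom_open c) cp) => q cq; rewrite /= chart_mapK.
by apply: continuous_comp => //; exact: chart_map_continuous.
Qed.

Section InPatch.
Variables (c : chart R m.+1 M) (b : chart R d N) (eps : R).
Hypothesis P : oriented_patch c b eps.

Let sc := op_source P.
Let sb := op_target P.
Let cb := op_maps P.
Let f := local_map F c b.
Let H := mean_curvature f (g b).
Let L := local_dataP g hw hF sc sb cb.

Lemma form_density_at rho p x : C1_function rho -> chart_dom c p -> chart_map c p = x ->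
  form_density g w F rho p * volume_density g F c x =
  eps * exterior_density f (w b) (fun z => rho (chart_inv c z) *: H z) x.
Proof.
move=> rhoC cp <-; rewrite -(op_sign P cp).
exact: (form_density_chart g hw hF sc sb cb cp rhoC).
Qed.

Lemma nablaH_Omega_at p x : chart_dom c p -> chart_map c p = x ->
  nablaH_Omega g w F p * volume_density g F c x = eps * covderiv_form (g b) (w b) (f x) (H x) ('J f x).
Proof.
move=> cp <-; rewrite -(op_sign P cp).
exact: (nablaH_Omega_chart g hw hF sc sb cb cp).
Qed.

Hypothesis comass : comass_one g w.

Lemma boundary_integrand_at p x : chart_dom c p -> chart_map c p = x ->
  sin (Omega_angle g w F p) * normH g F p =
  Num.sqrt (1 - (w b (f x) ('J f x)) ^+ 2 / \det (gram g F c x)) * Num.sqrt (ip (g b (f x)) (H x) (H x)).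
Proof. by move=> cp <-; exact: (boundary_integrand hw hF sc sb cb cp comass). Qed.

Lemma gram_det_neq0 x : chart_cod c x -> \det (gram g F c x) != 0.
Proof.
move=> cx; have := volume_density_gt0 g hw hF sc sb cb cx.
by rewrite /volume_density sqrtr_gt0 => /lt0r_neq0.
Qed.

Lemma Ck_scaled rho : C1_function rho -> Ck 1 (chart_cod c) (fun z => rho (chart_inv c z) *: H z).
Proof.
move=> rhoC; apply: Ck_scalemx; [exact: open_chart_cod|exact: (rhoC c sc)|exact: (smooth_mean_curvature L 1)].
Qed.

(** The definition uses another chart and another frame at each point. In a patch the density is
    [eps] times a continuous coordinate expression divided by the positive volume density. *)
Lemma continuous_form_density_patch rho p : C1_function rho -> chart_dom c p ->
  {for p, continuous (form_density g w F rho : M -> R^o)}.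
Proof.
move=> rhoC cp; have cx := chart_mem_cod cp.
apply: (continuous_via_chart cp).
apply: (near_eq_continuous (f := fun x => eps * exterior_density f (w b) (fun z => rho (chart_inv c z) *: H z) x
    / volume_density g F c x : R^o)).
  apply: (near_open (open_chart_cod c) cx) => z cz; have [ci E] := chart_codE cz.
  apply: esym; exact: (eq_divr (volume_density_gt0 g hw hF sc sb cb cz) (form_density_at rhoC ci E)).
have cv := (continuous_volume_density (g := g) hw hF sc sb cb cx).
apply: (continuous_div _ _ cv).
  apply: (@continuousM R); first exact: cst_continuous.
  exact: (continuous_exterior_density L (Ck_scaled rhoC) cx).
by rewrite gt_eqF// (volume_density_gt0 g hw hF sc sb cb cx).
Qed.

Lemma continuous_nablaH_Omega_patch p : chart_dom c p ->
  {for p, continuous (nablaH_Omega g w F : M -> R^o)}.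
Proof.
move=> cp; have cx := chart_mem_cod cp.
apply: (continuous_via_chart cp).
apply: (near_eq_continuous (f := fun x => eps * covderiv_form (g b) (w b) (f x) (H x) ('J f x)
    / volume_density g F c x : R^o)).
  apply: (near_open (open_chart_cod c) cx) => z cz; have [ci E] := chart_codE cz.
  apply: esym; exact: (eq_divr (volume_density_gt0 g hw hF sc sb cb cz) (nablaH_Omega_at ci E)).
have cv := (continuous_volume_density (g := g) hw hF sc sb cb cx).
apply: (continuous_div _ _ cv).
  apply: (@continuousM R); first exact: cst_continuous.
  exact: (continuous_covderiv_form L cx).
by rewrite gt_eqF// (volume_density_gt0 g hw hF sc sb cb cx).
Qed.

Lemma continuous_boundary_integrand_patch p : chart_dom c p ->
  {for p, continuous (fun p => sin (Omega_angle g w F p) * normH g F p : R^o)}.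
Proof.
move=> cp; have cx := chart_mem_cod cp; have ou := open_chart_cod c.
apply: (continuous_via_chart cp).
apply: (near_eq_continuous (f := fun x => Num.sqrt (1 - (w b (f x) ('J f x)) ^+ 2 / \det (gram g F c x)) *
   Num.sqrt (ip (g b (f x)) (H x) (H x)) : R^o)).
  apply: (near_open ou cx) => z cz; have [ci E] := chart_codE cz.
  exact: (esym (boundary_integrand_at ci E)).
have CW : Ck 0 (chart_cod c) (fun x => w b (f x) ('J f x) : R^o).
  exact: (Ck_form L (Ck_local_jacobian L 0)).
have CH := smooth_mean_curvature L 0.
have CG : Ck 0 (chart_cod c) (fun x => g b (f x)).
  exact: (Ck_compmx ou (open_chart_cod b) (ld_maps L) (ld_map L 0) (ld_metric L 0)).
apply: (@continuousM R).
  apply: (@continuous_comp _ _ _ (fun x => 1 - (w b (f x) ('J f x)) ^+ 2 / \det (gram g F c x) : R^o) (@Num.sqrt R));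
    last exact: sqrt_continuous.
  apply: (@continuousB R R^o); first exact: cst_continuous.
  apply: continuous_div.
  - apply: (Ck_continuous (k := 0) _ cx); exact: (CkM ou CW CW).
  - exact: (gram_det_neq0 cx).
  - exact: (Ck_continuous (Ck_det ou (Ck_gram g hw hF sc sb cb 0)) cx).
apply: (@continuous_comp _ _ _ (fun x => ip (g b (f x)) (H x) (H x) : R^o) (@Num.sqrt R));
  last exact: sqrt_continuous.
exact: (Ck_continuous (Ck_ip ou CG CH CH) cx).
Qed.

End InPatch.

Lemma patch_at (p : M) : exists c b eps, oriented_patch c b eps /\ chart_dom c p.
Proof.
have [W' [oW' [b [eps [P W'p _]]]]] :=
  oriented_patch_exists (chart_at_smooth p) openT (I : setT p) (chart_at_dom p).
by exists (restrict_chart (chart_at p) oW'), b, eps; split=> //; split=> //; exact: chart_at_dom.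
Qed.

Lemma continuous_form_density rho p : C1_function rho ->
  {for p, continuous (form_density g w F rho : M -> R^o)}.
Proof. by have [c [b [eps [P cp]]]] := patch_at p => rhoC; exact: (continuous_form_density_patch P). Qed.

Lemma continuous_nablaH_Omega p : {for p, continuous (nablaH_Omega g w F : M -> R^o)}.
Proof. by have [c [b [eps [P cp]]]] := patch_at p; exact: (continuous_nablaH_Omega_patch P). Qed.

Lemma continuous_boundary_integrand p : comass_one g w ->
  {for p, continuous (fun p => sin (Omega_angle g w F p) * normH g F p : R^o)}.
Proof. by have [c [b [eps [P cp]]]] := patch_at p => comass; exact: (continuous_boundary_integrand_patch P). Qed.

End OrientedPatch.

Lemma compact_indic_integrable (R : realType) k (U K : set 'rV[R]_k) (B : R) (h : 'rV[R]_k -> R^o)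
    (S : set (g_sigma_algebraType (@open 'rV[R]_k))) :
  open U -> closed K -> K `<=` U -> K `<=` cube B -> (forall x, U x -> ~ K x -> h x = 0) ->
  Ck 0 U h -> measurable S -> S `<=` U ->
  (mu_rV k).-integrable setT (fun x => (\1_S x * h x)%:E).
Proof.
move=> oU cK KU KB h0 Ch mS SU.
have [cZ _] := Ck_zero_extend oU cK KU h0 Ch.
have Z0 x : ~ cube B x -> zero_extend U h x = 0.
  by move=> xB; apply: (zero_extend0 h0) => xa; apply: xB; exact: KB.
have [C HC] := compact_support_bounded (fun x => cZ x I) Z0.
have E1 : (fun x => (\1_S x * h x)%:E) = EFin \o (fun x => \1_S x * zero_extend U h x : R).
  apply/funext => x /=; have [Ux|Ux] := pselect (U x); first by rewrite zero_extendE.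
  by rewrite indicE memNset ?mul0r// => /SU.
rewrite E1; apply: (@bounded_support_integrable R _ (g_sigma_algebraType (@open 'rV[R]_k)) (mu_rV k)
  (cube B) (fun x => \1_S x * zero_extend U h x : R) `|C|).
- exact: measurable_cube.
- exact: mu_rV_cube.
- apply: measurable_funM; first exact: measurable_indic.
  by apply: borel_measurable_real => [|x _]; [exact: openT|exact: cZ].
- move=> x; rewrite normrM indicE; case: (_ \in _); rewrite ?normr1 ?mul1r ?normr0 ?mul0r//.
  by rewrite (le_trans (HC x))// ler_norm.
- by move=> x xB; rewrite Z0 ?mulr0.
Qed.

(** * The Stokes estimate for a density supported in one patch *)

Section PatchEstimate.
Context {R : realType} {m d : nat}.
Variables (M : manifold R m.+1) (N : manifold R d).
Variables (g : riem_metric N) (w : diff_form N m.+1) (F : M -> N).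
Hypotheses (hw : closed_form w) (hF : immersion F) (hM : oriented M).
Variables (c : chart R m.+1 M) (b : chart R d N) (eps : R).
Hypothesis P : oriented_patch F c b eps.
Variables (a : 'rV[R]_m.+1) (r : R).
Hypothesis boxc : box a r `<=` chart_cod c.

Notation e_ i := (delta_mx 0 i).
Let sc := op_source P.
Let sb := op_target P.
Let cb := op_maps P.
Let f := local_map F c b.
Let H := mean_curvature f (g b).
Let L := local_dataP g hw hF sc sb cb.
Let ou := open_chart_cod c.

Definition supported (phi : M -> R) : Prop :=
  forall p, phi p <> 0 -> chart_dom c p /\ box a r (chart_map c p).

Lemma supported_off phi x : supported phi -> chart_cod c x -> ~ box a r x -> phi (chart_inv c x) = 0.
Proof.
move=> sp cx xa; apply: contrapT => /sp[]; by rewrite (chart_codE cx).2.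
Qed.

(** The box is compact, so its image is compact, hence closed in the Hausdorff space [M]. Thus [phi]
    vanishes on a neighbourhood even of points at the edge of the chart domain, about which the
    chart itself says nothing. *)
Lemma supported_near phi p : supported phi -> ~ (chart_dom c p /\ box a r (chart_map c p)) ->
  \forall q \near p, phi q = 0.
Proof.
move=> sp np; have KC : compact (chart_inv c @` box a r).
  apply: continuous_compact; last exact: compact_box.
  by apply: continuous_in_subspaceT => x /set_mem /boxc cx; exact: chart_inv_continuous.
have oK : open (~` (chart_inv c @` box a r)).
  by apply: closed_openC; apply: compact_closed KC; exact: manifold_hausdorff.
apply: (near_open oK) => [[x xa E]|q qK].
  by apply: np; rewrite -E; have [] := chart_codE (boxc xa) => ? ->.
apply: contrapT => /sp[cq qa]; apply: qK; exists (chart_map c q) => //.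
exact: chart_mapK.
Qed.

(** Where [rho] vanishes near [p], so do the currents and their derivatives. The point may lie
    outside [c], so this is read in a patch around [p]. *)
Lemma supported_form_density rho : C1_function rho -> supported rho ->
  supported (form_density g w F rho).
Proof.
move=> rhoC srho p; apply: contra_notP => np; have near0 := supported_near srho np.
have [c1 [b1 [e1 [P1 c1p]]]] := patch_at hF hM p.
have := form_density_at g hw hF P1 rhoC c1p erefl.
have c1x := chart_mem_cod c1p.
pose L1 := local_dataP g hw hF (op_source P1) (op_target P1) (op_maps P1).
rewrite (exterior_density_current L1 (Ck_scaled g hw hF P1 rhoC) c1x) big1; last first.
  move=> j _; apply: etrans (near_eq_derive _ (g := fun=> 0 : R^o) _) (derive_cst _ _ _).
  have near1 : \forall z \near chart_map c1 p, rho (chart_inv c1 z) = 0.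
    have ci := chart_inv_continuous c1x; rewrite /prop_for /continuous_at (chart_mapK c1p) in ci.
    exact: ci near0.
  have near2 : \forall z \near chart_map c1 p, chart_cod c1 z by exact: near_open (open_chart_cod c1) c1x _.
  apply: filterS2 near1 near2 => z rz cz; rewrite /current rz scale0r.
  exact: (multilinear0 (ld_multilinear L1 (ld_maps L1 cz))).
rewrite mulr0 => /eqP; rewrite mulf_eq0 => /orP[/eqP//|].
by rewrite gt_eqF// (volume_density_gt0 g hw hF (op_source P1) (op_target P1) (op_maps P1) c1x).
Qed.

Section Volume.
Variable vol : {measure set (borel M) -> \bar R}.
Hypothesis hvol : is_volume_measure g F vol.
Variable phi : M -> R.
Hypotheses (cphi : forall p, {for p, continuous (phi : M -> R^o)}) (sphi : supported phi).

Let mphi : measurable_fun setT (phi : borel M -> R).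
Proof. by apply: borel_measurable_real => [|p _]; [exact: openT|exact: cphi]. Qed.

Lemma supported_volume_integral (E : set (borel M)) : measurable E ->
  (\int[vol]_(p in E) (phi p)%:E =
   \int[mu_rV m.+1]_x (\1_(chart_cod c `&` chart_inv c @^-1` E) x *
      phi (chart_inv c x) * volume_density g F c x)%:E)%E.
Proof.
move=> mE; rewrite -(volume_integral hw hF sc sb cb hvol mE mphi).
rewrite integral_mkcond [RHS]integral_mkcond; congr integral; apply/funext => p.
rewrite !patchE [p \in chart_dom c `&` _]in_setI; have [cp|cp] := pselect (chart_dom c p); first by rewrite (mem_set cp).
rewrite (memNset cp) /=; case: ifP => // _; congr EFin.
by apply: contrapT => /sphi[].
Qed.

Lemma chart_integrand_integrable (E : set (borel M)) : measurable E ->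
  (mu_rV m.+1).-integrable setT (fun x => (\1_(chart_cod c `&` chart_inv c @^-1` E) x *
      phi (chart_inv c x) * volume_density g F c x)%:E).
Proof.
move=> mE; pose h x : R^o := phi (chart_inv c x) * volume_density g F c x.
have h0 x : chart_cod c x -> ~ box a r x -> h x = 0.
  by move=> cx xa; rewrite /h (supported_off sphi cx xa) mul0r.
have Ch : Ck 0 (chart_cod c) h.
  split=> // x cx; apply: (@continuousM R).
    apply: continuous_comp; [exact: chart_inv_continuous|exact: cphi].
  exact: (continuous_volume_density (g := g) hw hF sc sb cb cx).
have [B [B0 aB]] := box_sub_cube a r.
have mS : measurable (chart_cod c `&` chart_inv c @^-1` E : set (g_sigma_algebraType (@open 'rV[R]_m.+1))).
  have mi := borel_measurable_fun ou (fun x cx => chart_inv_continuous cx).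
  by apply: mi => //; apply: sub_sigma_algebra.
have := compact_indic_integrable ou (closed_box (a := a) (r := r)) boxc aB h0 Ch mS (@subIsetl _ _ _).
by rewrite /h; under [in X in _ -> X]eq_fun do rewrite -mulrA.
Qed.

End Volume.

Lemma supported_integrable (vol : {measure set (borel M) -> \bar R}) (phi : M -> R) (E : set (borel M)) :
  is_volume_measure g F vol -> (forall p, {for p, continuous (phi : M -> R^o)}) -> supported phi ->
  measurable E -> vol.-integrable E (EFin \o phi).
Proof.
move=> hvol cphi sphi mE; apply/integrableP; split.
  apply/measurable_EFinP; apply: measurable_funTS.
  by apply: borel_measurable_real => [|p _]; [exact: openT|exact: cphi].
have cn p : {for p, continuous ((fun p => `|phi p|) : M -> R^o)}.
  by apply: (@continuous_comp _ _ _ phi (fun x : R => `|x|)); [exact: cphi|exact: norm_continuous].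
have sn : supported (fun p => `|phi p|).
  by move=> p np; apply: sphi => p0; apply: np; rewrite p0 normr0.
rewrite (eq_integral (fun p : borel M => (`|phi p|)%:E))//.
rewrite (supported_volume_integral hvol cn sn mE).
exact: integrable_lty (chart_integrand_integrable cn sn mE).
Qed.

Section Divergence.
Variables (rho : M -> R) (D : set M) (o : option 'I_m.+1).
Hypotheses (rhoC : C1_function rho) (srho : supported rho) (oD : open D).
Hypothesis hside : forall p, chart_dom c p -> (D p <-> side o (chart_map c p)).

Let Q z := rho (chart_inv c z) *: H z.
Let CQ : Ck 1 (chart_cod c) Q := Ck_scaled g hw hF P rhoC.

(** Extended by zero, the current is a field on the whole Euclidean space, as the divergence theorem
    requires. *)
Definition patch_current j : 'rV[R]_m.+1 -> R^o :=
  zero_extend (chart_cod c) (current f (w b) Q j).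

Lemma current_off_box j x : chart_cod c x -> ~ box a r x -> current f (w b) Q j x = 0.
Proof.
move=> cx xa; rewrite /current /Q (supported_off srho cx xa) scale0r.
exact: (multilinear0 (ld_multilinear L (ld_maps L cx))).
Qed.

Lemma Ck_patch_current j : Ck 1 setT (patch_current j).
Proof.
apply: (Ck_zero_extend ou (closed_box (a := a) (r := r)) boxc (@current_off_box j)).
exact: (Ck_current L).
Qed.

Lemma patch_current_compact B : box a r `<=` cube B -> compact_C1 B patch_current.
Proof.
move=> aB j; have CJ := Ck_patch_current j; split=> [x|x|x|x xB].
- exact: (Ck_continuous CJ).
- exact: (Ck_derivable (i := j) CJ I).
- exact: (Ck_continuous (Ck_derive j CJ)).
- by apply: (zero_extend0 (@current_off_box j)) => xa; apply: xB; exact: aB.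
Qed.

Lemma patch_divergence x :
  \1_(chart_cod c `&` chart_inv c @^-1` D) x * form_density g w F rho (chart_inv c x) *
    volume_density g F c x = eps * half_divergence o patch_current x.
Proof.
(* Off the chart the left side is 0 through the indicator, and the right side because the current
   vanishes near any point outside the box. *)
have [cx|cx] := pselect (chart_cod c x); last first.
  rewrite indicE memNset ?mul0r; last by case.
  rewrite /half_divergence; case: (side o x); rewrite ?mulr0 ?mul0r// big1 ?mulr0// => j _.
  apply: etrans (near_eq_derive _ (g := fun=> 0 : R^o) _) (derive_cst _ _ _).
  have xa : (~` box a r) x by move=> /boxc.
  apply: (near_open (closed_openC (closed_box (a := a) (r := r))) xa) => z za.
  exact: (zero_extend0 (@current_off_box j)).
have [ci xE] := chart_codE cx.
rewrite -mulrA (form_density_at g hw hF P rhoC ci xE).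
rewrite (exterior_density_current L CQ cx) /half_divergence.
have -> : \1_(chart_cod c `&` chart_inv c @^-1` D) x = (side o x)%:R :> R.
  rewrite indicE; congr (_%:R); congr nat_of_bool; apply/idP/idP => [/set_mem[_ /(hside ci)]|sx].
    by rewrite xE.
  by apply/mem_set; split=> //; apply/(hside ci); rewrite xE.
case: (side o x); last by rewrite mul0r mulr0.
rewrite mul1r; congr (_ * _); apply: eq_bigr => j _; apply: near_eq_derive.
by apply: (near_open ou cx) => z cz; rewrite /patch_current zero_extendE.
Qed.

Lemma form_density_integral_le (vol : {measure set (borel M) -> \bar R}) : is_volume_measure g F vol ->
  (`|\int[vol]_(p in D) (form_density g w F rho p)%:E| <=
   \int[mu_rV m]_y (if o is Some i then `|patch_current i (insert0 i y)| else 0)%:E)%E.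
Proof.
move=> hvol; have mD : measurable (D : set (borel M)) by exact: sub_sigma_algebra.
rewrite (supported_volume_integral hvol
  (fun p => continuous_form_density hw hF hM (p := p) rhoC) (supported_form_density rhoC srho) mD).
rewrite (eq_integral (fun x : g_sigma_algebraType (@open 'rV[R]_m.+1) =>
  eps%:E * (half_divergence o patch_current x)%:E)%E); last first.
  by move=> x _; rewrite patch_divergence EFinM.
have [B [B0 aB]] := box_sub_cube a r.
have hC := patch_current_compact aB.
have [ih _] := half_divergence_le o B0 hC.
rewrite integralZl//.
rewrite abseM; apply: (@le_trans _ _ (`|\int[mu_rV m.+1]_x (half_divergence o patch_current x)%:E|)%E).
  rewrite -[leRHS]mul1e lee_wpmul2r// abse_EFin lee_fin.
  exact: op_bound P.
exact: (abs_half_divergence_le o B0 hC).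
Qed.

(** [comass_normal_bound] applied to the normal vector H; the nonnegative factor [rho] comes out by
    linearity in the replaced row. *)
Lemma current_bound i x : comass_one g w -> (forall p, 0 <= rho p) -> chart_cod c x ->
  `|current f (w b) Q i x| <= rho (chart_inv c x) *
    (sin (Omega_angle g w F (chart_inv c x)) * normH g F (chart_inv c x)) * area_density g F c i x.
Proof.
move=> comass rho0 cx; have [ci xE] := chart_codE cx.
have wl := ld_multilinear L (ld_maps L cx); have wa := ld_alternating L (ld_maps L cx).
rewrite /current /Q (multilinearZ wl) normrM ger0_norm// -mulrA ler_wpM2l//.
rewrite (boundary_integrand_at hw hF P comass ci xE) [_ * Num.sqrt (ip _ _ _)]mulrC.
have [X1 X2] := direct_frameP L cx.
have [cm _] := comass b sb _ (ld_maps L cx).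
have gE := gramE g hw hF sc sb cb cx.
have := comass_normal_bound i wl wa (ld_posdef L (ld_maps L cx)) cm (ld_immersion L cx) X1
  (mean_curvature_normal L cx).
rewrite /area_density gE.
have E : w b (f x) (direct_frame f (g b) x *m 'J f x) ^+ 2 =
    w b (f x) ('J f x) ^+ 2 / \det (induced_gram f (g b) x).
  (* Frame and density are taken in the same chart, hence the transition determinant 1. *)
  apply: (frame_value_sqr (K := 1) (posdef_det_gt0 (gram_posdef L cx)) (oner_neq0 _) _
    (det_frame_sqrt X1 X2) _ (alternating_mul _ _ wl wa)).
    by rewrite expr1n mul1r.
  by rewrite mul1r.
by rewrite E.
Qed.

End Divergence.

Section Area.
Variables (D : set M) (i : 'I_m.+1) (area : {measure set (borel M) -> \bar R}).
Hypotheses (oD : open D) (sD : straightens D c i) (harea : is_boundary_measure g F D area).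

(** [straightens] tells which points of the chart lie in [D], not which lie in its closure. A point
    of the face x_i = 0 is approached from inside through the points with x_i = -e/2. *)
Lemma boundary_point y : chart_cod c (insert0 i y) -> bdry D (chart_inv c (insert0 i y)).
Proof.
move=> cy; have [ci yE] := chart_codE cy; set p := chart_inv c (insert0 i y) in ci yE *.
have i0 : insert0 i y 0 i = 0 := insert_at i 0 y.
split; last by move/(sD.2 p ci).1; rewrite yE i0 ltxx.
move=> A pA.
have cins : {for 0, continuous (fun t : R => insert i t y)}.
  apply/continuous_mxP => k j.
  have -> : (fun t => insert i t y k j : R^o) = fun t : R => if unlift i j is Some l then y 0 l else t.
    by apply/funext => t; rewrite (ord1 k) mxE.
  by case: unlift => [l|]; [exact: cst_continuous|exact: cvg_id].
have nA : \forall t \near (0 : R), A (chart_inv c (insert i t y)).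
  exact: (continuous_comp cins (chart_inv_continuous cy)) A pA.
have nc : \forall t \near (0 : R), chart_cod c (insert i t y).
  exact: cins _ (open_nbhs_nbhs (conj ou cy)).
have [e /= e0 He] := filterI nA nc.
have [|At ct] := He (- (e / 2)).
  by rewrite /= sub0r opprK gtr0_norm ?divr_gt0// ltr_pdivrMr// ltr_pMr// ltr1n.
have [ci' yE'] := chart_codE ct.
exists (chart_inv c (insert i (- (e / 2)) y)); split=> //.
by apply/(sD.2 _ ci'); rewrite yE' insert_at oppr_lt0 divr_gt0.
Qed.

Lemma measurable_bdry : measurable (bdry D : set (borel M)).
Proof.
apply: measurableD; last exact: sub_sigma_algebra.
rewrite -[closure D]setCK; apply: measurableC; apply: sub_sigma_algebra.
exact/closed_openC/closed_closure.
Qed.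

Variable phi : M -> R.
Hypotheses (cphi : forall p, {for p, continuous (phi : M -> R^o)}) (sphi : supported phi).

Let mphi : measurable_fun setT (phi : borel M -> R).
Proof. by apply: borel_measurable_real => [|p _]; [exact: openT|exact: cphi]. Qed.

Let Y : set 'rV[R]_m := [set y | chart_cod c (insert0 i y)].

Lemma supported_area_integral :
  (\int[area]_(p in bdry D) (phi p)%:E =
   \int[mu_rV m]_y (\1_Y y * phi (chart_inv c (insert0 i y)) * area_density g F c i (insert0 i y))%:E)%E.
Proof.
have -> : Y = [set y | chart_cod c (insert0 i y) /\ bdry D (chart_inv c (insert0 i y))].
  apply/seteqP; split=> [y cy|y []//]; split=> //; exact: boundary_point.
rewrite -(area_integral hw hF sc sb cb harea sD measurable_bdry mphi).
rewrite integral_mkcond [RHS]integral_mkcond; congr integral; apply/funext => p.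
rewrite !patchE [p \in chart_dom c `&` _]in_setI; have [cp|cp] := pselect (chart_dom c p); first by rewrite (mem_set cp).
rewrite (memNset cp) /=; case: ifP => // _; congr EFin.
by apply: contrapT => /sphi[].
Qed.

Lemma area_integrand_integrable :
  (mu_rV m).-integrable setT (fun y =>
    (\1_Y y * phi (chart_inv c (insert0 i y)) * area_density g F c i (insert0 i y))%:E).
Proof.
have cins y : {for y, continuous (@insert0 R m i)} := @continuous_insert0 R m i y.
have oY : open Y.
  rewrite (_ : Y = setT `&` insert0 i @^-1` chart_cod c); last by rewrite setTI.
  by apply: open_preimage; [exact: openT|move=> y _; exact: cins|exact: ou].
pose K : set 'rV[R]_m := insert0 i @^-1` box a r.
have cK : closed K by apply: closed_comp => [y _|]; [exact: cins|exact: closed_box].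
have KY : K `<=` Y by move=> y /boxc.
have [B [B0 aB]] := box_sub_cube a r.
have KB : K `<=` cube B.
  move=> y /aB h j; have := h (lift i j); rewrite (_ : insert0 i y = insert i 0 y)//.
  by rewrite insert_off.
pose h y : R^o := phi (chart_inv c (insert0 i y)) * area_density g F c i (insert0 i y).
have h0 y : Y y -> ~ K y -> h y = 0.
  by move=> cy ya; rewrite /h (supported_off sphi cy ya) mul0r.
have Ch : Ck 0 Y h.
  split=> // y cy; apply: (@continuousM R).
    apply: (@continuous_comp _ _ _ (insert0 i) (phi \o chart_inv c)) => //.
    apply: continuous_comp; [exact: chart_inv_continuous|exact: cphi].
  apply: (@continuous_comp _ _ _ (insert0 i) (area_density g F c i)) => //.
  exact: (continuous_area_density (g := g) hw hF sc sb cb).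
have mY : measurable (Y : set (g_sigma_algebraType (@open 'rV[R]_m))) by exact: sub_sigma_algebra.
have := compact_indic_integrable oY cK KY KB h0 Ch mY (@subset_refl _ _).
by rewrite /h; under [in X in _ -> X]eq_fun do rewrite -mulrA.
Qed.

End Area.

Lemma supported_area_integrable (D : set M) i (area : {measure set (borel M) -> \bar R}) (phi : M -> R) :
  open D -> straightens D c i -> is_boundary_measure g F D area ->
  (forall p, {for p, continuous (phi : M -> R^o)}) -> supported phi ->
  area.-integrable (bdry D) (EFin \o phi).
Proof.
move=> oD sD harea cphi sphi; apply/integrableP; split.
  apply/measurable_EFinP; apply: measurable_funTS.
  by apply: borel_measurable_real => [|p _]; [exact: openT|exact: cphi].
have cn p : {for p, continuous ((fun p => `|phi p|) : M -> R^o)}.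
  by apply: (@continuous_comp _ _ _ phi (fun x : R => `|x|)); [exact: cphi|exact: norm_continuous].
have sn : supported (fun p => `|phi p|).
  by move=> p np; apply: sphi => p0; apply: np; rewrite p0 normr0.
rewrite (eq_integral (fun p : borel M => (`|phi p|)%:E))//.
rewrite (supported_area_integral oD sD harea cn sn).
exact: integrable_lty (area_integrand_integrable i cn sn).
Qed.

Lemma C1_function_continuous (rho : M -> R) p : C1_function rho -> {for p, continuous (rho : M -> R^o)}.
Proof.
move=> rhoC; apply: (continuous_via_chart (chart_at_dom p)).
exact: (Ck_continuous (rhoC _ (chart_at_smooth p)) (chart_mem_cod (chart_at_dom p))).
Qed.

Lemma patch_current_boundary_le (rho : M -> R) (D : set M) i (area : {measure set (borel M) -> \bar R}) :
  C1_function rho -> supported rho -> (forall p, 0 <= rho p) -> comass_one g w ->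
  open D -> straightens D c i -> is_boundary_measure g F D area ->
  (\int[mu_rV m]_y (`|patch_current rho i (insert0 i y)|)%:E <=
   \int[area]_(p in bdry D) (rho p * (sin (Omega_angle g w F p) * normH g F p))%:E)%E.
Proof.
move=> rhoC srho rho0 comass oD sD harea.
pose phi p := rho p * (sin (Omega_angle g w F p) * normH g F p).
have cphi p : {for p, continuous (phi : M -> R^o)}.
  apply: (@continuousM R); first exact: C1_function_continuous.
  exact: continuous_boundary_integrand.
have sphi : supported phi by move=> p; rewrite /phi => np; apply: srho => r0; apply: np; rewrite r0 mul0r.
rewrite (supported_area_integral oD sD harea cphi sphi).
apply: ge0_le_integral => //.
- by apply/measurable_EFinP; apply: measurableT_comp; [exact: normr_measurable|];
    apply: borel_measurable_real => [|y _]; [exact: openT|];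
    apply: continuous_comp; [exact: continuous_insert0|exact: (Ck_continuous (Ck_patch_current rhoC srho i))].
- exact: measurable_int (area_integrand_integrable i cphi sphi).
move=> y _; rewrite lee_fin; have [cy|cy] := pselect (chart_cod c (insert0 i y)).
  rewrite indicE mem_set// mul1r /patch_current zero_extendE//.
  exact: current_bound.
by rewrite indicE memNset// !mul0r /patch_current /zero_extend asboolF// normr0.
Qed.

Lemma boundary_integrand_ge0 p : comass_one g w -> 0 <= sin (Omega_angle g w F p) * normH g F p.
Proof.
have [c1 [b1 [e1 [P1 cp]]]] := patch_at hF hM p => comass.
by rewrite (boundary_integrand_at hw hF P1 comass cp erefl) mulr_ge0 ?sqrtr_ge0.
Qed.

Lemma patch_estimate (rho : M -> R) (D : set M) (o : option 'I_m.+1)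
    (vol area : {measure set (borel M) -> \bar R}) :
  C1_function rho -> supported rho -> (forall p, 0 <= rho p) -> comass_one g w ->
  open D -> (forall p, chart_dom c p -> (D p <-> side o (chart_map c p))) ->
  is_volume_measure g F vol -> is_boundary_measure g F D area ->
  (`|\int[vol]_(p in D) (form_density g w F rho p)%:E| <=
   \int[area]_(p in bdry D) (rho p * (sin (Omega_angle g w F p) * normH g F p))%:E)%E.
Proof.
move=> rhoC srho rho0 comass oD hside hvol harea.
apply: le_trans (form_density_integral_le rhoC srho oD hside hvol) _.
case: o hside => [i|] hside; last first.
  (* In a patch without a face the divergence theorem leaves 0, and the boundary integrand is
     nonnegative. *)
  rewrite integral0; apply: integral_ge0 => p _; rewrite lee_fin mulr_ge0//; exact: boundary_integrand_ge0.
by apply: patch_current_boundary_le => //; split.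
Qed.

End PatchEstimate.

(** * Partition of unity *)

Section Bump.
Context {R : realType}.
Notation e_ i := (delta_mx 0 i).

(** The square of the positive part of [v]. It has derivative v + |v| with a quadratic remainder,
    and this derivative is continuous: a C^1 cutoff made of polynomials and absolute values. *)
Definition possq (v : R) : R^o := ((v + `|v|) / 2) ^+ 2.

Lemma possq_neg v : v <= 0 -> possq v = 0.
Proof. by move=> v0; rewrite /possq ler0_norm// subrr mul0r expr0n. Qed.

Lemma possq_pos v : 0 <= v -> possq v = v ^+ 2.
Proof. by move=> v0; rewrite /possq (ger0_norm v0); congr (_ ^+ 2); field. Qed.

Lemma possq_quadratic v k : `|possq (v + k) - possq v - k * (v + `|v|)| <= k ^+ 2.
Proof.
have [v0|v0] := leP 0 v; have [w0|w0] := leP 0 (v + k).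
- rewrite !possq_pos// (ger0_norm v0).
  have -> : (v + k) ^+ 2 - v ^+ 2 - k * (v + v) = k ^+ 2 by ring.
  by rewrite ger0_norm ?sqr_ge0.
- rewrite (possq_neg (ltW w0)) possq_pos// (ger0_norm v0).
  have -> : 0 - v ^+ 2 - k * (v + v) = - (v ^+ 2 + 2 * k * v) by ring.
  rewrite normrN ler_norml; apply/andP; split; nra.
- rewrite possq_pos// (possq_neg (ltW v0)) (ltr0_norm v0) subrr mulr0 !subr0 ger0_norm ?sqr_ge0//; nra.
- by rewrite (possq_neg (ltW w0)) (possq_neg (ltW v0)) (ltr0_norm v0) [v - v]subrr mulr0 !subr0 normr0 sqr_ge0.
Qed.

Lemma is_derive_quadratic (F : R -> R^o) (v l : R) :
  (forall k, `|F (v + k) - F v - k * l| <= k ^+ 2) -> is_derive v (1 : R) F l.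
Proof.
move=> HF; have H : (fun h : R => h^-1 *: ((F \o shift v) (h *: (1 : R^o)) - F v) : R^o) @ 0^' --> (l : R^o).
  apply/cvgrPdist_le => e e0; near=> h.
  have h0 : h != 0 by near: h; exact: nbhs_dnbhs_neq.
  rewrite /= /shift /= [h *: 1]mulr1 [h + v]addrC.
  have -> : l - h^-1 *: (F (v + h) - F v) = - (h^-1 * (F (v + h) - F v - h * l)).
    by rewrite [h^-1 *: _](_ : _ = h^-1 * (F (v + h) - F v))// [in RHS]mulrBr mulKf// opprB.
  rewrite normrN normrM normfV ler_pdivrMl ?normr_gt0//.
  apply: le_trans (HF h) _; rewrite -real_normK ?num_real// expr2 ler_wpM2l//.
  by near: h; apply: dnbhs0_le.
split; first by apply/cvg_ex; exists l.
exact: cvg_lim H.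
Unshelve. all: by end_near. Qed.

Lemma Ck1_possq d (U : set 'rV[R]_d) (u : 'rV[R]_d -> R^o) : open U -> Ck 1 U u ->
  Ck 1 U (fun x => possq (u x)).
Proof.
move=> oU Cu.
have dp (v : R) : is_derive (v : R^o) (1 : R^o) (possq : R^o -> R^o) (v + `|v|).
  by apply: is_derive_quadratic => k; exact: possq_quadratic.
have fp (v : R) : differentiable (possq : R^o -> R^o) v by apply/derivable1_diffP; exact: ex_derive.
have du x : U x -> differentiable u x by move=> Ux; exact: (Ck_differentiable1 (k := 0) oU Cu Ux).
have cu x : U x -> {for x, continuous u} by move=> Ux; exact: (Ck_continuous Cu Ux).
split=> [x Ux|i].
  apply: (@continuous_comp _ _ _ u (possq : R^o -> R^o)); first exact: cu.
  exact: differentiable_continuous.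
have dc x : U x -> differentiable (possq \o u) x by move=> Ux; apply: differentiable_comp; [exact: du|exact: fp].
split=> [x Ux|]; first by apply: diff_derivable; exact: dc.
apply: (Ck_ext (f := fun x => 'D_(e_ i) u x * (u x + `|u x|) : R^o)) => //.
  move=> x Ux; rewrite [RHS]deriveE; last exact: dc.
  rewrite diff_comp; [|exact: du|exact: fp]; rewrite /= diff1E; last exact: fp.
  by rewrite derive1E (@derive_val _ _ _ _ _ _ _ (dp (u x))) deriveE//; exact: du.
split=> // x Ux; apply: (@continuousM R); first exact: (Ck_continuous (Ck_derive i Cu) Ux).
apply: (@continuousD _ R^o); first exact: cu.
by apply: (@continuous_comp _ _ _ u (fun x : R => `|x|)); [exact: cu|exact: norm_continuous].
Qed.

Lemma Ck1_sub1 d (U : set 'rV[R]_d) (u : 'rV[R]_d -> R^o) : open U -> Ck 1 U u -> Ck 1 U (fun x => 1 - u x : R^o).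
Proof.
move=> oU Cu; have -> : (fun x => 1 - u x : R^o) = fun x => 1 + (-1) * u x.
  by apply/funext => x; rewrite mulN1r.
exact: (CkD oU (Ck_cst _ _ _) (CkM oU (Ck_cst _ _ _) Cu)).
Qed.

Lemma Ck_coord d k (U : set 'rV[R]_d) i : open U -> Ck k U (fun x => x 0 i : R^o).
Proof.
move=> oU; apply: (@Ck_entry R d 1 d k U (fun x => x) 0 i oU).
case: k => [|k]; first by split=> // x _; exact: cvg_id.
split=> [x _|j]; first exact: cvg_id.
split=> [x _|]; first exact: derivable_id.
have -> : 'D_(e_ j) (fun x : 'rV[R]_d => x) = fun _ => e_ j by apply/funext => x; exact: derive_id.
exact: Ck_cst.
Qed.

Variables (k : nat) (a : 'rV[R]_k) (r : R).
Hypothesis r0 : 0 < r.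

(* With s = max(0, 1 - t^2)^2, the factor 1 - max(0, 1 - 2 s)^2 vanishes when
   t^2 >= 1 and is 1 when s >= 1/2, in particular when t^2 <= 1/4.  It is only
   C^1, which is all that the divergence theorem needs. *)
Definition bump (x : 'rV[R]_k) : R^o :=
  \prod_i (1 - possq (1 - 2 * possq (1 - ((x 0 i - a 0 i) / r) ^+ 2))).

Lemma Ck1_bump (U : set 'rV[R]_k) : open U -> Ck 1 U bump.
Proof.
move=> oU; apply: (Ck_prod (f := fun i x => 1 - possq (1 - 2 * possq (1 - ((x 0 i - a 0 i) / r) ^+ 2)) : R^o) oU) => i _; apply: (Ck1_sub1 oU); apply: (Ck1_possq oU).
have C1 : Ck 1 U (fun x : 'rV[R]_k => (x 0 i - a 0 i) / r : R^o).
  apply: (CkM oU); last exact: Ck_cst.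
  exact: (CkD oU (Ck_coord _ _ oU) (Ck_cst _ _ _)).
have C2 : Ck 1 U (fun x : 'rV[R]_k => possq (1 - ((x 0 i - a 0 i) / r) ^+ 2)).
  exact: (Ck1_possq oU (Ck1_sub1 oU (CkM oU C1 C1))).
exact: (Ck1_sub1 oU (CkM oU (Ck_cst _ _ _) C2)).
Qed.

Lemma possq_le1 v : v <= 1 -> -1 <= v -> 0 <= possq v <= 1.
Proof.
move=> v1 v2; have [v0|v0] := leP 0 v; last by rewrite (possq_neg (ltW v0)); apply/andP; split; [exact: lexx|exact: ler01].
by rewrite possq_pos// sqr_ge0 expr_le1.
Qed.

Lemma bump_factor t : 0 <= 1 - possq (1 - 2 * possq (1 - t ^+ 2)) <= 1.
Proof.
have s1 : 0 <= possq (1 - t ^+ 2) <= 1.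
  have [v0|v0] := leP 0 (1 - t ^+ 2); last by rewrite (possq_neg (ltW v0)); apply/andP; split; [exact: lexx|exact: ler01].
  by apply: possq_le1; have := sqr_ge0 t; lra.
have /andP[? ?] : 0 <= possq (1 - 2 * possq (1 - t ^+ 2)) <= 1.
  by move: s1 => /andP[? ?]; apply: possq_le1; lra.
by apply/andP; split; lra.
Qed.

Lemma bump_ge0_le1 (x : 'rV[R]_k) : 0 <= bump x <= 1.
Proof.
apply/andP; split; first by apply: prodr_ge0 => i _; case/andP: (bump_factor ((x 0 i - a 0 i) / r)).
apply: prodr_ile1 => i _; exact: (bump_factor ((x 0 i - a 0 i) / r)).
Qed.

Lemma bump_support (x : 'rV[R]_k) : bump x != 0 -> box a r x.
Proof.
move=> bx i; rewrite leNgt; apply: contra bx => h.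
rewrite /bump (bigD1 i) //= mulf_eq0; apply/orP; left.
have t1 : 1 < ((x 0 i - a 0 i) / r) ^+ 2.
  rewrite -real_normK ?num_real// normrM normfV (gtr0_norm r0).
  by rewrite exprn_egt1// ltr_pdivlMr// mul1r.
rewrite [possq (1 - _ ^+ 2)]possq_neg; last by lra.
by rewrite mulr0 subr0 possq_pos// expr1n subrr.
Qed.

Lemma bump_eq1 (x : 'rV[R]_k) : (forall i, `|x 0 i - a 0 i| < r / 2) -> bump x = 1.
Proof.
move=> h; rewrite /bump big1// => i _.
set t := _ / r; have t1 : t ^+ 2 <= 1 / 4.
  have : `|t| <= 1 / 2.
    by rewrite normrM normfV (gtr0_norm r0) ler_pdivrMr// mulrC mulrA mulr1 ltW.
  rewrite -[t ^+ 2]real_normK ?num_real//; have := normr_ge0 t; nra.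
(* From t^2 <= 1/4, (1 - t^2)^2 >= (3/4)^2 = 9/16, which exceeds 1/2, so the argument 1 - 2 s of the
   outer [possq] is negative. *)
have s : 9 / 16 <= possq (1 - t ^+ 2) by rewrite possq_pos; nra.
by rewrite [possq (1 - 2 * _)]possq_neg ?subr0//; lra.
Qed.

End Bump.

Section C1Functions.
Context {R : realType} {m : nat} {M : manifold R m.+1}.
Implicit Types (phi psi : M -> R) (c : chart R m.+1 M).

Lemma C1_function1B phi : C1_function phi -> C1_function (fun p => 1 - phi p).
Proof. by move=> Cf c sc; exact: (Ck1_sub1 (open_chart_cod c) (Cf c sc)). Qed.

Lemma C1_functionM phi psi : C1_function phi -> C1_function psi -> C1_function (fun p => phi p * psi p).
Proof. by move=> Cf Cg c sc; exact: (CkM (open_chart_cod c) (Cf c sc) (Cg c sc)). Qed.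

Lemma C1_function_prod k (phi : 'I_k -> M -> R) : (forall j, C1_function (phi j)) ->
  C1_function (fun p => \prod_(j < k) phi j p).
Proof.
move=> Cf c sc.
exact: (Ck_prod (P := xpredT) (f := fun j z => phi j (chart_inv c z) : R^o) (open_chart_cod c) (fun j _ => Cf j c sc)).
Qed.

Lemma C1_function_cst (v : R) : C1_function (fun _ : M => v).
Proof. by move=> c sc; exact: Ck_cst. Qed.

Section ChartBump.
Variables (c : chart R m.+1 M) (a : 'rV[R]_m.+1) (r : R).
Hypotheses (sc : smooth_chart c) (r0 : 0 < r) (boxc : box a r `<=` chart_cod c).

Definition chart_bump (p : M) : R := if `[<chart_dom c p>] then bump a r (chart_map c p) else 0.

Lemma chart_bump_ge0_le1 p : 0 <= chart_bump p <= 1.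
Proof.
rewrite /chart_bump; case: ifP => _; first exact: bump_ge0_le1.
by rewrite lexx ler01.
Qed.

Lemma chart_bump_supported : supported c a r chart_bump.
Proof.
move=> p; rewrite /chart_bump; case: ifP => [/asboolP cp /eqP bp|//].
by split=> //; exact: bump_support bp.
Qed.

Lemma chart_bump_eq1 p : chart_dom c p -> ball a (r / 2) (chart_map c p) -> chart_bump p = 1.
Proof.
move=> cp ba; rewrite /chart_bump asboolT//; apply: (bump_eq1 r0) => i.
by rewrite distrC; exact: (ba.2 0 i).
Qed.

(** On the domain of [c] the bump is a composition of C^1 maps; at any other point it vanishes
    nearby, by [supported_near]. *)
Lemma C1_chart_bump : C1_function chart_bump.
Proof.
move=> c' sc'; apply: Ck_local => z c'z; have [cp|cp] := pselect (chart_dom c (chart_inv c' z)).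
  exists (chart_overlap c' c); split; first exact/chart_overlapE.
  have oV := open_overlap c' c.
  have C := Ck_comp oV (open_chart_cod c) _ (smooth_transition sc' sc 1) (Ck1_bump a r (open_chart_cod c)).
  apply: (Ck_ext oV _ (C _)) => [y /chart_overlapE[_ cy]|y /chart_overlapE[_ cy]].
    by rewrite /chart_bump asboolT.
  exact: chart_mem_cod cy.
have := supported_near boxc chart_bump_supported (p := chart_inv c' z).
move=> /(_ (fun h => cp h.1)) near0.
have near1 : \forall y \near z, chart_bump (chart_inv c' y) = 0.
  exact: (chart_inv_continuous c'z) near0.
have [V [[oV Vz] V0]] : exists V, open_nbhs z V /\ V `<=` [set y | chart_bump (chart_inv c' y) = 0].
  by move: near1; rewrite /prop_near1 nbhsE => -[V ? ?]; exists V.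
exists V; split=> //; apply: (Ck_ext oV _ (Ck_cst 1 V (0 : R^o))) => y /V0 /= ->.
by [].
Qed.

End ChartBump.

(** The share taken by [psi k] of what the earlier functions leave of 1. The sums telescope to 1 -
    prod (1 - psi_j), which is 1 wherever some psi_j is 1, so the family is normalized without any
    division. *)
Definition partition_term (psi : nat -> M -> R) k (p : M) : R := psi k p * \prod_(j < k) (1 - psi j p).

Section Partition.
Variable psi : nat -> M -> R.
Hypothesis psi01 : forall j p, 0 <= psi j p <= 1.

Lemma partition_term_ge0 k p : 0 <= partition_term psi k p.
Proof.
apply: mulr_ge0; first by case/andP: (psi01 k p).
by apply: prodr_ge0 => j _; rewrite subr_ge0; case/andP: (psi01 j p).
Qed.

Lemma sum_partition_term n p : \sum_(k < n) partition_term psi k p = 1 - \prod_(j < n) (1 - psi j p).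
Proof.
elim: n => [|n IH]; first by rewrite !big_ord0 subrr.
by rewrite !big_ord_recr /= IH /partition_term; ring.
Qed.

Lemma sum_partition_term1 n j p : (j < n)%N -> psi j p = 1 -> \sum_(k < n) partition_term psi k p = 1.
Proof.
move=> jn p1; rewrite sum_partition_term (bigD1 (Ordinal jn))//=.
by rewrite p1 subrr mul0r subr0.
Qed.

Lemma partition_term_supported c a r k : supported c a r (psi k) -> supported c a r (partition_term psi k).
Proof. by move=> sk p np; apply: sk => p0; apply: np; rewrite /partition_term p0 mul0r. Qed.

Lemma C1_partition_term k : (forall j, C1_function (psi j)) -> C1_function (partition_term psi k).
Proof.
move=> Cp; apply: C1_functionM => //; apply: (C1_function_prod (phi := fun j p => 1 - psi j p)) => j.
exact: C1_function1B.
Qed.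

End Partition.

End C1Functions.

(** * Covering a compact domain and gluing the patch estimates *)

Section BumpPatches.
Context {R : realType} {m d : nat}.
Variables (M : manifold R m.+1) (N : manifold R d).
Variables (g : riem_metric N) (w : diff_form N m.+1) (F : M -> N).
Hypotheses (hw : closed_form w) (hF : immersion F) (hM : oriented M).

Notation e_ i := (delta_mx 0 i).

(** The density involves a derivative of [rho], so the sum has to be 1 near [p], not just at [p];
    then linearity of the currents in [rho] applies. *)
Lemma form_density_sum n (rho : nat -> M -> R) p : (forall k, C1_function (rho k)) ->
  (\forall q \near p, \sum_(k < n) rho k q = 1) ->
  \sum_(k < n) form_density g w F (rho k) p = form_density g w F (fun=> 1) p.
Proof.
move=> rhoC near1; have [c [b [eps [P cp]]]] := patch_at hF hM p.
have cx := chart_mem_cod cp.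
pose L := local_dataP g hw hF (op_source P) (op_target P) (op_maps P).
have v0 := volume_density_gt0 g hw hF (op_source P) (op_target P) (op_maps P) cx.
pose f := local_map F c b; pose H := mean_curvature f (g b).
pose J phi j : 'rV[R]_m.+1 -> R^o := current f (w b) (fun z => phi (chart_inv c z) *: H z) j.
have E phi : C1_function phi ->
    form_density g w F phi p = eps * (\sum_j 'D_(e_ j) (J phi j) (chart_map c p)) / volume_density g F c (chart_map c p).
  move=> Cphi; apply: (eq_divr v0); apply: etrans (form_density_at g hw hF P Cphi cp erefl) _.
  apply: f_equal; exact: (exterior_density_current L (Ck_scaled g hw hF P Cphi) cx).
rewrite (eq_bigr _ (fun (k : 'I_n) _ => E _ (rhoC k))) (E _ (C1_function_cst 1)).
rewrite -mulr_suml -mulr_sumr exchange_big /=; apply: f_equal2 => //; apply: f_equal.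
apply: eq_bigr => j _.
have dJ k : derivable (J (rho k) j) (chart_map c p) (e_ j).
  exact: (Ck_derivable (i := j) (Ck_current L j (Ck_scaled g hw hF P (rhoC k))) cx).
apply: etrans (esym (derive_sum (h := fun k : 'I_n => J (rho k) j) (fun k => dJ k))) _.
apply: near_eq_derive.
have near2 : \forall z \near chart_map c p, \sum_(k < n) rho k (chart_inv c z) = 1.
  have ci := chart_inv_continuous cx; rewrite /prop_for /continuous_at (chart_mapK cp) in ci.
  exact: ci near1.
have near3 : \forall z \near chart_map c p, chart_cod c z by exact: near_open (open_chart_cod c) cx _.
apply: filterS2 near2 near3 => z z1 cz; rewrite fct_sumE.
have wl := ld_multilinear L (ld_maps L cz).
under eq_bigr do rewrite /J /current (multilinearZ wl).
rewrite -mulr_suml z1 /J /current; exact: (esym (multilinearZ wl _ _ _ _)).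
Qed.

(** The bump is supported in the box of radius [bp_radius] and is 1 on the concentric ball of half
    the radius; these balls are the cores used for the covering. [bp_side] tells whether a face of
    [D] cuts the patch. *)
Record bump_patch (D : set M) := BumpPatch {
  bp_source : chart R m.+1 M;
  bp_target : chart R d N;
  bp_sign : R;
  bp_center : 'rV[R]_m.+1;
  bp_radius : R;
  bp_side : option 'I_m.+1;
  bp_oriented : oriented_patch F bp_source bp_target bp_sign;
  bp_radius_gt0 : 0 < bp_radius;
  bp_box : box bp_center bp_radius `<=` chart_cod bp_source;
  bp_sideP : forall p, chart_dom bp_source p -> (D p <-> side bp_side (chart_map bp_source p)) }.

Definition bp_core D (X : bump_patch D) : set M :=
  chart_dom (bp_source X) `&` chart_map (bp_source X) @^-1` ball (bp_center X) (bp_radius X / 2).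

Lemma open_bp_core D (X : bump_patch D) : open (bp_core X).
Proof.
apply: open_preimage; [exact: chart_dom_open|exact: chart_map_continuous|exact: ball_open].
Qed.

Lemma bump_patch_exists (D W : set M) (c : chart R m.+1 M) (o : option 'I_m.+1) p :
  smooth_chart c -> open W -> W p -> chart_dom c p ->
  (forall q, chart_dom c q -> W q -> (D q <-> side o (chart_map c q))) ->
  exists X : bump_patch D, bp_core X p.
Proof.
move=> sc oW Wp cp hside.
have [W' [oW' [b [eps [P W'p W'W]]]]] := oriented_patch_exists hF hM sc oW Wp cp.
set c' := restrict_chart c oW' in P.
have c'p : chart_dom c' p by [].
have : nbhs (chart_map c' p) (chart_cod c').
  by apply: open_nbhs_nbhs; split; [exact: open_chart_cod|exact: chart_mem_cod].
rewrite -nbhs_ballE => -[e /= e0 ec].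
(* Halving the radius puts a closed box inside the open ball. *)
have boxc : box (chart_map c' p) (e / 2) `<=` chart_cod c'.
  move=> x xb; apply: ec; split=> // i j; rewrite (ord1 i); have := xb j; rewrite distrC => xj.
  apply: (le_lt_trans xj); lra.
have e20 : 0 < e / 2 by rewrite divr_gt0.
have hs q : chart_dom c' q -> (D q <-> side o (chart_map c' q)).
  by move=> [cq W'q]; apply: hside => //; exact: W'W.
exists (BumpPatch P e20 boxc hs); split=> //=.
apply: ballxx; exact: divr_gt0 e20 _.
Qed.

(** At a point of [D] the patch is shrunk into [D], so that no face appears; at a boundary point the
    straightening chart is used. *)
Lemma compact_domain_patch (D : set M) p : compact_domain D -> closure D p ->
  exists X : bump_patch D, bp_core X p.
Proof.
move=> [oD [_ hb]] clp; have [Dp|Dp] := pselect (D p).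
  apply: (bump_patch_exists (o := None) (chart_at_smooth p) oD Dp (chart_at_dom p)) => q _ Dq.
  by split.
have [c [i [[sc hs] cp]]] := hb p (conj clp Dp).
by apply: (bump_patch_exists (o := Some i) sc openT I cp) => q cq _; exact: hs.
Qed.

Lemma compact_domain_patches (D : set M) p0 : compact_domain D -> closure D p0 ->
  exists n (X : nat -> bump_patch D), forall p, closure D p -> exists2 k, (k < n)%N & bp_core (X k) p.
Proof.
move=> hD clp0; have [X0 _] := compact_domain_patch hD clp0.
(* [X0] is a default off the closure, so that [choice] can be applied over all points. *)
have : forall p, exists X : bump_patch D, closure D p -> bp_core X p.
  by move=> p; have [/(compact_domain_patch hD)[X ?]|?] := pselect (closure D p); [exists X|exists X0].
move=> /choice[X HX]; have [_ [cD _]] := hD.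
move: cD; rewrite compact_cover => /(_ M (closure D) (fun p => bp_core (X p))).
case=> [p _|p clp|E _ HE]; first exact: open_bp_core.
  by exists p => //; exact: HX.
exists (size (finmap.enum_fset E)), (fun k => X (nth p0 (finmap.enum_fset E) k)) => p /HE[q /= qE qp].
by exists (index q (finmap.enum_fset E)); rewrite ?index_mem// nth_index.
Qed.

Section Assembly.
Variables (D : set M) (n : nat) (X : nat -> bump_patch D).
Hypothesis oD : open D.
Hypothesis coverX : forall p, closure D p -> exists2 k, (k < n)%N & bp_core (X k) p.

Let psi k := chart_bump (bp_source (X k)) (bp_center (X k)) (bp_radius (X k)).
Let rho := partition_term psi.

Let psi01 k p : 0 <= psi k p <= 1.
Proof. exact: chart_bump_ge0_le1. Qed.

Let rhoC k : C1_function (rho k).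
Proof.
apply: C1_partition_term => j; apply: C1_chart_bump; first exact: op_source (bp_oriented (X j)).
- exact: bp_radius_gt0.
- exact: bp_box.
Qed.

Let rho_supported k : supported (bp_source (X k)) (bp_center (X k)) (bp_radius (X k)) (rho k).
Proof. apply: partition_term_supported; apply: chart_bump_supported; exact: bp_radius_gt0. Qed.

Let rho_near1 p : closure D p -> \forall q \near p, \sum_(k < n) rho k q = 1.
Proof.
move=> /coverX[k kn kp]; apply: (near_open (@open_bp_core D (X k)) kp) => q [cq bq].
apply: (sum_partition_term1 kn); exact: (chart_bump_eq1 (bp_radius_gt0 (X k)) cq bq).
Qed.

Let rho1 p : closure D p -> \sum_(k < n) rho k p = 1.
Proof. by move=> /rho_near1/nbhs_singleton. Qed.

Let scaled_continuous phi k : (forall p, {for p, continuous (phi : M -> R^o)}) ->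
  forall p, {for p, continuous ((fun p => rho k p * phi p) : M -> R^o)}.
Proof. by move=> cphi p; apply: (@continuousM R); [exact: C1_function_continuous|exact: cphi]. Qed.

Let scaled_supported (phi : M -> R) k :
  supported (bp_source (X k)) (bp_center (X k)) (bp_radius (X k)) (fun p => rho k p * phi p).
Proof. by move=> p np; apply: rho_supported => r0; apply: np; rewrite r0 mul0r. Qed.

Section Volume.
Variable vol : {measure set (borel M) -> \bar R}.
Hypothesis hvol : is_volume_measure g F vol.

Let mD : measurable (D : set (borel M)).
Proof. exact: sub_sigma_algebra. Qed.

(** On [D] the function is the finite sum of its products with the partition functions, and each
    product is continuous and supported in a compact box of a chart. *)
Lemma domain_integrable (phi : M -> R) : (forall p, {for p, continuous (phi : M -> R^o)}) ->
  vol.-integrable (D : set (borel M)) (EFin \o phi).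
Proof.
move=> cphi; apply: (eq_integrable mD (fun p : borel M => \sum_(k < n) (rho k p * phi p)%:E)%E).
  move=> p /set_mem Dp; rewrite sumEFin -mulr_suml rho1 ?mul1r//; exact: subset_closure.
apply: (integrable_sum mD) => k _.
have := supported_integrable hw hF (bp_oriented (X k)) (@bp_box D (X k)) hvol (phi := fun p => rho k p * phi p).
apply; [exact: scaled_continuous|exact: scaled_supported|exact: mD].
Qed.

Lemma domain_integral_form_density :
  (\int[vol]_(p in D) (form_density g w F (fun=> 1) p)%:E =
   \sum_(k < n) \int[vol]_(p in D) (form_density g w F (rho k) p)%:E)%E.
Proof.
rewrite -(integral_sum mD (f := fun (k : 'I_n) (p : borel M) => (form_density g w F (rho k) p)%:E)).
  apply: eq_integral => p /set_mem Dp; rewrite sumEFin.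
  by rewrite (form_density_sum rhoC (rho_near1 (subset_closure Dp))).
move=> k; exact: (domain_integrable (fun p => continuous_form_density hw hF hM (p := p) (rhoC k))).
Qed.

End Volume.

Section Area.
Variable area : {measure set (borel M) -> \bar R}.
Hypothesis harea : is_boundary_measure g F D area.
Variable phi : M -> R.
Hypothesis cphi : forall p, {for p, continuous (phi : M -> R^o)}.

Let mB : measurable (bdry D : set (borel M)) := measurable_bdry oD.

Let scaled_area_integrable k :
  area.-integrable (bdry D : set (borel M)) (fun p => (rho k p * phi p)%:E).
Proof.
case E : (bp_side (X k)) => [i|]; last first.
  (* A patch without a face lies entirely in [D], so its partition function vanishes on the
     boundary. *)
  apply: (eq_integrable mB (cst 0%E)); last exact: integrable0.
  move=> p /set_mem[clp Dp]; apply/esym; congr EFin; apply: contrapT => /scaled_supported[cp _].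
  by apply: Dp; apply/(bp_sideP cp); rewrite E.
have st : straightens D (bp_source (X k)) i.
  split; first exact: op_source (bp_oriented (X k)).
  by move=> p cp; rewrite (bp_sideP cp) E.
have := supported_area_integrable hw hF (bp_oriented (X k)) (@bp_box D (X k)) oD st harea (phi := fun p => rho k p * phi p).
apply; [exact: scaled_continuous|exact: scaled_supported].
Qed.

Let sum_on_bdry p : p \in bdry D -> (phi p)%:E = (\sum_(k < n) (rho k p * phi p)%:E)%E.
Proof. by move=> /set_mem[clp _]; rewrite sumEFin -mulr_suml rho1 ?mul1r. Qed.

Lemma bdry_integrable : area.-integrable (bdry D : set (borel M)) (EFin \o phi).
Proof.
apply: (eq_integrable mB (fun p : borel M => \sum_(k < n) (rho k p * phi p)%:E)%E).
  by move=> p pB; rewrite -sum_on_bdry.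
apply: (integrable_sum mB) => k _; exact: scaled_area_integrable.
Qed.

Lemma bdry_integral_sum :
  (\int[area]_(p in bdry D) (phi p)%:E =
   \sum_(k < n) \int[area]_(p in bdry D) (rho k p * phi p)%:E)%E.
Proof.
rewrite -(integral_sum mB (f := fun (k : 'I_n) (p : borel M) => (rho k p * phi p)%:E)).
  by apply: eq_integral => p; exact: sum_on_bdry.
by move=> k; exact: scaled_area_integrable.
Qed.

End Area.

Variables (vol area : {measure set (borel M) -> \bar R}).
Hypotheses (hvol : is_volume_measure g F vol) (harea : is_boundary_measure g F D area).
Hypothesis comass : comass_one g w.

(** The triangle inequality over the patches gives a sum of boundary integrals weighted by the
    partition functions, whose weights add up to 1 on the boundary. *)
Lemma form_density_integral_bound :
  (`|\int[vol]_(p in D) (form_density g w F (fun=> 1) p)%:E| <=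
   \int[area]_(p in bdry D) (sin (Omega_angle g w F p) * normH g F p)%:E)%E.
Proof.
rewrite (domain_integral_form_density hvol).
rewrite (bdry_integral_sum harea (fun p => continuous_boundary_integrand hw hF hM (p := p) comass)).
apply: le_trans (lee_abs_sum _ _ _) _; apply: lee_sum => k _.
apply: (patch_estimate hw hF hM (bp_oriented (X k)) (@bp_box D (X k)) (o := bp_side (X k))) => //.
- by move=> p; exact: partition_term_ge0.
- by move=> p; exact: bp_sideP.
Qed.

Lemma calibration_estimate :
  `|\int[vol]_(p in D) (- (m.+1)%:R * cos (Omega_angle g w F p) * normH g F p ^+ 2 + nablaH_Phi g w F p)
    + \int[vol]_(p in D) nablaH_Omega g w F p|
  <= \int[area]_(p in bdry D) (sin (Omega_angle g w F p) * normH g F p).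
Proof.
have mD : measurable (D : set (borel M)) by exact: sub_sigma_algebra.
pose A p := - (m.+1)%:R * cos (Omega_angle g w F p) * normH g F p ^+ 2 + nablaH_Phi g w F p.
have AE p : A p = form_density g w F (fun=> 1) p - nablaH_Omega g w F p.
  by rewrite (form_density1 hw hF p comass) addrK.
have cB p := continuous_nablaH_Omega (g := g) hw hF hM (p := p).
have cf p := continuous_form_density (g := g) hw hF hM (p := p) (C1_function_cst 1).
have iB := domain_integrable hvol cB.
have iA : vol.-integrable (D : set (borel M)) (EFin \o A).
  (* The geometric integrand involves frames and [Phi]; it is recognized as a difference of two
     functions already known to be continuous. *)
  have -> : A = fun p => form_density g w F (fun=> 1) p - nablaH_Omega g w F p by apply/funext => q; exact: AE.
  apply: (domain_integrable hvol) => p; by apply: (@continuousB R R^o); [exact: cf|exact: cB].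
rewrite -(RintegralD mD iA iB).
have -> : \int[vol]_(p in D) (A p + nablaH_Omega g w F p) = \int[vol]_(p in D) form_density g w F (fun=> 1) p.
  by apply: eq_Rintegral => p _; rewrite AE subrK.
have := form_density_integral_bound.
(* Both integrals are finite, so the inequality between extended reals is one between the
   real-valued integrals. *)
have i1 := integrable_fin_num mD (domain_integrable hvol cf).
have i2 := integrable_fin_num (measurable_bdry oD)
  (bdry_integrable harea (fun p => continuous_boundary_integrand hw hF hM (p := p) comass)).
by rewrite /= -(fineK i1) -(fineK i2) lee_fin.
Qed.

End Assembly.

End BumpPatches.

Theorem theorem1p2 (R : realType) (m n : nat)
    (N : manifold R (m.+2 + n)) (g : riem_metric N)
    (Omega : diff_form N m.+2) (hOmega : calibration g Omega)
    (M : manifold R m.+2) (hM : oriented M)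
    (F : M -> N) (hF : immersion F)
    (vol : {measure set (borel M) -> \bar R}) (hvol : is_volume_measure g F vol)
    (D : set M) (hD : compact_domain D)
    (area : {measure set (borel M) -> \bar R})
    (harea : is_boundary_measure g F D area) :
  let theta := Omega_angle g Omega F in
  `| \int[vol]_(p in D) (- (m.+2)%:R * cos (theta p) * normH g F p ^+ 2
                         + nablaH_Phi g Omega F p)
     + \int[vol]_(p in D) nablaH_Omega g Omega F p |
  <= \int[area]_(p in bdry D) (sin (theta p) * normH g F p).
Proof.
have [hw comass] := hOmega.
(* Enumerating a finite cover takes a default point; when the closure is empty both sides are 0. *)
have [[p0 clp0]|D0] := pselect (exists p, closure D p).
  have [k [X HX]] := compact_domain_patches hF hM hD clp0.
  exact: (calibration_estimate hw hF hM hD.1 HX hvol harea comass).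
have -> : D = set0 by apply/seteqP; split=> // p Dp; apply: D0; exists p; exact: subset_closure.
by rewrite /= !Rintegral_set0 addr0 normr0 /bdry closure0 set0D Rintegral_set0.
Qed.
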